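(* A function $g\in L^1$ belongs to the range space $T(L\log L)$ if and only if it satisfies both $\widehat T(g)\in L\log L$ and $T(\widehat T(g))=g$. That is, $$T(L\log L)=\big\{g\in L^1:\ \widehat T(g)\in L\log L,\ T(\widehat T(g))=g\big\}.$$
   Context: All functions are complex-valued, Lebesgue measurable on $(-1,1)$, identified when equal a.e.; $L^1=L^1(-1,1)$. The decreasing rearrangement of $f$ is $f^*(t)=\inf\{\lambda\ge 0: |\{x\in(-1,1):|f(x)|>\lambda\}|\le t\}$, $0<t<2$. The Zygmund space $L\log L=L\log L(-1,1)$ consists of all measurable $f$ with $\|f\|_{L\log L}:=\int_0^2 f^*(t)\log\big(\tfrac{2e}{t}\big)\,dt<\infty$ (equivalently $\int_{-1}^1|f|\log^+|f|<\infty$); it is contained in $L^1$. For $f\in L^1$ the finite Hilbert transform is $$T(f)(t)=\lim_{\varepsilon\to0^+}\frac1\pi\Big(\int_{-1}^{t-\varepsilon}+\int_{t+\varepsilon}^1\Big)\frac{f(x)}{x-t}\,dx ,$$ which exists for a.e. $t\in(-1,1)$ and is measurable; $T$ maps $L\log L$ boundedly into $L^1$. For $g\in L^1$ the measurable function $\widehat T(g)$ is defined by $$\widehat T(g)(x)=\frac{-1}{\sqrt{1-x^2}}\,T\big(\sqrt{1-t^2}\,g(t)\big)(x)\quad\text{for a.e. }x\in(-1,1).$$ *)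

(* Defs.v *)
From HB Require Import structures.
From mathcomp Require Import all_boot all_order all_algebra.
From mathcomp Require Import complex.
From mathcomp Require Import all_classical all_reals all_analysis.

Set Implicit Arguments.
Unset Strict Implicit.
Unset Printing Implicit Defensive.
Import Order.TTheory GRing.Theory Num.Theory.
Import numFieldNormedType.Exports.
Local Open Scope classical_set_scope.
Local Open Scope ring_scope.
Local Open Scope complex_scope.

(* The real line with the sigma-algebra of Lebesgue measurable sets, i.e. the
   Caratheodory sigma-algebra of the outer Lebesgue measure. The canonical
   sigma-algebra on R is the (smaller) Borel one. *)
Definition lebesgueTypeR (R : realType) : Type := R.

HB.instance Definition _ (R : realType) := Measurable.copy (lebesgueTypeR R)
  (caratheodory_type (@mu_ext _ (ocitv_type R) R (@wlength R idfun))).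

Definition leb {R : realType} : set (lebesgueTypeR R) -> \bar R :=
  @completed_lebesgue_measure R.

HB.instance Definition _ (R : realType) :=
  SigmaFiniteMeasure.copy (@leb R) (@completed_lebesgue_measure R).

(* Functions on (-1,1) are represented by total functions on R whose values
   outside (-1,1) are irrelevant. *)
Notation itvm11 R := (`]-1, 1[%classic : set (lebesgueTypeR R)).

Notation rearr_itv R := (`]0, 2[%classic : set (lebesgueTypeR R)).

Section finite_hilbert_transform.
Context {R : realType}.
Implicit Types (f g : lebesgueTypeR R -> R[i]) (D : set (lebesgueTypeR R)).

Definition cmeasurable_fun D f :=
  measurable_fun D (fun x => complex.Re (f x)) /\
  measurable_fun D (fun x => complex.Im (f x)).

Definition ae_eq_itvm11 f g := {ae leb, forall x, itvm11 R x -> f x = g x}.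

Definition Cintegral D f : R[i] :=
  (\int[leb]_(x in D) complex.Re (f x))%R +i*
  (\int[leb]_(x in D) complex.Im (f x))%R.

Definition L1 : set (lebesgueTypeR R -> R[i]) :=
  [set f | cmeasurable_fun (itvm11 R) f /\
    (\int[leb]_(x in itvm11 R) (Normc.normc (f x))%:E < +oo)%E].

Definition decr_rearr f (t : R) : \bar R :=
  ereal_inf [set l%:E | l in [set l : R | 0 <= l /\
    (leb [set x | itvm11 R x /\ (l < Normc.normc (f x))%R] <= t%:E)%E]].

Definition LlogL_norm f : \bar R :=
  (\int[leb]_(t in rearr_itv R)
     (decr_rearr f t * (ln (2 * expR 1 / t))%:E))%E.

Definition LlogL : set (lebesgueTypeR R -> R[i]) :=
  [set f | cmeasurable_fun (itvm11 R) f /\ (LlogL_norm f < +oo)%E].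

Definition truncated_hilbert f (t e : R) : R[i] :=
  (pi^-1)%:C *
    (Cintegral `]-1, t - e[%classic (fun x => f x / (x - t)%:C) +
     Cintegral `]t + e, 1[%classic (fun x => f x / (x - t)%:C)).

(* At the points t where the limit fails to exist (a null set when f is in L1),
   the value is the default one of lim. *)
Definition fht f : lebesgueTypeR R -> R[i] := fun t =>
  lim ((truncated_hilbert f t e : (R[i] : numFieldType)) @[e --> 0^'+]).

Definition fht_hat g : lebesgueTypeR R -> R[i] := fun x =>
  (- 1 / Num.sqrt (1 - x ^+ 2))%:C *
    fht (fun t => (Num.sqrt (1 - t ^+ 2))%:C * g t) x.

(* The range T(LlogL), functions being identified when equal a.e. *)
Definition fht_range_LlogL : set (lebesgueTypeR R -> R[i]) :=
  [set g | exists2 f, LlogL f & ae_eq_itvm11 (fht f) g].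

End finite_hilbert_transform.

(* Main.v *)
(** Write S(x) = sqrt(1 - x^2), w = 1/S, and T_s f for the Hilbert transform regularised by the
    conjugate Poisson kernel.

    If |sg| <= 1 and C is the Cauchy transform of sg, then exp(al C) is holomorphic and, for al
    small, its real part is comparable to |exp(al C)|; integrating it over [-2,2] x {s} bounds
    the integral of exp(al |T_s sg|) uniformly in s.  By duality and Young's inequality, T_s is
    bounded from L log L to L^1(-1,1) uniformly in s, hence T_s f converges in L^1(-1,1) for every f
    in L log L, the limit being T f by the behaviour at Lebesgue points.

    Pairing T_s f with S(x)/(x - z), z = t + i y, and using T S (x) = - x, gives in the limit
    s -> 0 a closed formula for the Cauchy transform of S Tf at z in terms of those of f and S.
    Letting y -> 0 at a Lebesgue point yields T(S Tf) = (1/pi) int f - S f, that is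
    That(Tf) = f - c w with c = (1/pi) int f.  As w is in L log L and T w = 0, That(Tf) is in L log L
    and T(That(Tf)) = Tf. *)

Require Import Defs.
From mathcomp Require Import all_boot all_order all_algebra.
From mathcomp Require Import complex.
From mathcomp Require Import all_classical all_reals all_analysis.
From mathcomp Require Import measurable_realfun lebesgue_integral_differentiation.
From mathcomp Require Import lebesgue_integral_under lebesgue_Rintegral.
From mathcomp Require Import ring lra.

Set Implicit Arguments.
Unset Strict Implicit.
Unset Printing Implicit Defensive.
Import Order.TTheory GRing.Theory Num.Theory.
Import numFieldNormedType.Exports.
Local Open Scope classical_set_scope.
Local Open Scope ring_scope.
Local Open Scope complex_scope.

(** * Integrals of real functions over the line *)

Section integrals.
Context {R : realType}.
Notation mu := (@lebesgue_measure R).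
Implicit Types f g k : R -> R.

(** Regularising by the Poisson kernels rather than by truncation pays twice: [1 / (u - i s)] is
    holomorphic, which gives the exponential bound, and it obeys the resolvent identity, which gives
    the closed formula for the Cauchy transform of S Tf. Truncations return only at the end: they
    differ from the regularisations by a kernel of mass zero dominated by the Poisson kernel, whose
    effect vanishes at Lebesgue points.

    The obstacle is that L log L is an endpoint class, on which both the L^1 convergence and the
    a.e. existence of Tf are delicate. The former is proved by density of Lipschitz functions. The
    latter is read off from the imaginary part of the closed formula: there the regularised
    transform of [f] at [t] is multiplied by a factor tending to pi S(t), which is not zero, so it
    can be solved for.

    All the work lies in one inclusion; for the other, That(g) is itself a preimage of g. The
    analysis is done for real Borel functions vanishing off (-1,1), and applied to real and
    imaginary parts. In it [conv] carries no factor 1/pi, so the limit function [G] is pi Tf; the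
    factor returns with the complex-valued functions. *)

Definition L1r f := mu.-integrable setT (EFin \o f).
Definition Int f : R := \int[mu]_x f x.

Lemma aeS (P Q : R -> Prop) : (forall x, P x -> Q x) ->
  {ae mu, forall x, P x} -> {ae mu, forall x, Q x}.
Proof. by move=> PQ; apply: filterS; first exact: (ae_filter_ringOfSetsType mu). Qed.

Lemma aeI (P Q : R -> Prop) : {ae mu, forall x, P x} -> {ae mu, forall x, Q x} ->
  {ae mu, forall x, P x /\ Q x}.
Proof. by move=> aP aQ; apply: filterI => //; exact: (ae_filter_ringOfSetsType mu). Qed.

Lemma EFin_meas f : measurable_fun setT f ->
  measurable_fun (setT : set (measurableTypeR R)) (EFin \o f).
Proof. by move/measurable_EFinP. Qed.

Lemma L1r_meas f : L1r f -> measurable_fun setT f.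
Proof. by move=> /integrableP[/measurable_EFinP]. Qed.

Lemma L1rM_bounded f k C : L1r f -> measurable_fun setT k ->
  (forall x, `|k x| <= C) -> L1r (fun x => f x * k x).
Proof.
move=> Lf mk kC.
have -> : (fun x => f x * k x) = (f \* k) by [].
rewrite /L1r.
have -> : EFin \o (f \* k) = ((EFin \o f) \* (EFin \o k))%E.
  by apply/funext => x /=; rewrite EFinM.
apply: integrableMl => //.
exists C; split; first exact: num_real.
by move=> M CM x _ /=; rewrite (le_trans (kC x))// ltW.
Qed.

Lemma L1rD f g : L1r f -> L1r g -> L1r (fun x => f x + g x).
Proof. by move=> Lf Lg; have := integrableD measurableT Lf Lg. Qed.

Lemma L1rB f g : L1r f -> L1r g -> L1r (fun x => f x - g x).
Proof. by move=> Lf Lg; have := integrableB measurableT Lf Lg. Qed.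

Lemma L1rZ c f : L1r f -> L1r (fun x => c * f x).
Proof. by move=> Lf; have := integrableZl measurableT c Lf. Qed.

Lemma L1rN f : L1r f -> L1r (fun x => - f x).
Proof. by move=> Lf; have := integrableN Lf. Qed.

Lemma L1r_abs f : L1r f -> L1r (fun x => `|f x|).
Proof. by move=> Lf; have := integrable_abse Lf. Qed.

Lemma L1r_le f g : measurable_fun setT f -> L1r g ->
  (forall x, `|f x| <= g x) -> L1r f.
Proof.
move=> mf Lg fg; apply: (le_integrable measurableT _ _ Lg).
  exact: EFin_meas.
by move=> x _ /=; rewrite lee_fin (le_trans (fg x))// ler_norm.
Qed.

Lemma IntD f g : L1r f -> L1r g -> Int (fun x => f x + g x) = Int f + Int g.
Proof. by move=> Lf Lg; rewrite /Int RintegralD. Qed.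

Lemma IntB f g : L1r f -> L1r g -> Int (fun x => f x - g x) = Int f - Int g.
Proof. by move=> Lf Lg; rewrite /Int RintegralB. Qed.

Lemma IntZ c f : L1r f -> Int (fun x => c * f x) = c * Int f.
Proof. by move=> Lf; rewrite /Int RintegralZl. Qed.

Lemma IntN f : L1r f -> Int (fun x => - f x) = - Int f.
Proof.
by move=> Lf; rewrite -mulN1r -IntZ//; apply: eq_Rintegral => x _; rewrite mulN1r.
Qed.

Lemma Int_le f g : L1r f -> L1r g -> (forall x, f x <= g x) -> Int f <= Int g.
Proof. by move=> Lf Lg fg; apply: le_Rintegral. Qed.

Lemma Int_ge0 f : (forall x, 0 <= f x) -> 0 <= Int f.
Proof. by move=> f0; apply: Rintegral_ge0. Qed.

Lemma Int_abs f : L1r f -> `|Int f| <= Int (fun x => `|f x|).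
Proof. by move=> Lf; apply: le_normr_Rintegral. Qed.

Lemma Int_abs_le f g : L1r f -> L1r g -> (forall x, `|f x| <= g x) ->
  `|Int f| <= Int g.
Proof.
move=> Lf Lg fg; apply: (le_trans (Int_abs Lf)); apply: Int_le => //.
exact: L1r_abs.
Qed.

Lemma eq_Int f g : f =1 g -> Int f = Int g.
Proof. by move=> fg; congr Int; apply/funext. Qed.

Lemma EFin_Int f : L1r f -> (Int f)%:E = (\int[mu]_x (f x)%:E)%E.
Proof. by move=> Lf; rewrite /Int /Rintegral fineK//; apply: integrable_fin_num. Qed.

Lemma Int_ae f g : L1r f -> L1r g -> {ae mu, forall x, f x = g x} -> Int f = Int g.
Proof.
move=> Lf Lg fg; rewrite /Int /Rintegral; congr fine.
apply: ae_eq_integral => //; try exact: measurable_int Lf.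
  exact: measurable_int Lg.
by apply: aeS fg => x /= -> _.
Qed.

Lemma Int_cvg (f_ : nat -> R -> R) f g : (forall n, measurable_fun setT (f_ n)) ->
  measurable_fun setT f -> L1r g ->
  {ae mu, forall x, f_ n x @[n --> \oo] --> f x} ->
  (forall n x, `|f_ n x| <= g x) ->
  Int (f_ n) @[n --> \oo] --> Int f.
Proof.
move=> mf_ mf Lg ff fg.
have [] := @dominated_convergence _ _ _ mu _ measurableT
   (fun n => EFin \o f_ n) (EFin \o f) (EFin \o g).
- by move=> n; apply: EFin_meas.
- exact: EFin_meas.
- apply: aeS ff => x /= h _; apply: cvg_EFin => //.
  exact: nearW.
- exact: Lg.
- by apply: aeW => x n _ /=; rewrite lee_fin.
move=> Lf _ h.
rewrite /Int /Rintegral; apply: fine_cvg => /=.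
by rewrite fineK//; apply: integrable_fin_num.
Qed.

Lemma Int_cvgr (f_ : R -> R -> R) f g : (forall n, 0 < n -> measurable_fun setT (f_ n)) ->
  measurable_fun setT f -> L1r g ->
  {ae mu, forall x, f_ n x @[n --> 0^'+] --> f x} ->
  (forall n x, 0 < n -> `|f_ n x| <= g x) ->
  Int (f_ n) @[n --> 0^'+] --> Int f.
Proof.
move=> mf_ mf Lg ff fg.
apply/cvg_at_rightP => u [u0 u_cvg].
apply: (@Int_cvg (fun n => f_ (u n)) f g) => //.
- by move=> n; apply: mf_.
- by apply: aeS ff => x /cvg_at_rightP h; apply: h.
- by move=> n x; apply: fg.
Qed.

End integrals.

(** * Functions supported in (-1,1) *)

Section supported.
Context {R : realType}.
Notation mu := (@lebesgue_measure R).
Implicit Types f g k : R -> R.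

Definition supp f := forall x, ~~ (-1 < x < 1) -> f x = 0.

Lemma L1r_indic (A : set R) : measurable A -> (mu A < +oo)%E -> L1r (\1_A : R -> R).
Proof.
move=> mA Aoo.
apply/integrableP; split; first exact: EFin_meas.
under eq_integral do rewrite /= ger0_norm//.
by rewrite integral_indic// setIT.
Qed.

Lemma L1r_itv (i : interval R) : (mu [set` i] < +oo)%E -> L1r (\1_[set` i] : R -> R).
Proof. by move=> h; apply: L1r_indic. Qed.

Lemma L1r_bounded f C : measurable_fun setT f -> supp f -> (forall x, `|f x| <= C) ->
  L1r f.
Proof.
move=> mf sf fC.
have L : L1r (fun x => C * (\1_`]-1, 1[%classic x : R)).
  apply: L1rZ; apply: L1r_itv; rewrite lebesgue_measure_itv/=.
  by case: ifP => _; rewrite -?EFinB ltry.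
apply: L1r_le L _ => // x.
rewrite indicE mem_setE in_itv/=.
case: (boolP (-1 < x < 1)) => h; first by rewrite mulr1.
by rewrite sf// normr0 mulr0.
Qed.

Lemma Int_itv (i : interval R) f : Int (fun x => \1_[set` i] x * f x) =
  \int[mu]_(x in [set` i]) f x.
Proof.
rewrite [RHS]Rintegral_mkcond; apply: eq_Rintegral => x _.
rewrite patchE indicE; case: ifP => _; by rewrite ?mul1r ?mul0r.
Qed.

End supported.

(** * The fundamental theorem of calculus, on segments and up to open ends *)

Section ftc.
Context {R : realType}.
Notation mu := (@lebesgue_measure R).
Implicit Types F f : R -> R.

Lemma measurable_inv : measurable_fun setT (@GRing.inv R).
Proof.
have -> : [set: R] = ~` [set 0] `|` [set 0] by rewrite setUC setUCr.
apply/measurable_funU => //; first exact: measurableC.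
split; last exact: measurable_fun_set1.
apply: open_continuous_measurable_fun; first exact: closed_openC.
by move=> x; rewrite inE/= => /eqP x0; exact: inv_continuous.
Qed.

Lemma measurable_funV (f : R -> R) : measurable_fun setT f ->
  measurable_fun setT (fun x => (f x)^-1).
Proof. by move=> mf; apply: (measurableT_comp measurable_inv). Qed.

Lemma FTC F f (a b : R) : a < b -> (forall x, a <= x <= b -> is_derive x (1:R) F (f x)) ->
  (forall x, a <= x <= b -> {for x, continuous f}) ->
  mu.-integrable `[a, b] (EFin \o f) /\ \int[mu]_(x in `[a, b]) f x = F b - F a.
Proof.
move=> ab dF cf.
have cwf : {within `[a, b], continuous f}.
  apply: continuous_in_subspaceT => x; rewrite inE/= in_itv/=; exact: cf.
have Lf : mu.-integrable `[a, b] (EFin \o f).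
  by apply: continuous_compact_integrable => //; exact: segment_compact.
split => //.
have cF x : a <= x <= b -> {for x, continuous F}.
  move=> /dF h; apply: differentiable_continuous; apply/derivable1_diffP.
  exact: ex_derive.
rewrite /Rintegral (@continuous_FTC2 R f F a b)//; first by split => //;
  [move=> x; rewrite in_itv/= => /andP[ax xb]; have := dF x; rewrite !ltW// => /(_ isT) h;
   exact: ex_derive|
   apply: cvg_at_right_filter; apply: cF; rewrite lexx ltW//|
   apply: cvg_at_left_filter; apply: cF; rewrite lexx ltW//].
move=> x; rewrite in_itv/= => /andP[ax xb]; rewrite derive1E.
by have := dF x; rewrite !ltW// => /(_ isT) h; exact: derive_val.
Qed.

(** Monotone convergence along segments exhausting []a, b[]: as [f] is nonnegative, the finite limit
    of the integrals gives integrability as well as the value. This serves integrands that blow up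
    at an end, such as [wt]. *)
Lemma FTC_oo F f (a b la lb : R) : a < b ->
  (forall x, a < x < b -> is_derive x (1:R) F (f x)) ->
  (forall x, a < x < b -> {for x, continuous f}) ->
  (forall x, a < x < b -> 0 <= f x) ->
  F x @[x --> a^'+] --> la -> F x @[x --> b^'-] --> lb ->
  mu.-integrable `]a, b[ (EFin \o f) /\ \int[mu]_(x in `]a, b[) f x = lb - la.
Proof.
move=> ab dF cf f0 Fa Fb.
(* The factor 1/3 keeps [a + d n < b - d n] from [n = 0] on. *)
pose d n : R := (b - a) / 3 / n.+1%:R.
have d0 n : 0 < d n by rewrite /d !divr_gt0// subr_gt0.
have d3 n : d n <= (b - a) / 3.
  by rewrite /d ler_pdivrMr// ler_peMr ?ler1n//; rewrite divr_ge0// subr_ge0 ltW.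
have dnd m n : (m <= n)%N -> d n <= d m.
  move=> mn; rewrite /d ler_pM2l; last by rewrite divr_gt0// subr_gt0.
  by rewrite lef_pV2 ?posrE// ler_nat.
have dcvg : d n @[n --> \oo] --> 0.
  rewrite -[X in _ --> X](mulr0 ((b - a) / 3)).
  apply: cvgM; first exact: cvg_cst.
  exact: (@cvg_harmonic R).
pose A n : set R := `[a + d n, b - d n]%classic.
have mf : measurable_fun `]a, b[ f.
  apply: open_continuous_measurable_fun; first exact: itv_open.
  by move=> x; rewrite inE/= in_itv/=; exact: cf.
have subA n : A n `<=` `]a, b[.
  move=> x; rewrite /A/= !in_itv/= => /andP[h1 h2]; have := d0 n.
  by move=> h; apply/andP; split; lra.
have bigA : \bigcup_n A n = `]a, b[%classic.
  apply/seteqP; split; first by move=> x [n _]; exact: subA.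
  move=> x; rewrite /= in_itv/= => /andP[ax xb].
  have : 0 < Num.min (x - a) (b - x) by rewrite lt_min !subr_gt0 ax.
  move=> e0; have /cvgrPdist_lt/(_ _ e0)[N _ /(_ N (leqnn N))] := dcvg.
  rewrite sub0r normrN gtr0_norm// lt_min => /andP[h1 h2].
  by exists N => //; rewrite /A /= in_itv/=; apply/andP; split; lra.
have IA n : (\int[mu]_(x in A n) (f x)%:E = (F (b - d n) - F (a + d n))%:E)%E.
  have hd : a + d n < b - d n by have := d3 n; have := d0 n; lra.
  have [|x h|Lf <-] := @FTC F f (a + d n) (b - d n) hd.
  - move=> x /andP[h1 h2]; apply: dF; have := d0 n; by move=> h; apply/andP; split; lra.
  - apply: cf; have := d0 n; move: h => /andP[h1 h2] h; by apply/andP; split; lra.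
  - by rewrite /Rintegral fineK//; apply: integrable_fin_num.
have nd : nondecreasing_seq A.
  move=> m n mn; apply/subsetPset => x; rewrite /A/= !in_itv/= => /andP[h1 h2].
  by have := dnd _ _ mn; move=> h; apply/andP; split; lra.
have Fb' : F (b - d n) @[n --> \oo] --> lb.
  move/cvg_at_leftP : Fb; apply; split; first by move=> n; have := d0 n; lra.
  rewrite -[X in _ --> X]subr0; apply: cvgB => //; exact: cvg_cst.
have Fa' : F (a + d n) @[n --> \oo] --> la.
  move/cvg_at_rightP : Fa; apply; split; first by move=> n; have := d0 n; lra.
  rewrite -[X in _ --> X]addr0; apply: cvgD => //; exact: cvg_cst.
have key : (\int[mu]_(x in `]a, b[) (f x)%:E = (lb - la)%:E)%E.
  have := @ge0_nondecreasing_set_cvg_integral _ (measurableTypeR R) R A (EFin \o f) mu nd.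
  rewrite bigA => h.
  have {}h : (\int[mu]_(x in A n) (f x)%:E)%E @[n --> \oo] --> (\int[mu]_(x in `]a, b[) (f x)%:E)%E.
    apply: h.
    - by move=> n; exact: measurable_itv.
    - move=> n; apply/measurable_EFinP; apply: measurable_funS mf => //; exact: subA.
    - by move=> n x /subA; rewrite /= in_itv/= lee_fin => /f0.
  have h2 : (F (b - d n) - F (a + d n))%:E @[n --> \oo] --> (lb - la)%:E.
    apply: cvg_EFin; first exact: nearW.
    exact: cvgB.
  apply/esym/(cvg_unique _ h2) => //.
  by move: h; under eq_fun do rewrite IA.
split; last by rewrite /Rintegral key.
apply/integrableP; split; first exact/measurable_EFinP.
rewrite (_ : (\int[mu]_(x in _) _ = (lb - la)%:E)%E) ?ltry//.
rewrite -key; apply: eq_integral => x; rewrite inE/= in_itv/= => /f0 h.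
by rewrite ger0_norm.
Qed.

End ftc.

(** * Poisson, conjugate Poisson and truncated Hilbert kernels *)

Section kernels.
Context {R : realType}.
Notation mu := (@lebesgue_measure R).
Implicit Types f : R -> R.

Lemma L1r_itv_mul (i : interval R) f : mu.-integrable [set` i] (EFin \o f) ->
  L1r (fun x => \1_[set` i] x * f x).
Proof.
move=> h; have := (@integrable_mkcond _ _ R mu [set` i] (EFin \o f) (measurable_itv i)).1 h.
rewrite /L1r (_ : (EFin \o f) \_ [set` i] = (EFin \o (fun x => \1_[set` i] x * f x)))//.
apply/funext => x /=.
by rewrite patchE indicE; case: ifP => _; rewrite ?mul1r ?mul0r.
Qed.

(* [kQ s u + i kP s u = 1 / (u - i s)], so [conv (kQ s) f t + i conv (kP s) f t] is the Cauchy
   transform of [f] at [t + i s]; [conv (kT e) f] is [pi] times the truncated Hilbert transform. *)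
Definition kQ (s u : R) : R := u / (u ^+ 2 + s ^+ 2).
Definition kP (s u : R) : R := s / (u ^+ 2 + s ^+ 2).
Definition kT (e u : R) : R := if e < `|u| then u^-1 else 0.
Definition conv (k : R -> R) f (t : R) : R := Int (fun x => f x * k (x - t)).

Lemma sqD_gt0 (s u : R) : 0 < s -> 0 < u ^+ 2 + s ^+ 2.
Proof. by move=> s0; rewrite ltr_wpDl// ?sqr_ge0// exprn_gt0. Qed.

Lemma kP_ge0 (s u : R) : 0 < s -> 0 <= kP s u.
Proof. by move=> s0; rewrite divr_ge0 ?ltW// sqD_gt0. Qed.

Lemma kP_le (s u : R) : 0 < s -> kP s u <= s^-1.
Proof.
move=> s0; rewrite /kP ler_pdivrMr ?sqD_gt0// ler_pdivlMl// -expr2.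
by rewrite lerDr sqr_ge0.
Qed.

Lemma kQ_le (s u : R) : 0 < s -> `|kQ s u| <= s^-1.
Proof.
move=> s0; rewrite /kQ normrM normfV (gtr0_norm (sqD_gt0 _ s0)).
rewrite ler_pdivrMr ?sqD_gt0// ler_pdivlMl//.
rewrite -(real_normK (num_real u)); have := normr_ge0 u; set a := `|u|; nra.
Qed.

Lemma kT_le (e u : R) : 0 < e -> `|kT e u| <= e^-1.
Proof.
move=> e0; rewrite /kT; case: ifPn => h; last by rewrite normr0 invr_ge0 ltW.
by rewrite normfV lef_pV2 ?posrE// ?ltW// (lt_trans e0).
Qed.

Lemma measurable_shift (t : R) : measurable_fun setT (fun x : R => x - t).
Proof. exact: measurable_funB. Qed.

Lemma measurable_sqD (s : R) : measurable_fun setT (fun u : R => u ^+ 2 + s ^+ 2).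
Proof. by apply: measurable_funD => //; exact: measurable_funX. Qed.

Lemma measurable_kQ (s : R) : measurable_fun setT (kQ s).
Proof.
apply: measurable_funM => //; apply: measurable_funV; exact: measurable_sqD.
Qed.

Lemma measurable_kP (s : R) : measurable_fun setT (kP s).
Proof.
apply: measurable_funM => //; apply: measurable_funV; exact: measurable_sqD.
Qed.

Lemma measurable_kT (e : R) : measurable_fun setT (kT e).
Proof.
apply: measurable_fun_ifT => //; last exact: measurable_inv.
by apply: measurable_fun_ltr => //; exact: measurableT_comp.
Qed.

Lemma measurable_sh (k : R -> R) (t : R) : measurable_fun setT k ->
  measurable_fun setT (fun x : R => k (x - t)).
Proof. by move=> mk; apply: (measurableT_comp mk); exact: measurable_shift. Qed.

Lemma is_derive_kP (s t x : R) : 0 < s ->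
  is_derive x (1:R) (fun x => atan ((x - t) / s)) (kP s (x - t)).
Proof.
move=> s0; apply: is_derive_eq; rewrite /GRing.scale/= /kP.
have := sqD_gt0 (x - t) s0; move=> h; field.
by rewrite !gt_eqF.
Qed.

Lemma is_derive_kQ (s t x : R) : 0 < s ->
  is_derive x (1:R) (fun x => ln ((x - t) ^+ 2 + s ^+ 2) / 2) (kQ s (x - t)).
Proof.
move=> s0; have h := sqD_gt0 (x - t) s0.
have h1 : is_derive x (1:R) (fun x : R => (x - t) ^+ 2 + s ^+ 2) (2 * (x - t)).
  apply: is_derive_eq; rewrite /GRing.scale/=; ring.
have h3 := @is_derive1_comp R (@ln R) (fun x : R => (x - t) ^+ 2 + s ^+ 2) x _ _
  (is_derive1_ln h) h1.
have -> : (fun x => ln ((x - t) ^+ 2 + s ^+ 2) / 2) =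
  (@ln R \o (fun x => (x - t) ^+ 2 + s ^+ 2)) * (cst 2^-1) by [].
apply: is_derive_eq; rewrite /GRing.scale/= /kQ; field.
by rewrite gt_eqF.
Qed.

Lemma continuous_kP (s t x : R) : 0 < s -> {for x, continuous (fun x => kP s (x - t))}.
Proof.
move=> s0; apply: differentiable_continuous; apply/derivable1_diffP.
have h := sqD_gt0 (x - t) s0; rewrite /kP.
apply: derivableM => //; apply: derivableV; rewrite ?gt_eqF//.
Qed.

Lemma continuous_kQ (s t x : R) : 0 < s -> {for x, continuous (fun x => kQ s (x - t))}.
Proof.
move=> s0; apply: differentiable_continuous; apply/derivable1_diffP.
have h := sqD_gt0 (x - t) s0; rewrite /kQ.
by apply: derivableM => //; apply: derivableV; rewrite ?gt_eqF//.
Qed.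

Lemma int_kP (s t a b : R) : 0 < s -> a < b ->
  \int[mu]_(x in `[a, b]) kP s (x - t) = atan ((b - t) / s) - atan ((a - t) / s).
Proof.
move=> s0 ab; have [|x _|_ ->//] :=
  @FTC R (fun x => atan ((x - t) / s)) (fun x => kP s (x - t)) a b ab.
- by move=> x _; exact: is_derive_kP.
- exact: continuous_kP.
Qed.

Lemma int_kP_le_pi (s t a b : R) : 0 < s -> a < b ->
  \int[mu]_(x in `[a, b]) kP s (x - t) <= pi.
Proof.
move=> s0 ab; rewrite int_kP//.
have := atan_ltpi2 ((b - t) / s); have := atan_gtNpi2 ((a - t) / s); lra.
Qed.

Lemma int_kQ (s t c : R) : 0 < s -> 0 < c ->
  \int[mu]_(x in `[t - c, t + c]) kQ s (x - t) = 0.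
Proof.
move=> s0 c0; have [||x _|_ ->//] :=
  @FTC R (fun x => ln ((x - t) ^+ 2 + s ^+ 2) / 2) (fun x => kQ s (x - t)) (t - c) (t + c).
- lra.
- by move=> x _; exact: is_derive_kQ.
- exact: continuous_kQ.
- have -> : t - c - t = - c by rewrite addrAC subrr add0r.
  have -> : t + c - t = c by rewrite addrAC subrr add0r.
  by rewrite sqrrN subrr.
Qed.

Lemma int_inv_right (t a b : R) : t < a -> a < b ->
  mu.-integrable `[a, b] (fun x => ((x - t)^-1)%:E) /\
  \int[mu]_(x in `[a, b]) (x - t)^-1 = ln (b - t) - ln (a - t).
Proof.
move=> ta ab; apply: (@FTC R (fun x => ln (x - t)) (fun x => (x - t)^-1)) => // x /andP[ax xb].
- have h : 0 < x - t by lra.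
  have h1 := is_derive1_ln h.
  have h2 : is_derive x (1:R) (fun x : R => x - t) 1.
    by apply: is_derive_eq; rewrite subr0.
  have := @is_derive1_comp R (@ln R) (fun x : R => x - t) x _ _ h1 h2.
  by rewrite mulr1.
- have h : x - t != 0 by rewrite gt_eqF//; lra.
  by apply: differentiable_continuous; apply/derivable1_diffP; apply: derivableV.
Qed.

Lemma int_inv_left (t a b : R) : b < t -> a < b ->
  mu.-integrable `[a, b] (fun x => ((x - t)^-1)%:E) /\
  \int[mu]_(x in `[a, b]) (x - t)^-1 = ln (t - b) - ln (t - a).
Proof.
move=> bt ab; apply: (@FTC R (fun x => ln (t - x)) (fun x => (x - t)^-1)) => // x /andP[ax xb].
- have h : 0 < t - x by lra.
  have h1 := is_derive1_ln h.
  have h2 : is_derive x (1:R) (fun x : R => t - x) (- 1).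
    by apply: is_derive_eq; ring.
  have := @is_derive1_comp R (@ln R) (fun x : R => t - x) x _ _ h1 h2; rewrite mulrN1 -invrN opprB.
  by apply.
- have h : x - t != 0 by rewrite lt_eqF//; lra.
  by apply: differentiable_continuous; apply/derivable1_diffP; apply: derivableV.
Qed.

Lemma int_kT (e t c : R) : 0 < e -> e < c ->
  \int[mu]_(x in `[t - c, t + c]) kT e (x - t) = 0.
Proof.
move=> e0 ec.
have L1 : mu.-integrable `[t - c, t - e] (fun x => ((x - t)^-1)%:E).
  by apply: (int_inv_left _ _).1; lra.
have L2 : mu.-integrable `[t + e, t + c] (fun x => ((x - t)^-1)%:E).
  by apply: (int_inv_right _ _).1; lra.
have H1 : \int[mu]_(x in `[t - c, t - e[) (x - t)^-1 = ln e - ln c.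
  rewrite Rintegral_itv_bndo_bndc; last first.
    by apply: integrableS L1 => //; apply: subset_itvl; rewrite bnd_simp.
  rewrite (int_inv_left _ _).2; try lra.
  by congr (ln _ - ln _); ring.
have H2 : \int[mu]_(x in `]t + e, t + c]) (x - t)^-1 = ln c - ln e.
  rewrite Rintegral_itv_obnd_cbnd; last first.
    by apply: integrableS L2 => //; apply: subset_itvr; rewrite bnd_simp.
  rewrite (int_inv_right _ _).2; try lra.
  by congr (ln _ - ln _); ring.
rewrite -Int_itv.
transitivity (Int (fun x => \1_`[t - c, t - e[ x * (x - t)^-1 +
                            \1_`]t + e, t + c] x * (x - t)^-1)).
  apply: eq_Int => x; rewrite !indicE !mem_setE !in_itv/= /kT.
  have [h|h] := ltP e `|x - t|; last first.
    move: h; rewrite ler_norml => /andP[h1 h2].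
    rewrite mulr0 (_ : (x < t - e) = false) ?andbF; last by apply/negbTE; rewrite -leNgt; lra.
    rewrite (_ : (t + e < x) = false) /=; last by apply/negbTE; rewrite -leNgt; lra.
    by rewrite !mul0r addr0.
  rewrite -mulrDl; congr (_ * _); move: h; rewrite lter_normr => /orP[] h.
    rewrite (_ : (x < t - e) = false) ?andbF; last by apply/negbTE; rewrite -leNgt; lra.
    rewrite (_ : (t + e < x) = true) /=; last by lra.
    rewrite add0r (_ : (t - c <= x) = true) //; lra.
  rewrite (_ : (x < t - e) = true) ?andbT; last by lra.
  rewrite (_ : (t + e < x) = false) /=; last by apply/negbTE; rewrite -leNgt; lra.
  rewrite addr0 (_ : (x <= t + c) = true) ?andbT//; lra.
have LI (i : interval R) : mu.-integrable [set` i] (fun x => ((x - t)^-1)%:E) ->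
    L1r (fun x => \1_[set` i] x * (x - t)^-1) by exact: L1r_itv_mul.
rewrite IntD ?Int_itv ?H1 ?H2; first by ring.
- by apply: LI; apply: integrableS L1 => //; apply: subset_itvl; rewrite bnd_simp.
- by apply: LI; apply: integrableS L2 => //; apply: subset_itvr; rewrite bnd_simp.
Qed.

(* Error in replacing [conv k f t] by [c * f t], for any kernel [k] of mass [c] dominated by
   the Poisson kernel; it vanishes with [s] at the Lebesgue points of [f]. *)
Definition osc f (t s : R) : R :=
  Int (fun x => \1_`[t - 3, t + 3] x * (`|f x - f t| * kP s (x - t))).

Lemma fin_itv (a b : R) : (mu `[a, b]%classic < +oo)%E.
Proof. by rewrite lebesgue_measure_itv/=; case: ifP => _; rewrite -?EFinB ltry. Qed.

Lemma L1r_itvf f (a b : R) : L1r f -> L1r (fun x => \1_`[a, b] x * f x).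
Proof.
move=> Lf; apply: L1r_itv_mul; apply: integrableS Lf => //; exact: measurableT.
Qed.

Lemma L1r_itv_cst (c a b : R) : L1r (fun x => \1_`[a, b] x * c).
Proof.
rewrite (_ : (fun x => _) = (fun x => c * \1_`[a, b] x)); last first.
  by apply/funext => x; rewrite mulrC.
by apply: L1rZ; apply: L1r_itv; exact: fin_itv.
Qed.

Lemma L1r_itv_bounded (a b C : R) (k : R -> R) : measurable_fun setT k -> (forall x, `|k x| <= C) ->
  L1r (fun x => \1_`[a, b] x * k x).
Proof.
move=> mk kC; apply: L1rM_bounded kC => //; apply: L1r_itv; exact: fin_itv.
Qed.

Lemma L1r_osc f (t : R) : L1r f -> L1r (fun x => \1_`[t - 3, t + 3] x * `|f x - f t|).
Proof.
move=> Lf; have : L1r (fun x => `| \1_`[t - 3, t + 3] x * f x - \1_`[t - 3, t + 3] x * f t|).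
  by apply: L1r_abs; apply: L1rB; [exact: L1r_itvf|exact: L1r_itv_cst].
rewrite (_ : (fun x => `|_|) = (fun x => \1_`[t - 3, t + 3] x * `|f x - f t|))//.
apply/funext => x; rewrite -mulrBr normrM; congr (_ * _).
by rewrite ger0_norm// indicE.
Qed.

(** The window [[t - 3, t + 3]] contains (-1,1), so [f] vanishes outside it and the constant [f t]
    may be subtracted inside it at the cost of the mass [c]. It is also symmetric about [t], so that
    odd kernels have mass zero on it. *)
Lemma conv_approx f (t s c : R) (k : R -> R) : L1r f -> supp f -> -1 < t < 1 -> 0 < s ->
  measurable_fun setT k -> (forall u, `|k u| <= kP s u) ->
  \int[mu]_(x in `[t - 3, t + 3]) k (x - t) = c ->
  `|conv k f t - c * f t| <= osc f t s.
Proof.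
move=> Lf sf /andP[t1 t2] s0 mk kkP <-.
have kb u : `|k u| <= s^-1 by rewrite (le_trans (kkP u))// kP_le.
have mks := measurable_sh t mk.
rewrite -Int_itv mulrC -IntZ; last exact: L1r_itv_bounded.
rewrite /conv -IntB; last 2 first.
- exact: L1rM_bounded (fun x => kb (x - t)).
- by apply: L1rZ; exact: L1r_itv_bounded.
apply: Int_abs_le.
- apply: L1rB; first exact: L1rM_bounded (fun x => kb (x - t)).
  by apply: L1rZ; exact: L1r_itv_bounded.
- have := @L1rM_bounded R _ (fun x => kP s (x - t)) s^-1 (L1r_osc t Lf)
    (measurable_sh t (measurable_kP s)).
  under eq_fun do rewrite -mulrA; apply=> x; rewrite ger0_norm ?kP_ge0//.
  exact: kP_le.
move=> x; rewrite indicE mem_setE in_itv/=.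
have [h|h] := boolP (t - 3 <= x <= t + 3).
  rewrite !mul1r -mulrBl normrM; apply: ler_wpM2l => //; exact: kkP.
rewrite !mul0r mulr0 subr0 sf ?mul0r ?normr0//.
apply: contra h => /andP[? ?]; apply/andP; split; lra.
Qed.

(** Lebesgue points, in the form that can be summed over dyadic balls: the oscillation over a ball
    of radius [r] is o(r). *)
Definition LPt f (t : R) := forall e, 0 < e -> exists2 d, 0 < d &
  forall r, 0 < r -> r <= d ->
  Int (fun x => \1_(ball t r) x * `|f x - f t|) <= e * r.

(** Where [2 ^+ m * s <= |u|], the kernel is at most [1 / (4 ^+ m * s)]. The ring between the radii
    [2 ^+ (j - 1) * s] and [2 ^+ j * s] is thus paid for by the [j]-th ball, whence the factor 4;
    the last term covers the exterior of the largest ball. *)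
Lemma kP_dyadic (s u : R) n : 0 < s ->
  kP s u <= \sum_(j < n.+1) (4 / (4 ^+ j * s) * (`|u| < 2 ^+ j * s)%R%:R) + 1 / (4 ^+ n * s).
Proof.
move=> s0.
have big m : 2 ^+ m * s <= `|u| -> kP s u <= 1 / (4 ^+ m * s).
  move=> h; rewrite /kP ler_pdivrMr ?sqD_gt0//.
  have h4 : 0 < 4 ^+ m * s by rewrite mulr_gt0// exprn_gt0.
  rewrite mul1r mulrC ler_pdivlMr//.
  have : (2 ^+ m * s) ^+ 2 <= u ^+ 2.
    rewrite -[leRHS]real_normK ?num_real// ler_sqr ?nnegrE//.
    by rewrite mulr_ge0 ?exprn_ge0 ?ltW.
  rewrite exprMn -exprM mulnC exprM (_ : 2 ^+ 2 = 4 :> R); last by rewrite expr2; ring.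
  move=> h2; have := sqr_ge0 s; have : 0 <= 4 ^+ m :> R by rewrite exprn_ge0.
  by rewrite expr2 in h2 *; nra.
elim: n => [|n IH].
  rewrite big_ord_recr big_ord0/= add0r expr0 !mul1r.
  have [h|h] := ltP `|u| s; last first.
    have := big 0%N; rewrite !expr0 !mul1r => /(_ h) h2.
    by rewrite (le_trans h2)// mulr0 add0r.
  have := kP_le u s0; have : 0 < s^-1 by rewrite invr_gt0.
  by rewrite mulr1; lra.
rewrite big_ord_recr/=.
have [h|h] := ltP `|u| (2 ^+ n.+1 * s).
  rewrite mulr1 (le_trans IH)// -addrA lerD2l.
  have h4 m : 0 < 4 ^+ m * s by rewrite mulr_gt0// exprn_gt0.
  rewrite -[leLHS]addr0; apply: lerD; last by rewrite divr_ge0 ?ltW.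
  rewrite exprS.
  rewrite (_ : 4 / (4 * 4 ^+ n * s) = 1 / (4 ^+ n * s))//.
  by field; rewrite gt_eqF// expf_neq0.
rewrite mulr0 addr0 (le_trans (big _ h))// lerDr sumr_ge0// => j _.
by rewrite mulr_ge0// divr_ge0// mulr_ge0 ?exprn_ge0// ltW.
Qed.

End kernels.

(** * Lebesgue points *)

Section lebesgue_points.
Context {R : realType}.
Notation mu := (@lebesgue_measure R).
Implicit Types f : R -> R.

Lemma Int_sum n (F : nat -> R -> R) : (forall i, (i < n)%N -> L1r (F i)) ->
  L1r (fun x => \sum_(i < n) F i x) /\
  Int (fun x => \sum_(i < n) F i x) = \sum_(i < n) Int (F i).
Proof.
elim: n => [|n IH] LF.
  have z : (fun x => \sum_(i < 0) F i x) = (fun=> 0).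
    by apply/funext => x; rewrite big_ord0.
  rewrite z big_ord0; split; first exact: integrable0.
  by rewrite /Int Rintegral_cst// mul0r.
have [L1 I1] := IH (fun i (h : (i < n)%N) => LF i (leqW h)).
have -> : (fun x => \sum_(i < n.+1) F i x) = (fun x => \sum_(i < n) F i x + F n x).
  by apply/funext => x; rewrite big_ord_recr.
have LFn := LF n (ltnSn n).
split; first exact: L1rD.
by rewrite IntD// I1 big_ord_recr.
Qed.

Lemma pow2_between (s d : R) : 0 < s -> s <= d ->
  exists n, 2 ^+ n * s <= d < 2 ^+ n.+1 * s.
Proof.
move=> s0 sd.
have ex : exists n, d < 2 ^+ n.+1 * s.
  have h : 0 <= d / s by rewrite divr_ge0 ?(ltW s0)// (le_trans (ltW s0)).
  exists (Num.bound (d / s)); have := archi_boundP h; rewrite ltr_pdivrMr// => /lt_le_trans; apply.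
  rewrite ler_pM2r// -natrX ler_nat; apply: ltnW; apply: (leq_trans (ltn_expl _ (isT : (1 < 2)%N))).
  by rewrite leq_exp2l.
exists (ex_minn ex); case: ex_minnP => n -> nmin; rewrite andbT.
case: n nmin => [|n] nmin; first by rewrite expr0 mul1r.
by rewrite leNgt; apply/negP => /nmin; rewrite ltnn.
Qed.

Lemma ball_itvE (t r : R) : ball t r = `](t - r)%R, (t + r)%R[%classic.
Proof. by rewrite ball_itv. Qed.

Lemma L1r_ball f (t r : R) : L1r f -> L1r (fun x => \1_(ball t r) x * `|f x - f t|).
Proof.
move=> Lf; rewrite ball_itvE.
apply: L1r_itv_mul.
have fin : (mu `](t - r)%R, (t + r)%R[%classic < +oo)%E.
  by rewrite lebesgue_measure_itv/=; case: ifP => _; rewrite -?EFinB ltry.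
apply: (@integrable_abse _ _ R mu _ (fun x => (f x - f t)%R%:E)).
rewrite (_ : (fun x => _) = ((EFin \o f) \- cst (f t)%:E)%E); last first.
  by apply/funext => x /=; rewrite EFinB.
apply: integrableB => //.
  by apply: integrableS Lf => //; exact: measurableT.
by apply/integrableP; split => //; rewrite integral_cst//= lte_mul_pinfty.
Qed.

Lemma indic_le1 (A : set R) (x : R) : \1_A x <= 1 :> R.
Proof. by rewrite indicE; case: (_ \in _). Qed.

Lemma indic_ge0 (A : set R) (x : R) : 0 <= \1_A x :> R.
Proof. by rewrite indicE. Qed.

(** The dyadic majorant is stopped at the last ball of radius at most [d]. The balls are controlled
    by the Lebesgue point property, and the remaining term is O(s / d^2), since twice the last
    radius exceeds [d]. *)
Lemma osc_cvg f (t : R) : L1r f -> LPt f t -> osc f t s @[s --> 0^'+] --> 0.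
Proof.
move=> Lf LP; apply/cvgrPdist_le => e e0.
(* With [e / 16], the [j]-th ball contributes at most [e / 4 / 2 ^+ j], for a total below
   [e / 2]. *)
have [|d d0 dP] := LP (e / 16); first by rewrite divr_gt0.
set V := Int (fun x => \1_`[t - 3, t + 3] x * `|f x - f t|).
have V0 : 0 <= V by apply: Int_ge0 => x; rewrite mulr_ge0// indic_ge0.
have LV := L1r_osc t Lf.
(* For [s <= c] the exterior term, at most [4 * s / d ^+ 2 * (V + 1)], is at most [e / 2]. *)
pose c := d ^+ 2 * e / (8 * (V + 1)).
have c0 : 0 < c.
  by rewrite /c divr_gt0// ?mulr_gt0 ?exprn_gt0//; lra.
near=> s.
have s0 : 0 < s by near: s; exact: nbhs_right_gt.
have sd : s <= d by near: s; exact: nbhs_right_le.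
have sc : s <= c by near: s; exact: nbhs_right_le.
rewrite sub0r normrN ger0_norm; last first.
  by apply: Int_ge0 => x; rewrite mulr_ge0 ?indic_ge0// mulr_ge0// kP_ge0.
have [n /andP[n1 n2]] := pow2_between s0 sd.
have p4 m : 0 < 4 ^+ m * s by rewrite mulr_gt0// exprn_gt0.
have p2 m : 0 < 2 ^+ m * s by rewrite mulr_gt0// exprn_gt0.
pose F j x := 4 / (4 ^+ j * s) * (\1_(ball t (2 ^+ j * s)) x * `|f x - f t|).
have LF j : L1r (F j) by apply: L1rZ; exact: L1r_ball.
have [LS IS] := @Int_sum n.+1 F (fun j _ => LF j).
have LG := L1rZ (1 / (4 ^+ n * s)) LV.
apply: (@le_trans _ _ (\sum_(j < n.+1) Int (F j) + (1 / (4 ^+ n * s)) * V)).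
  rewrite -IS -IntZ// -IntD//; apply: Int_le.
  - have := @L1rM_bounded R _ (fun x => kP s (x - t)) s^-1 LV
      (measurable_sh t (measurable_kP s)).
    under eq_fun do rewrite -mulrA; apply=> x; rewrite ger0_norm ?kP_ge0//.
    exact: kP_le.
  - exact: L1rD.
  move=> x; have := kP_dyadic (x - t) n s0.
  set w := `|f x - f t|; have w0 : 0 <= w by rewrite /w.
  move=> h; have a1 := indic_le1 `[t - 3, t + 3] x; have a0 := indic_ge0 `[t - 3, t + 3] x.
  set a := (\1_ _ x) in a0 a1 *.
  have -> : \sum_(i < n.+1) F i x =
     w * \sum_(j < n.+1) (4 / (4 ^+ j * s) * (`|x - t| < 2 ^+ j * s)%R%:R).
    rewrite mulr_sumr; apply: eq_bigr => j _; rewrite /F -/w indicE ball_itvE mem_setE in_itv/=.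
    by rewrite ltr_distl; ring.
  set S := \sum_(j < n.+1) _ in h *.
  have S0 : 0 <= S.
    by apply: sumr_ge0 => j _; rewrite mulr_ge0// divr_ge0// ltW.
  have g0 : 0 <= 1 / (4 ^+ n * s) by rewrite divr_ge0// ltW.
  apply: (@le_trans _ _ (a * (w * (S + 1 / (4 ^+ n * s))))).
    by rewrite ler_wpM2l// ler_wpM2l.
  rewrite mulrDr mulrDr lerD//; last by rewrite mulrA mulrC.
  by rewrite -[leRHS]mul1r ler_wpM2r// mulr_ge0.
rewrite (splitr e) lerD//.
  have -> : e / 2 = e / 4 * 2 by lra.
  apply: (@le_trans _ _ (\sum_(j < n.+1) e / 4 / 2 ^+ j)).
    apply: ler_sum => j _; rewrite /F IntZ; last exact: L1r_ball.
    have jn : 2 ^+ j * s <= d.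
      rewrite (le_trans _ n1)// ler_pM2r// ler_weXn2l ?ler1n//.
      by rewrite -ltnS ltn_ord.
    have := dP _ (p2 j) jn; set I := Int _ => hI.
    have -> : e / 4 / 2 ^+ j = 4 / (4 ^+ j * s) * (e / 16 * (2 ^+ j * s)).
      have -> : 4 ^+ j = 2 ^+ j * 2 ^+ j :> R by rewrite -exprMn; congr (_ ^+ _); ring.
      by field; rewrite gt_eqF// expf_neq0.
    by rewrite ler_wpM2l// divr_ge0// ltW.
  rewrite -mulr_sumr; apply: ler_wpM2l; first by rewrite divr_ge0 ?ltW.
  have gs m : \sum_(j < m.+1) (2 ^+ j)^-1 = 2 - (2 ^+ m)^-1 :> R.
    elim: m => [|m IH]; first by rewrite big_ord_recr big_ord0/= expr0 invr1; ring.
    rewrite big_ord_recr/= IH exprS; field.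
    by rewrite expf_neq0.
  by rewrite gs lerBlDr lerDl invr_ge0 exprn_ge0.
have h : 1 / (4 ^+ n * s) <= 4 * s / d ^+ 2.
  rewrite ler_pdivrMr// mulrAC ler_pdivlMr ?exprn_gt0// mul1r.
  have -> : 4 * s * (4 ^+ n * s) = (2 ^+ n.+1 * s) ^+ 2.
    rewrite exprMn -exprM mulnC exprM (_ : 2 ^+ 2 = 4 :> R); last by rewrite expr2; ring.
    by rewrite exprS; ring.
  by rewrite ler_sqr ?nnegrE ?ltW.
apply: (@le_trans _ _ (4 * s / d ^+ 2 * (V + 1))).
  by rewrite ler_pM ?divr_ge0 ?lerDl// ltW.
have V1 : 0 < V + 1 by lra.
have -> : 4 * s / d ^+ 2 * (V + 1) = s * (4 * (V + 1) / d ^+ 2).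
  by field; rewrite gt_eqF.
rewrite -ler_pdivlMr; last by rewrite divr_gt0 ?exprn_gt0// mulr_gt0.
have -> : e / 2 / (4 * (V + 1) / d ^+ 2) = c.
  by rewrite /c; field; rewrite !gt_eqF.
by [].
Unshelve. all: end_near. Qed.

Lemma LPt_lebesgue_pt f (t : R) : L1r f -> lebesgue_pt f t -> LPt f t.
Proof.
move=> Lf h e e0.
have e20 : 0 < e / 2 by rewrite divr_gt0.
have /fine_cvgP[ff /cvgrPdist_le/(_ _ e20)] : davg f t r @[r --> 0^'+] --> 0%:E by [].
move=> hf; have := filterI ff hf.
move=> -[/= d d0 dP]; exists (d / 2); first by rewrite divr_gt0.
move=> r r0 rd.
have [] := dP r.
- by rewrite /= sub0r normrN gtr0_norm// (le_lt_trans rd)// ltr_pdivrMr// ltr_pMr// ltr1n.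
- by [].
move=> fn; rewrite sub0r normrN => le.
have r20 : 0 < r * 2 by rewrite mulr_gt0.
have mb : mu (ball t r) = (r * 2)%:E.
  by rewrite lebesgue_measure_ball ?ltW// mulr_natr.
have LB := L1r_ball t r Lf.
have E : (\int[mu]_(y in ball t r) `|((center (f t) \o f) y)%:E| =
          (Int (fun x => \1_(ball t r) x * `|f x - f t|))%:E)%E.
  rewrite EFin_Int// integral_mkcond; apply: eq_integral => x _.
  by rewrite patchE indicE; case: ifP => _ /=; rewrite ?mul1r ?mul0r.
have : davg f t r = ((r * 2)^-1 * Int (fun x => \1_(ball t r) x * `|f x - f t|))%:E.
  rewrite /davg /iavg E mb inver gt_eqF// -EFinM.
move=> hd; move: le; rewrite hd /= ger0_norm; last first.
  apply: mulr_ge0; first by rewrite invr_ge0 ltW.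
  by apply: Int_ge0 => x; rewrite mulr_ge0// indic_ge0.
rewrite ler_pdivrMl//; have -> // : r * 2 * (e / 2) = e * r by field.
Qed.

Lemma L1r_loc f : L1r f -> locally_integrable setT f.
Proof. by move=> Lf; apply: open_integrable_locally => //; exact: openT. Qed.

Lemma ae_LPt f : L1r f -> {ae mu, forall t, LPt f t}.
Proof.
move=> Lf; apply: aeS (lebesgue_differentiation (L1r_loc Lf)) => t.
exact: LPt_lebesgue_pt.
Qed.

Lemma continuous_LPt f (t : R) : L1r f -> {for t, continuous f} -> LPt f t.
Proof.
move=> Lf cf; apply: LPt_lebesgue_pt => //.
apply: (@continuous_lebesgue_pt _ _ _ setT) => //; first exact: open_nbhsT.
exact: L1r_meas.
Qed.

(** On the window of radius 3 the Poisson kernel has mass [2 * atan (3 / s)], which tends to [pi];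
    the error is [osc]. *)
Lemma conv_kP_cvg f (t : R) : L1r f -> supp f -> -1 < t < 1 -> LPt f t ->
  conv (kP s) f t @[s --> 0^'+] --> pi * f t.
Proof.
move=> Lf sf t1 LP.
pose c s : R := atan (3 / s) - atan (- 3 / s).
have cE s : 0 < s -> \int[mu]_(x in `[t - 3, t + 3]) kP s (x - t) = c s.
  move=> s0; rewrite int_kP//; last by lra.
  by rewrite /c; congr (atan (_ / _) - atan (_ / _)); ring.
have ccvg : c s @[s --> 0^'+] --> pi.
  have -> : c = (fun s => atan (3 * s^-1) * 2).
    by apply/funext => s; rewrite /c mulNr atanN opprK mulr2n mulrDr mulr1.
  have -> : pi = pi / 2 * 2 :> R by rewrite mulfVK.
  apply: cvgM; last exact: cvg_cst.
  suff h : (3 * s^-1) @[s --> (0:R)^'+] --> +oo%R by exact: (cvg_comp _ _ h (@cvgy_atan R)).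
  apply/cvgryPge => A; near=> s.
  have s0 : 0 < s by near: s; exact: nbhs_right_gt.
  rewrite ler_pdivlMr//.
  have A1 : 0 < `|A| + 1 by rewrite ltr_pwDr.
  have : s < 3 / (`|A| + 1).
    by near: s; apply: nbhs_right_lt; rewrite divr_gt0// ltr_pwDr.
  rewrite ltr_pdivlMr// => h.
  have := ler_wpM2r (ltW s0) (ler_norm A); lra.
have -> : pi * f t = 0 + pi * f t by rewrite add0r.
have : (conv (kP s) f t - c s * f t) @[s --> 0^'+] --> 0.
  apply/norm_cvg0P; apply: (squeeze_cvgr _ (cvg_cst 0) (osc_cvg Lf LP)).
  near=> s; rewrite normr_ge0/=.
  have s0 : 0 < s by near: s; exact: nbhs_right_gt.
  apply: conv_approx => //; first exact: measurable_kP.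
  - by move=> u; rewrite ger0_norm ?kP_ge0.
  - exact: cE.
move=> h; have h2 : c s * f t @[s --> 0^'+] --> pi * f t.
  by apply: cvgM => //; exact: cvg_cst.
suff <- : (fun s => (conv (kP s) f t - c s * f t) + c s * f t) = (fun s => conv (kP s) f t).
  exact: cvgD.
by apply/funext => s; rewrite subrK.
Unshelve. all: end_near. Qed.

Lemma kQ_sub_kT (s u : R) : 0 < s -> `|kQ s u - kT s u| <= kP s u.
Proof.
move=> s0; have D0 := sqD_gt0 u s0.
rewrite /kQ /kT; case: ifPn => h.
  have u0 : u != 0 by apply: contraTneq h => ->; rewrite normr0 -leNgt ltW.
  have -> : u / (u ^+ 2 + s ^+ 2) - u^-1 = - (s ^+ 2 / (u ^+ 2 + s ^+ 2) / u).
    by field; rewrite u0 gt_eqF.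
  rewrite normrN !normf_div (gtr0_norm D0) (ger0_norm (sqr_ge0 s)).
  rewrite /kP mulrAC ler_pM2r ?invr_gt0//.
  rewrite ler_pdivrMr ?normr_gt0// expr2 ler_pM2l// ltW//.
rewrite subr0 normrM normfV (gtr0_norm D0) /kP ler_pM2r ?invr_gt0//.
by rewrite leNgt.
Qed.

(** Both kernels are odd, so their difference has mass zero on the window, and it is dominated by
    [kP s]; [osc] bounds what is left. Through this lemma limits of regularisations become principal
    values. *)
Lemma conv_kQ_sub_kT f (t : R) : L1r f -> supp f -> -1 < t < 1 -> LPt f t ->
  (conv (kQ s) f t - conv (kT s) f t) @[s --> 0^'+] --> 0.
Proof.
move=> Lf sf t1 LP.
apply/norm_cvg0P; apply: (squeeze_cvgr _ (cvg_cst 0) (osc_cvg Lf LP)).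
near=> s; rewrite normr_ge0/=.
have s0 : 0 < s by near: s; exact: nbhs_right_gt.
have s3 : s < 3 by near: s; exact: nbhs_right_lt.
have mQ := measurable_kQ s; have mT := measurable_kT s.
have := @conv_approx R f t s 0 (fun u => kQ s u - kT s u) Lf sf t1 s0
  (measurable_funB mQ mT) (fun u => kQ_sub_kT u s0).
have h (k : R -> R) : measurable_fun setT k -> (forall u, `|k u| <= s^-1) ->
   mu.-integrable `[t - 3, t + 3] (fun x => (k (x - t))%:E).
  move=> mk kb; apply: measurable_bounded_integrable => //.
  - exact: fin_itv.
  - by apply: measurable_funTS; exact: measurable_sh.
  - exists s^-1; split; first exact: num_real.
    by move=> M h1 x _ /=; rewrite (le_trans (kb _))// ltW.
have kQb u := kQ_le u s0; have kTb u := kT_le u s0.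
rewrite RintegralB//; [|exact: h..].
rewrite int_kQ// int_kT// subr0 mul0r subr0 => /(_ erefl).
rewrite /conv -IntB; last 2 first.
- exact: L1rM_bounded (measurable_sh t mQ) (fun x => kQb (x - t)).
- exact: L1rM_bounded (measurable_sh t mT) (fun x => kTb (x - t)).
by under eq_Int do rewrite mulrBr.
Unshelve. all: end_near. Qed.

End lebesgue_points.

(** * Derivatives of the Cauchy transform in both variables *)

Section conjugate_kernels.
Context {R : realType}.
Notation mu := (@lebesgue_measure R).
Implicit Types f sg : R -> R.

Lemma is_derive_div (f g : R -> R) (x df dg : R) : is_derive x (1:R) f df ->
  is_derive x (1:R) g dg -> g x != 0 ->
  is_derive x (1:R) (fun y => f y / g y) ((df * g x - f x * dg) / g x ^+ 2).
Proof.
move=> hf hg g0.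
have hV : is_derive x (1:R) (fun y => (g y)^-1) (- (g x ^- 2) * dg).
  apply: DeriveDef; first by apply: derivableV => //; exact: ex_derive.
  rewrite deriveV//.
  by rewrite (@derive_val _ _ _ _ _ _ _ hg).
apply: is_derive_eq; rewrite /GRing.scale/=; by field.
Qed.

Lemma derive_param (k dk : R -> R -> R) (p u v C : R) sg : L1r sg -> u < p < v ->
  (forall q x, u < q < v -> is_derive q (1:R) (k^~ x) (dk q x)) ->
  (forall q, measurable_fun setT (k q)) ->
  (forall q x, u < q < v -> `|k q x| <= C) ->
  (forall q x, u < q < v -> `|dk q x| <= C) ->
  is_derive p (1:R) (fun q => Int (fun x => sg x * k q x))
    (Int (fun x => sg x * dk p x)).
Proof.
move=> Ls puv dk_ mk kC dkC.
pose f q x := sg x * k q x.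
have C0 : 0 <= C by rewrite (le_trans _ (kC p 0 puv)).
have df q x : u < q < v -> is_derive q (1:R) (f^~ x) (sg x * dk q x).
  move=> quv; have h := dk_ q x quv; rewrite /f; apply: is_derive_eq.
  rewrite /GRing.scale/=; ring.
have pE q x : u < q < v -> partial1of2 f q x = sg x * dk q x.
  by move=> quv; rewrite partial1of2E; have := df _ x quv => h; exact: derive_val.
have Ip : `]u, v[%classic p by rewrite /= in_itv.
have If q : `]u, v[%classic q -> L1r (f q).
  by rewrite /= in_itv/= => quv; apply: (L1rM_bounded Ls (mk q) (fun x => kC q x quv)).
have dfI q x : `]u, v[%classic q -> setT x -> derivable (f^~ x) q 1.
  by rewrite /= in_itv/= => quv _; have h := df q x quv; exact: ex_derive.
have LG : L1r (fun x => `|sg x| * C).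
  rewrite (_ : (fun x => _) = (fun x => C * `|sg x|)); first exact/L1rZ/L1r_abs.
  by apply/funext => x; rewrite mulrC.
have Gub q x : `]u, v[%classic q -> setT x -> `|partial1of2 f q x| <= `|sg x| * C.
  by rewrite /= in_itv/= => quv _; rewrite pE// normrM ler_wpM2l// dkC.
have G0 x : 0 <= `|sg x| * C by rewrite mulr_ge0.
have d1 := @derivable_under_integral R _ _ mu f setT measurableT p u v Ip If dfI
  _ G0 LG Gub.
have d2 := @differentiation_under_integral R _ _ mu f setT measurableT p u v Ip If dfI
  _ G0 LG Gub.
apply: DeriveDef; first exact: d1.
rewrite -derive1E d2; apply: eq_Rintegral => x _; exact: pE.
Qed.

(** [kA s u + i kB s u] is [1 / (u - i s) ^+ 2]. The four derivatives of [cQ] and [cP] below are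
    therefore [cA], [cB], [- cB] and [cA]: the Cauchy-Riemann equations. *)
Definition kA (s u : R) : R := (u ^+ 2 - s ^+ 2) / (u ^+ 2 + s ^+ 2) ^+ 2.
Definition kB (s u : R) : R := 2 * u * s / (u ^+ 2 + s ^+ 2) ^+ 2.

Lemma kA_le (s u : R) : 0 < s -> `|kA s u| <= (s ^+ 2)^-1.
Proof.
move=> s0; have D := sqD_gt0 u s0; rewrite /kA normrM normfV.
rewrite (gtr0_norm (exprn_gt0 2 D)) ler_pdivrMr ?exprn_gt0// ler_pdivlMl ?exprn_gt0//.
have := sqr_ge0 u; have : 0 < s ^+ 2 by rewrite exprn_gt0.
set a := u ^+ 2; set b := s ^+ 2 => b0 a0.
by case: (lerP 0 (a - b)) => h; [rewrite ger0_norm//|rewrite ltr0_norm//]; nra.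
Qed.

Lemma kB_le (s u : R) : 0 < s -> `|kB s u| <= (s ^+ 2)^-1.
Proof.
move=> s0; have D := sqD_gt0 u s0; rewrite /kB normrM normfV.
rewrite (gtr0_norm (exprn_gt0 2 D)) ler_pdivrMr ?exprn_gt0// ler_pdivlMl ?exprn_gt0//.
have h : `|2 * u * s| <= u ^+ 2 + s ^+ 2.
  rewrite ler_norml; have := sqr_ge0 (u + s); have := sqr_ge0 (u - s).
  by rewrite sqrrB sqrrD => h1 h2; apply/andP; split; nra.
have s2 : 0 < s ^+ 2 by rewrite exprn_gt0.
have := sqr_ge0 u; move=> u2.
apply: (@le_trans _ _ (s ^+ 2 * (u ^+ 2 + s ^+ 2))); first by rewrite ler_pM2l.
rewrite [leRHS]expr2 ler_pM2r//; lra.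
Qed.

Lemma measurable_kA (s : R) : measurable_fun setT (kA s).
Proof.
apply: measurable_funM; last first.
  by apply: measurable_funV; apply: measurable_funX; exact: measurable_sqD.
by apply: measurable_funB => //; exact: measurable_funX.
Qed.

Lemma measurable_kB (s : R) : measurable_fun setT (kB s).
Proof.
apply: measurable_funM; last first.
  by apply: measurable_funV; apply: measurable_funX; exact: measurable_sqD.
by apply: measurable_funM => //; exact: measurable_funM.
Qed.

Section density.
Variable sg : R -> R.
Hypothesis msg : measurable_fun setT sg.
Hypothesis ssg : supp sg.
Hypothesis bsg : forall x, `|sg x| <= 1.

Let Lsg : L1r sg. Proof. exact: L1r_bounded bsg. Qed.

Definition cQ (s t : R) := conv (kQ s) sg t.
Definition cP (s t : R) := conv (kP s) sg t.
Definition cA (s t : R) := conv (kA s) sg t.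
Definition cB (s t : R) := conv (kB s) sg t.

Lemma is_derive_cQt (s t : R) : 0 < s -> is_derive t (1:R) (cQ s) (cA s t).
Proof.
move=> s0.
apply: (@derive_param (fun t x => kQ s (x - t)) (fun t x => kA s (x - t)) t (t - 1) (t + 1)
  (s^-1 + (s ^+ 2)^-1)) => //.
- by apply/andP; split; lra.
- move=> q x _; have D := sqD_gt0 (x - q) s0; rewrite /kQ.
  apply: is_derive_eq; first by apply: is_derive_div; rewrite ?gt_eqF.
  rewrite /GRing.scale/= /kA; field; by rewrite gt_eqF.
- by move=> q; exact: measurable_sh (measurable_kQ s).
- by move=> q x _; rewrite (le_trans (kQ_le _ s0))// lerDl invr_ge0 sqr_ge0.
- by move=> q x _; rewrite (le_trans (kA_le _ s0))// lerDr invr_ge0 ltW.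
Qed.

Lemma is_derive_cPt (s t : R) : 0 < s -> is_derive t (1:R) (cP s) (cB s t).
Proof.
move=> s0.
apply: (@derive_param (fun t x => kP s (x - t)) (fun t x => kB s (x - t)) t (t - 1) (t + 1)
  (s^-1 + (s ^+ 2)^-1)) => //.
- by apply/andP; split; lra.
- move=> q x _; have D := sqD_gt0 (x - q) s0; rewrite /kP.
  apply: is_derive_eq; first by apply: is_derive_div; rewrite ?gt_eqF.
  rewrite /GRing.scale/= /kB; field; by rewrite gt_eqF.
- by move=> q; exact: measurable_sh (measurable_kP s).
- move=> q x _; rewrite ger0_norm ?kP_ge0// (le_trans (kP_le _ s0))// lerDl invr_ge0.
  exact: sqr_ge0.
- by move=> q x _; rewrite (le_trans (kB_le _ s0))// lerDr invr_ge0 ltW.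
Qed.

Lemma is_derive_cQs (s t : R) : 0 < s -> is_derive s (1:R) (cQ^~ t) (- cB s t).
Proof.
move=> s0.
have s20 : 0 < s / 2 by rewrite divr_gt0.
have le1 q : s / 2 < q -> q^-1 <= (s / 2)^-1.
  by move=> h; rewrite lef_pV2 ?posrE//; [exact: ltW|exact: lt_trans h].
have le2 q : s / 2 < q -> (q ^+ 2)^-1 <= ((s / 2) ^+ 2)^-1.
  move=> h; have q0 := lt_trans s20 h.
  rewrite lef_pV2 ?posrE ?exprn_gt0// ler_sqr ?nnegrE; [exact: ltW|exact: ltW|exact: ltW].
have := @derive_param (fun s x => kQ s (x - t)) (fun s x => - kB s (x - t)) s (s / 2) (s + 1)
  ((s / 2)^-1 + ((s / 2) ^+ 2)^-1) sg Lsg.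
have -> : Int (fun x => sg x * - kB s (x - t)) = - cB s t.
  rewrite /cB /conv -IntN; first by apply: eq_Int => x; rewrite mulrN.
  exact: L1rM_bounded (measurable_sh t (measurable_kB s)) (fun x => kB_le (x - t) s0).
apply.
- by apply/andP; split; lra.
- move=> q x /andP[q1 _]; have q0 := lt_trans s20 q1; have D := sqD_gt0 (x - t) q0; rewrite /kQ.
  apply: is_derive_eq; first by apply: is_derive_div; rewrite ?gt_eqF.
  rewrite /GRing.scale/= /kB; field; by rewrite gt_eqF.
- by move=> q; exact: measurable_sh (measurable_kQ q).
- move=> q x /andP[q1 _]; have q0 := lt_trans s20 q1.
  rewrite (le_trans (kQ_le _ q0))// (le_trans (le1 _ q1))// lerDl invr_ge0; exact: sqr_ge0.
- move=> q x /andP[q1 _]; have q0 := lt_trans s20 q1.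
  rewrite normrN (le_trans (kB_le _ q0))// (le_trans (le2 _ q1))// lerDr invr_ge0; exact: ltW.
Qed.

Lemma is_derive_cPs (s t : R) : 0 < s -> is_derive s (1:R) (cP^~ t) (cA s t).
Proof.
move=> s0.
have s20 : 0 < s / 2 by rewrite divr_gt0.
have le1 q : s / 2 < q -> q^-1 <= (s / 2)^-1.
  by move=> h; rewrite lef_pV2 ?posrE//; [exact: ltW|exact: lt_trans h].
have le2 q : s / 2 < q -> (q ^+ 2)^-1 <= ((s / 2) ^+ 2)^-1.
  move=> h; have q0 := lt_trans s20 h.
  rewrite lef_pV2 ?posrE ?exprn_gt0// ler_sqr ?nnegrE; [exact: ltW|exact: ltW|exact: ltW].
apply: (@derive_param (fun s x => kP s (x - t)) (fun s x => kA s (x - t)) s (s / 2) (s + 1)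
  ((s / 2)^-1 + ((s / 2) ^+ 2)^-1) sg Lsg).
- by apply/andP; split; lra.
- move=> q x /andP[q1 _]; have q0 := lt_trans s20 q1; have D := sqD_gt0 (x - t) q0; rewrite /kP.
  apply: is_derive_eq; first by apply: is_derive_div; rewrite ?gt_eqF.
  rewrite /GRing.scale/= /kA; field; by rewrite gt_eqF.
- by move=> q; exact: measurable_sh (measurable_kP q).
- move=> q x /andP[q1 _]; have q0 := lt_trans s20 q1.
  rewrite ger0_norm ?kP_ge0// (le_trans (kP_le _ q0))// (le_trans (le1 _ q1))// lerDl invr_ge0.
  exact: sqr_ge0.
- move=> q x /andP[q1 _]; have q0 := lt_trans s20 q1.
  rewrite (le_trans (kA_le _ q0))// (le_trans (le2 _ q1))// lerDr invr_ge0; exact: ltW.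
Qed.

End density.
End conjugate_kernels.

(** * Exponential integrability of conjugate functions *)

Section exponential_bound.
Context {R : realType}.
Notation mu := (@lebesgue_measure R).
Implicit Types sg : R -> R.

Lemma mu_cc (a b : R) : a <= b -> mu `[a, b]%classic = (b - a)%:E.
Proof.
rewrite le_eqVlt => /orP[/eqP ->|ab]; rewrite lebesgue_measure_itv/= lte_fin.
  by rewrite ltxx subrr.
by rewrite ab -EFinB.
Qed.

Lemma Rint_cst_cc (c a b : R) : a <= b -> \int[mu]_(x in `[a, b]) c = c * (b - a).
Proof.
move=> ab; rewrite Rintegral_cst//.
exact: (congr1 (fun z : \bar R => c * fine z) (mu_cc ab)).
Qed.

(* Small enough for [`|al * cP|] to stay below [1/2], hence for [cos (al * cP)] to be bounded
   away from zero. *)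
Definition al : R := (2 * pi)^-1.

Lemma al_gt0 : 0 < al. Proof. by rewrite invr_gt0 mulr_gt0// pi_gt0. Qed.

Section density.
Variable sg : R -> R.
Hypothesis msg : measurable_fun setT sg.
Hypothesis ssg : supp sg.
Hypothesis bsg : forall x, `|sg x| <= 1.

Let Lsg : L1r sg. Proof. exact: L1r_bounded bsg. Qed.

Let sg_le x : `|sg x| <= \1_`[-1, 1] x.
Proof.
rewrite indicE mem_setE in_itv/=.
have [h|h] := boolP (-1 < x < 1); last by rewrite ssg// normr0.
by move: h => /andP[h1 h2]; rewrite (ltW h1) (ltW h2).
Qed.

Lemma conv_abs_le (k : R -> R) (C t : R) : 0 <= C -> measurable_fun setT k ->
  (exists M, forall u, `|k u| <= M) ->
  (forall x, -1 < x < 1 -> `|k (x - t)| <= C) -> `|conv k sg t| <= 2 * C.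
Proof.
move=> C0 mk [M kM] kC.
have LC := @L1r_itv_cst R C (-1) 1.
apply: (@le_trans _ _ (Int (fun x => \1_`[-1, 1] x * C))).
  apply: Int_abs_le => //.
    exact: L1rM_bounded (measurable_sh t mk) (fun x => kM (x - t)).
  move=> x; rewrite normrM.
  have [h|h] := boolP (-1 < x < 1); last by rewrite ssg// normr0 mul0r mulr_ge0// indic_ge0.
  by apply: ler_pM => //; exact: kC.
rewrite Int_itv Rint_cst_cc; last lra.
by rewrite mulrC; lra.
Qed.

Lemma cP_le (s t : R) : 0 < s -> `|cP sg s t| <= pi.
Proof.
move=> s0; have N11 : (-1 : R) < 1 by lra.
apply: le_trans (int_kP_le_pi t s0 N11); rewrite -Int_itv.
have kb x : `|kP s (x - t)| <= s^-1 by rewrite ger0_norm ?kP_ge0// kP_le.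
have mk := measurable_sh t (measurable_kP s).
apply: Int_abs_le.
- exact: L1rM_bounded mk kb.
- exact: L1r_itv_bounded mk kb.
move=> x; rewrite normrM (ger0_norm (kP_ge0 _ s0)) ler_wpM2r//; exact: kP_ge0.
Qed.

Lemma cQ_le (s t : R) : 0 < s -> `|cQ sg s t| <= 2 * s^-1.
Proof.
move=> s0; apply: conv_abs_le; first by rewrite invr_ge0 ltW.
- exact: measurable_kQ.
- by exists s^-1 => u; exact: kQ_le.
- by move=> x _; exact: kQ_le.
Qed.

Lemma cA_le (s t : R) : 0 < s -> `|cA sg s t| <= 2 * (s ^+ 2)^-1.
Proof.
move=> s0; apply: conv_abs_le; first by rewrite invr_ge0 ltW ?exprn_gt0.
- exact: measurable_kA.
- by exists (s ^+ 2)^-1 => u; exact: kA_le.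
- by move=> x _; exact: kA_le.
Qed.

Lemma cB_le (s t : R) : 0 < s -> `|cB sg s t| <= 2 * (s ^+ 2)^-1.
Proof.
move=> s0; apply: conv_abs_le; first by rewrite invr_ge0 ltW ?exprn_gt0.
- exact: measurable_kB.
- by exists (s ^+ 2)^-1 => u; exact: kB_le.
- by move=> x _; exact: kB_le.
Qed.

(** At distance at least one from the support the kernel is at most one, whatever [s] is. For this
    reason the contour has its vertical sides at [-2] and [2] and not at the ends of the support. *)
Lemma cQ_le_far (s t : R) : 0 < s -> 2 <= `|t| -> `|cQ sg s t| <= 2.
Proof.
move=> s0 t2; rewrite -[leRHS]mulr1; apply: conv_abs_le => //.
- exact: measurable_kQ.
- by exists s^-1 => u; exact: kQ_le.
move=> x /andP[x1 x2].
have u1 : 1 <= `|x - t|.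
  by move: t2; rewrite !ler_normr => /orP[] h; apply/orP; [right|left]; lra.
have D := sqD_gt0 (x - t) s0.
rewrite /kQ normrM normfV (gtr0_norm D) ler_pdivrMr// mul1r.
rewrite -[(x - t) ^+ 2]real_normK ?num_real//; move: u1; set a := `|_|.
by have := sqr_ge0 s; nra.
Qed.

(* [Ef + i Sf] is the holomorphic function [exp (al * C)], where [C = cQ + i cP] is the
   Cauchy transform of [sg] at the point [t + i s]; [Df] is [dSf/dt = - dEf/ds]. *)
Definition Ef s t := expR (al * cQ sg s t) * cos (al * cP sg s t).
Definition Sf s t := expR (al * cQ sg s t) * sin (al * cP sg s t).
Definition Df s t := al * expR (al * cQ sg s t) *
  (cB sg s t * cos (al * cP sg s t) + cA sg s t * sin (al * cP sg s t)).

Lemma is_derive_Sf (s t : R) : 0 < s -> is_derive t (1:R) (Sf s) (Df s t).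
Proof.
move=> s0; have h1 := is_derive_cQt msg ssg bsg t s0.
have h2 := is_derive_cPt msg ssg bsg t s0.
have e1 : is_derive t (1:R) (fun t => expR (al * cQ sg s t))
   (expR (al * cQ sg s t) * (al * cA sg s t)).
  apply: (@is_derive1_comp R expR (fun t => al * cQ sg s t)).
have e2 : is_derive t (1:R) (fun t => sin (al * cP sg s t))
   (cos (al * cP sg s t) * (al * cB sg s t)).
  apply: (@is_derive1_comp R sin (fun t => al * cP sg s t)).
by rewrite /Sf; apply: is_derive_eq; rewrite /GRing.scale/= /Df; ring.
Qed.

Lemma is_derive_Ef (s t : R) : 0 < s -> is_derive s (1:R) (Ef^~ t) (- Df s t).
Proof.
move=> s0; have h1 := is_derive_cQs msg ssg bsg t s0.
have h2 := is_derive_cPs msg ssg bsg t s0.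
have e1 : is_derive s (1:R) (fun s => expR (al * cQ sg s t))
   (expR (al * cQ sg s t) * (al * - cB sg s t)).
  apply: (@is_derive1_comp R expR (fun s => al * cQ sg s t)).
have e2 : is_derive s (1:R) (fun s => cos (al * cP sg s t))
   (- sin (al * cP sg s t) * (al * cA sg s t)).
  apply: (@is_derive1_comp R cos (fun s => al * cP sg s t)).
by rewrite /Ef; apply: is_derive_eq; rewrite /GRing.scale/= /Df; ring.
Qed.

Lemma derive_continuous (f : R -> R) (t d : R) : is_derive t (1:R) f d -> {for t, continuous f}.
Proof.
move=> h; apply: differentiable_continuous; apply/derivable1_diffP.
exact: ex_derive.
Qed.

Lemma continuous_cQ (s t : R) : 0 < s -> {for t, continuous (cQ sg s)}.
Proof. by move=> s0; exact: derive_continuous (is_derive_cQt msg ssg bsg t s0). Qed.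

Lemma continuous_cP (s t : R) : 0 < s -> {for t, continuous (cP sg s)}.
Proof. by move=> s0; exact: derive_continuous (is_derive_cPt msg ssg bsg t s0). Qed.

Lemma continuous_conv (k : R -> R) (t C : R) : continuous k -> (forall u, `|k u| <= C) ->
  {for t, continuous (conv k sg)}.
Proof.
move=> ck kC.
have mk : measurable_fun setT k by exact: continuous_measurable_fun.
have h := @continuity_under_integral R _ _ mu (fun t x => sg x * k (x - t)) setT measurableT
  (t - 1) (t + 1) _ _ (fun x => C * `|sg x|) _ _.
apply: h; last by rewrite inE/= in_itv/=; apply/andP; split; lra.
- move=> x _; exact: L1rM_bounded (measurable_sh x mk) (fun y => kC (y - x)).
- apply: aeW => y _ x _.
  apply: cvgM; first exact: cvg_cst.
  apply: (@continuous_comp _ _ _ (fun x => y - x) k); last exact: ck.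
  apply: cvgB; [exact: cvg_cst|exact: cvg_id].
- by apply: L1rZ; exact: L1r_abs.
- move=> x _; apply: aeW => y _; rewrite normrM mulrC ler_wpM2r//.
Qed.

Lemma continuous_kA (s : R) : 0 < s -> continuous (kA s).
Proof.
move=> s0 u; apply: differentiable_continuous; apply/derivable1_diffP.
have h := sqD_gt0 u s0; rewrite /kA.
by apply: derivableM => //; apply: derivableV; rewrite ?gt_eqF// exprn_gt0.
Qed.

Lemma continuous_kB (s : R) : 0 < s -> continuous (kB s).
Proof.
move=> s0 u; apply: differentiable_continuous; apply/derivable1_diffP.
have h := sqD_gt0 u s0; rewrite /kB.
by apply: derivableM => //; apply: derivableV; rewrite ?gt_eqF// exprn_gt0.
Qed.

Lemma continuous_exp_trig (s t : R) (h : R -> R) : 0 < s -> continuous h ->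
  {for t, continuous (fun t => expR (al * cQ sg s t))} /\
  {for t, continuous (fun t => h (al * cP sg s t))}.
Proof.
move=> s0 ch; split.
  apply: (@continuous_comp _ _ _ (fun t => al * cQ sg s t) expR); last exact: continuous_expR.
  by apply: cvgM; [exact: cvg_cst|exact: continuous_cQ].
apply: (@continuous_comp _ _ _ (fun t => al * cP sg s t) h); last exact: ch.
by apply: cvgM; [exact: cvg_cst|exact: continuous_cP].
Qed.

Lemma continuous_Ef (s : R) : 0 < s -> continuous (Ef s).
Proof.
move=> s0 t; have [h1 h2] := continuous_exp_trig t s0 (@continuous_cos R).
exact: cvgM.
Qed.

Lemma continuous_Df (s : R) : 0 < s -> continuous (Df s).
Proof.
move=> s0 t; have [h1 h2] := continuous_exp_trig t s0 (@continuous_cos R).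
have [_ h3] := continuous_exp_trig t s0 (@continuous_sin R).
apply: cvgM; first by apply: cvgM => //; exact: cvg_cst.
apply: cvgD; apply: cvgM => //.
  exact: continuous_conv (continuous_kB s0) (fun u => kB_le u s0).
exact: continuous_conv (continuous_kA s0) (fun u => kA_le u s0).
Qed.

Lemma expQ_le (s t C : R) : `|cQ sg s t| <= C -> expR (al * cQ sg s t) <= expR (al * C).
Proof.
move=> h; rewrite ler_expR ler_pM2l ?al_gt0// (le_trans _ h)//; exact: ler_norm.
Qed.

Definition If s := \int[mu]_(t in `[-2, 2]) Ef s t.

Let N22 : (-2 : R) < 2. Proof. lra. Qed.

(** Since [dEf/ds = - dSf/dt], differentiating under the integral leaves an exact derivative in [t],
    hence only the values of [Sf] on the two vertical sides. This is Cauchy's theorem on a rectangle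
    in differential form. *)
Lemma is_derive_If (s : R) : 0 < s -> is_derive s (1:R) If (- (Sf s 2 - Sf s (-2))).
Proof.
move=> s0.
have s20 : 0 < s / 2 by rewrite divr_gt0.
have s2s : s / 2 < s by lra.
(* [M] and [D] bound the exponential and the kernel derivatives for parameters above [s / 2]. They
   blow up with [1 / s], but they only justify differentiation at a fixed [s]. *)
pose M := expR (al * (2 * (s / 2)^-1)).
pose D := 2 * ((s / 2) ^+ 2)^-1.
have D0 : 0 <= D by rewrite mulr_ge0// invr_ge0 sqr_ge0.
have QM q t : s / 2 < q -> expR (al * cQ sg q t) <= M.
  move=> sq; have q0 := lt_trans s20 sq; apply: expQ_le.
  rewrite (le_trans (cQ_le _ q0))// ler_pM2l// lef_pV2 ?posrE//; exact: ltW.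
have qD q : s / 2 < q -> 2 * (q ^+ 2)^-1 <= D.
  move=> sq; have q0 := lt_trans s20 sq; rewrite ler_pM2l// lef_pV2 ?posrE ?exprn_gt0//.
  by rewrite ler_sqr ?nnegrE; exact: ltW.
have trig (c d x y : R) : `|c| <= 1 -> `|d| <= 1 -> `|x * c + y * d| <= `|x| + `|y|.
  move=> c1 d1; rewrite (le_trans (ler_normD _ _))// !normrM lerD//.
    by rewrite -[leRHS]mulr1 ler_wpM2l.
  by rewrite -[leRHS]mulr1 ler_wpM2l.
have cosb x : `|cos x| <= 1 :> R by rewrite ler_norml cos_geN1 cos_le1.
have sinb x : `|sin x| <= 1 :> R by rewrite ler_norml sin_geN1 sin_le1.
have fin := fin_itv (-2 : R) 2.
have intE q : `]s / 2, s + 1[%classic q -> mu.-integrable `[-2, 2] (EFin \o Ef q).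
  rewrite /= in_itv/= => /andP[sq _]; have q0 := lt_trans s20 sq.
  apply: continuous_compact_integrable; first exact: segment_compact.
  by apply: continuous_subspaceT; exact: continuous_Ef.
have dE q t : `]s / 2, s + 1[%classic q -> `[-2, 2]%classic t -> derivable (Ef^~ t) q 1.
  rewrite /= in_itv/= => /andP[sq _] _; have q0 := lt_trans s20 sq.
  have h := is_derive_Ef t q0; exact: ex_derive.
have pE q t : s / 2 < q -> partial1of2 Ef q t = - Df q t.
  move=> sq; have q0 := lt_trans s20 sq; rewrite partial1of2E.
  have h := is_derive_Ef t q0; exact: derive_val.
have pub q t : `]s / 2, s + 1[%classic q -> `[-2, 2]%classic t ->
    `|partial1of2 Ef q t| <= al * M * (D + D).
  rewrite /= in_itv/= => /andP[sq _] _; have q0 := lt_trans s20 sq; rewrite pE// normrN /Df.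
  rewrite normrM (@ger0_norm _ (al * _)); last by rewrite mulr_ge0 ?expR_ge0// ltW// al_gt0.
  apply: ler_pM => //; first by rewrite mulr_ge0 ?expR_ge0// ltW// al_gt0.
    by rewrite ler_pM2l ?al_gt0// QM.
  rewrite (le_trans (trig _ _ _ _ (cosb _) (sinb _)))// lerD//.
    by rewrite (le_trans (cB_le _ q0))// qD.
  by rewrite (le_trans (cA_le _ q0))// qD.
have Is : `]s / 2, s + 1[%classic s by rewrite /= in_itv/=; apply/andP; split; lra.
have intG : mu.-integrable `[-2, 2] (EFin \o (fun _ : R => al * M * (D + D))).
  apply: continuous_compact_integrable; first exact: segment_compact.
  by apply: continuous_subspaceT => ?; exact: cst_continuous.
have G0 (t : R) : 0 <= al * M * (D + D).
  by rewrite mulr_ge0 ?addr_ge0// mulr_ge0 ?expR_ge0// ltW// al_gt0.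
have d1 := @derivable_under_integral R _ _ mu Ef `[-2, 2]%classic (measurable_itv _) s _ _ Is
  intE dE _ G0 intG pub.
have d2 := @differentiation_under_integral R _ _ mu Ef `[-2, 2]%classic (measurable_itv _) s _ _ Is
  intE dE _ G0 intG pub.
apply: DeriveDef; first exact: d1.
rewrite -derive1E d2.
have [_ <-] := @FTC R (Sf s) (Df s) (-2) 2 N22 (fun t _ => is_derive_Sf t s0)
  (fun t _ => @continuous_Df s s0 t).
have Ls : mu.-integrable `[-2, 2] (EFin \o Df s).
  apply: continuous_compact_integrable; first exact: segment_compact.
  by apply: continuous_subspaceT; exact: continuous_Df.
rewrite -[RHS]mulN1r -RintegralZl//; apply: eq_Rintegral => t _.
by rewrite pE ?mulN1r.
Qed.

(** By the mean value theorem between [s] and 1: at height 1 one has [|cQ| <= 2], so [If 1] is at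
    most [4 * X], and on the vertical sides [|cQ| <= 2] again, so the derivative is at most
    [2 * X]. *)
Lemma If_le (s : R) : 0 < s -> s < 1 -> If s <= 6 * expR (al * 2).
Proof.
move=> s0 s1.
set X := expR (al * 2).
have dI x : x \in `]s, 1[%R -> is_derive x (1:R) If (- (Sf x 2 - Sf x (-2))).
  by rewrite in_itv/= => /andP[sx _]; apply: is_derive_If; rewrite (lt_trans s0).
have cI : {within `[s, 1], continuous If}.
  apply: continuous_in_subspaceT => x; rewrite inE/= in_itv/= => /andP[sx _].
  by apply: derive_continuous (is_derive_If _); rewrite (lt_le_trans s0).
have [c] := @MVT_segment R If _ s 1 (ltW s1) dI cI.
rewrite in_itv/= => /andP[sc _] E.
have c0 : 0 < c := lt_le_trans s0 sc.
have X0 : 0 <= X := expR_ge0 _.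
have Sb t : 2 <= `|t| -> `|Sf c t| <= X.
  move=> t2; rewrite /Sf normrM (ger0_norm (expR_ge0 _)) -[leRHS]mulr1.
  apply: ler_pM => //; first by apply: expQ_le; exact: cQ_le_far.
  by rewrite ler_norml sin_geN1 sin_le1.
have I1 : If 1 <= 4 * X.
  have -> : 4 * X = \int[mu]_(t in `[-2, 2]) X.
    by rewrite Rint_cst_cc; [ring|lra].
  apply: le_Rintegral => //.
  - apply: continuous_compact_integrable; first exact: segment_compact.
    by apply: continuous_subspaceT; exact: continuous_Ef.
  - apply: continuous_compact_integrable; first exact: segment_compact.
    by apply: continuous_subspaceT => ?; exact: cst_continuous.
  move=> t _; rewrite /Ef -[leRHS]mulr1.
  have : expR (al * cQ sg 1 t) <= X.
    by apply: expQ_le; have := cQ_le t (@ltr01 R); rewrite invr1 mulr1.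
  have := expR_ge0 (al * cQ sg 1 t); have := cos_le1 (al * cP sg 1 t).
  set u := expR _; set v := cos _; nra.
have S2 : `|Sf c 2| <= X by apply: Sb; rewrite ger0_norm.
have S2' : `|Sf c (-2)| <= X by apply: Sb; rewrite normrN ger0_norm.
move: S2 S2'; rewrite !ler_norml => /andP[a1 a2] /andP[b1 b2].
nra.
Qed.

Lemma cos_al_ge (s t : R) : 0 < s -> cos 2^-1 <= cos (al * cP sg s t).
Proof.
move=> s0; have := cP_le t s0; set p := cP _ _ _ => hp.
have pi2 := @pi_ge2 R.
have h : `|al * p| <= 2^-1.
  rewrite normrM (gtr0_norm al_gt0) /al ler_pdivrMl; last by rewrite mulr_gt0// pi_gt0.
  lra.
have -> : cos (al * p) = cos `|al * p|.
  by case: (lerP 0 (al * p)) => q; [rewrite ger0_norm|rewrite ltr0_norm// cosN].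
have [-> //|ne] := eqVneq `|al * p| 2^-1.
apply: ltW; rewrite ltr_cos//.
- by rewrite lt_neqAle ne.
- by rewrite in_itv/= normr_ge0/=; lra.
- by rewrite in_itv/=; apply/andP; split; lra.
Qed.

End density.

(** [exp (al * |cQ|)] is at most the sum of the exponentials for [sg] and [- sg], and each of them
    is at most [Ef / cos 2^-1]. The constant is twice the bound on [If] divided by [cos 2^-1]; it
    depends neither on [sg] nor on [s]. *)
Lemma expN_bound : exists2 C : R, 0 < C & forall (sg : R -> R) (s : R),
  measurable_fun setT sg -> supp sg -> (forall x, `|sg x| <= 1) -> 0 < s -> s < 1 ->
  \int[mu]_(t in `[-2, 2]) expR (al * `|conv (kQ s) sg t|) <= C.
Proof.
have c1 : 0 < cos 2^-1 :> R.
  by apply: cos_gt0_pihalf; have := @pi_ge2 R; move=> h; apply/andP; split; lra.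
exists (12 * expR (al * 2) / cos 2^-1).
  by rewrite divr_gt0// mulr_gt0// expR_gt0.
move=> sg s msg ssg bsg s0 s1.
have half (sg' : R -> R) : measurable_fun setT sg' -> supp sg' -> (forall x, `|sg' x| <= 1) ->
   mu.-integrable `[-2, 2] (EFin \o (fun t => expR (al * cQ sg' s t))) /\
   \int[mu]_(t in `[-2, 2]) expR (al * cQ sg' s t) <= 6 * expR (al * 2) / cos 2^-1.
  move=> m1 m2 m3.
  have L : mu.-integrable `[-2, 2] (EFin \o (fun t => expR (al * cQ sg' s t))).
    apply: continuous_compact_integrable; first exact: segment_compact.
    apply: continuous_subspaceT => t.
    by have [] := continuous_exp_trig m1 m2 m3 t s0 (@continuous_cos R).
  split => //; rewrite ler_pdivlMr// -RintegralZr//.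
  apply: le_trans (If_le m1 m2 m3 s0 s1); apply: le_Rintegral => //.
  - rewrite (_ : EFin \o _ = (fun t => (cos 2^-1)%:E * (expR (al * cQ sg' s t))%:E)%E).
      exact: integrableZl.
    by apply/funext => t /=; rewrite muleC.
  - apply: continuous_compact_integrable; first exact: segment_compact.
    by apply: continuous_subspaceT; exact: continuous_Ef.
  - by move=> t _; rewrite ler_wpM2l ?expR_ge0// cos_al_ge.
have [L1 B1] := half sg msg ssg bsg.
have [|||L2 B2] := half (fun x => - sg x).
- exact: measurableT_comp.
- by move=> x h; rewrite ssg// oppr0.
- by move=> x; rewrite normrN.
have cQN t : cQ (fun x => - sg x) s t = - cQ sg s t.
  rewrite /cQ /conv -IntN; first by apply: eq_Int => x; rewrite mulNr.
  exact: L1rM_bounded (L1r_bounded msg ssg bsg) (measurable_sh t (measurable_kQ s))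
    (fun x => kQ_le (x - t) s0).
have -> : 12 * expR (al * 2) / cos 2^-1 = 6 * expR (al * 2) / cos 2^-1 + 6 * expR (al * 2) / cos 2^-1 :> R.
  by field; rewrite gt_eqF.
apply: le_trans (lerD B1 B2).
rewrite -RintegralD//; apply: le_Rintegral => //.
- apply: continuous_compact_integrable; first exact: segment_compact.
  apply: continuous_subspaceT => t.
  apply: (@continuous_comp _ _ _ (fun t => al * `|cQ sg s t|) expR); last exact: continuous_expR.
  apply: cvgM; first exact: cvg_cst.
  by apply: cvg_norm; exact: continuous_cQ.
- exact: (@integrableD _ _ R mu _ (measurable_itv _) _ _ L1 L2).
- move=> t _; rewrite cQN -/(cQ sg s t); case: (lerP 0 (cQ sg s t)) => h.
    by rewrite ger0_norm// lerDl expR_ge0.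
  by rewrite ltr0_norm// lerDr expR_ge0.
Qed.

End exponential_bound.

(** * Fubini for bounded kernels, and measurability of [conv] *)

Section fubini.
Context {R : realType}.
Notation mu := (@lebesgue_measure R).
Implicit Types f g k : R -> R.

Lemma integrable_prod_conv f g k (C : R) : L1r f -> L1r g -> measurable_fun setT k ->
  (forall u, `|k u| <= C) ->
  L1r (fun t => g t * conv k f t) /\
  (mu \x mu)%E.-integrable setT
    (fun z : measurableTypeR R * measurableTypeR R => (g z.1 * (f z.2 * k (z.2 - z.1)))%:E).
Proof.
move=> Lf Lg mk kC.
pose F (z : measurableTypeR R * measurableTypeR R) : \bar R :=
  (g z.1 * (f z.2 * k (z.2 - z.1)))%:E.
have C0 : 0 <= C by rewrite (le_trans _ (kC 0)).
have mF : measurable_fun setT F.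
  apply/measurable_EFinP; apply: measurable_funM.
    exact: (measurableT_comp (L1r_meas Lg) measurable_fst).
  apply: measurable_funM; first exact: (measurableT_comp (L1r_meas Lf) measurable_snd).
  apply: (measurableT_comp mk); apply: measurable_funB; [exact: measurable_snd|exact: measurable_fst].
have mabsF : measurable_fun setT (abse \o F) by apply: measurableT_comp mF.
have Lfk t : L1r (fun x => f x * k (x - t)).
  exact: L1rM_bounded Lf (measurable_sh t mk) (fun x => kC (x - t)).
have F1 t : (\int[mu]_x F (t, x) = (g t * conv k f t)%:E)%E.
  rewrite /conv -IntZ// EFin_Int//; exact: L1rZ.
have iF : (mu \x mu)%E.-integrable setT F.
  apply/integrable12ltyP => //.
  apply: (@le_lt_trans _ _ (\int[mu]_t (`|g t| * (Int (fun x => `|f x|) * C))%:E)%E); last first.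
    have : L1r (fun t => (Int (fun x => `|f x|) * C) * `|g t|) by apply: L1rZ; exact: L1r_abs.
    move=> L; rewrite [ltLHS](_ : _ = (Int (fun t => (Int (fun x => `|f x|) * C) * `|g t|))%:E).
      by rewrite ltry.
    by rewrite EFin_Int//; apply: eq_integral => t _; rewrite mulrC.
  apply: ge0_le_integral => //.
  - by move=> t _; exact: integral_ge0.
  - exact: (@measurable_fun_fubini_tonelli_F _ _ _ _ R mu (abse \o F) mabsF
      (fun z => abse_ge0 (F z))).
  - apply/measurable_EFinP; apply: measurable_funM => //.
    by apply: measurableT_comp => //; exact: L1r_meas.
  move=> t _; rewrite [leRHS](_ : _ = \int[mu]_x (`|g t| * (`|f x| * C))%:E)%E; last first.
    rewrite -EFin_Int; last first.
      apply: L1rZ; rewrite (_ : (fun x => _) = (fun x => C * `|f x|)).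
        by apply: L1rZ; exact: L1r_abs.
      by apply/funext => x; rewrite mulrC.
    rewrite IntZ; last first.
      rewrite (_ : (fun x => _) = (fun x => C * `|f x|)).
        by apply: L1rZ; exact: L1r_abs.
      by apply/funext => x; rewrite mulrC.
    congr (_ * _)%:E; rewrite mulrC -IntZ; last exact: L1r_abs.
    by apply: eq_Int => x; rewrite mulrC.
  apply: ge0_le_integral => //.
  - exact: (measurableT_comp (@abse_measurable R setT) (EFin_meas (L1r_meas (L1rZ (g t) (Lfk t))))).
  - apply/measurable_EFinP; apply: measurable_funM => //; apply: measurable_funM => //.
    by apply: measurableT_comp => //; exact: L1r_meas.
  move=> x _; rewrite lee_fin !normrM ler_wpM2l// ler_wpM2l//.
have L1 : L1r (fun t => g t * conv k f t).
  have := integrable_fubini_F iF.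
  by rewrite /fubini_F (_ : (fun x => _) = EFin \o (fun t => g t * conv k f t))//;
    apply/funext => t; rewrite F1.
by [].
Qed.

Lemma FubiniK f g k (C : R) : L1r f -> L1r g -> measurable_fun setT k ->
  (forall u, `|k u| <= C) ->
  [/\ L1r (fun t => g t * conv k f t),
      L1r (fun x => f x * Int (fun t => g t * k (x - t))) &
      Int (fun t => g t * conv k f t) =
      Int (fun x => f x * Int (fun t => g t * k (x - t)))].
Proof.
move=> Lf Lg mk kC; have [L1 iF] := integrable_prod_conv Lf Lg mk kC.
have mkN : measurable_fun setT (fun u : R => k (- u)) by apply: (measurableT_comp mk).
have [L2 _] := integrable_prod_conv Lg Lf mkN (fun u => kC (- u)).
have cE x : conv (fun u => k (- u)) g x = Int (fun t => g t * k (x - t)).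
  by apply: eq_Int => t; rewrite opprB.
have {}L2 : L1r (fun x => f x * Int (fun t => g t * k (x - t))).
  by under eq_fun do rewrite -cE.
split; [exact: L1|exact: L2|].
have Lfk t : L1r (fun x => f x * k (x - t)).
  exact: L1rM_bounded Lf (measurable_sh t mk) (fun x => kC (x - t)).
have mks x : measurable_fun setT (fun t : R => k (x - t)).
  by apply: (measurableT_comp mk); exact: measurable_funB.
have Lgk x : L1r (fun t => g t * k (x - t)).
  exact: L1rM_bounded Lg (mks x) (fun t => kC (x - t)).
have F1 t : (\int[mu]_x (g t * (f x * k (x - t)))%:E = (g t * conv k f t)%:E)%E.
  rewrite /conv -IntZ// EFin_Int//; exact: L1rZ.
have F2 x : (\int[mu]_t (g t * (f x * k (x - t)))%:E = (f x * Int (fun t => g t * k (x - t)))%:E)%E.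
  rewrite -IntZ// EFin_Int; last exact: L1rZ.
  by apply: eq_integral => t _; congr (_%:E); ring.
have /= := Fubini iF.
under eq_integral do rewrite F1.
under [X in _ = X -> _]eq_integral do rewrite F2.
by rewrite -(EFin_Int L1) -(EFin_Int L2) => -[].
Qed.

Lemma conv_bounded f k (C t : R) : L1r f -> measurable_fun setT k ->
  (forall u, `|k u| <= C) -> `|conv k f t| <= C * Int (fun x => `|f x|).
Proof.
move=> Lf mk kC; rewrite -IntZ; last exact: L1r_abs.
apply: Int_abs_le.
- exact: L1rM_bounded Lf (measurable_sh t mk) (fun x => kC (x - t)).
- by apply: L1rZ; exact: L1r_abs.
by move=> x; rewrite normrM mulrC ler_wpM2r.
Qed.

(** Fubini yields measurability only of [conv k f] times an integrable function; the indicators of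
    [[-n, n]] are such functions, and the products converge pointwise. *)
Lemma measurable_conv f k (C : R) : L1r f -> measurable_fun setT k ->
  (forall u, `|k u| <= C) -> measurable_fun setT (conv k f).
Proof.
move=> Lf mk kC.
have key n : measurable_fun setT (fun t : R => \1_`[- n%:R, n%:R] t * conv k f t : R).
  by have [/L1r_meas] := FubiniK Lf (L1r_itv (fin_itv (- n%:R) n%:R)) mk kC.
apply: (@measurable_fun_cvg _ _ _ _ (fun n (t : R) => \1_`[- n%:R, n%:R] t * conv k f t : R)) => //.
move=> t _; apply: cvg_near_cst; near=> n.
rewrite indicE mem_setE in_itv/= -ler_norml (_ : _ <= _) ?mul1r//.
by near: n; exact: nbhs_infty_ger.
Unshelve. all: end_near. Qed.

End fubini.

(** * The Zygmund class *)

Section zygmund.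
Context {R : realType}.
Notation mu := (@lebesgue_measure R).
Implicit Types f g k : R -> R.

Definition Phi (v : R) : R := v * ln (1 + v).

Lemma Phi0 : Phi 0 = 0. Proof. by rewrite /Phi mul0r. Qed.

Lemma ln1_ge0 (v : R) : 0 <= v -> 0 <= ln (1 + v).
Proof. by move=> v0; apply: ln_ge0; rewrite lerDl. Qed.

Lemma Phi_ge0 (v : R) : 0 <= v -> 0 <= Phi v.
Proof. by move=> v0; rewrite mulr_ge0// ln1_ge0. Qed.

Lemma le_Phi (a b : R) : 0 <= a -> a <= b -> Phi a <= Phi b.
Proof.
move=> a0 ab; have b0 := le_trans a0 ab; apply: ler_pM => //; first exact: ln1_ge0.
by rewrite ler_ln ?posrE ?lerD2l// ltr_pwDl.
Qed.

Lemma PhiD (a b : R) : 0 <= a -> 0 <= b -> Phi (a + b) <= Phi (2 * a) + Phi (2 * b).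
Proof.
move=> a0 b0.
have h2a : 0 <= 2 * a by rewrite mulr_ge0.
have h2b : 0 <= 2 * b by rewrite mulr_ge0.
have pa := Phi_ge0 h2a; have pb := Phi_ge0 h2b.
case: (leP a b) => h.
  apply: (@le_trans _ _ (Phi (2 * b))); last by rewrite lerDr.
  by apply: le_Phi; [rewrite addr_ge0|lra].
apply: (@le_trans _ _ (Phi (2 * a))); last by rewrite lerDl.
by apply: le_Phi; [rewrite addr_ge0|lra].
Qed.

(** From [1 + M * v <= (1 + M) * (1 + v)]. This growth condition makes [Phi (M * |f|)] integrable
    for every [M] once [Phi |f|] is, as approximation at all scales [M] demands. *)
Lemma PhiM (M v : R) : 0 <= M -> 0 <= v ->
  Phi (M * v) <= M * ln (1 + M) * v + M * Phi v.
Proof.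
move=> M0 v0; rewrite /Phi.
have h : ln (1 + M * v) <= ln (1 + M) + ln (1 + v).
  have h : 0 <= M * v by rewrite mulr_ge0.
  have p1 : 0 < 1 + M by lra.
  have p2 : 0 < 1 + v by lra.
  have p3 : 0 < 1 + M * v by lra.
  rewrite -lnM ?posrE// ler_ln ?posrE ?mulr_gt0//; nra.
have : 0 <= M * v by rewrite mulr_ge0.
move=> h1; have := ler_wpM2l h1 h; set a := ln _; set b := ln _; set c := ln _.
by move=> h2; nra.
Qed.

Lemma le_Phi_lin (v : R) : 0 <= v -> v <= expR 1 + Phi v.
Proof.
move=> v0; case: (leP v (expR 1)) => h.
  by rewrite (le_trans h)// lerDl Phi_ge0.
have l1 : 1 <= ln (1 + v).
  rewrite -[leLHS](@expRK R) ler_ln ?posrE ?expR_gt0 ?ltr_pwDl//.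
  by rewrite (le_trans (ltW h))// lerDr.
apply: (@le_trans _ _ (Phi v)); last by rewrite lerDr expR_ge0.
by rewrite /Phi ler_peMr.
Qed.

(** If [y <= ln (1 + x)] the first term suffices. Otherwise put [y = ln (1 + x) + d]: then [expR y]
    is at least [(1 + x) * (1 + d)], which absorbs the excess [x * d]. *)
Lemma young (x y : R) : 0 <= x -> 0 <= y -> x * y <= Phi x + expR y.
Proof.
move=> x0 y0; have l0 := ln1_ge0 x0; case: (leP y (ln (1 + x))) => h.
  rewrite (le_trans (ler_wpM2l x0 h))// lerDl; exact: expR_ge0.
have -> : expR y = (1 + x) * expR (y - ln (1 + x)).
  by rewrite expRB lnK ?posrE ?ltr_pwDl// mulrC divfK// gt_eqF// ltr_pwDl.
have := expR_ge1Dx (y - ln (1 + x)); rewrite /Phi.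
set e := expR _; set L := ln _ in l0 h *; move=> he.
nra.
Qed.

Lemma measurable_Phi : measurable_fun setT Phi.
Proof.
apply: measurable_funM => //; apply: (measurableT_comp (@measurable_ln R)).
exact: measurable_funD.
Qed.

Lemma measurable_Phi_abs (M : R) f : measurable_fun setT f ->
  measurable_fun setT (fun x : R => Phi (M * `|f x|)).
Proof.
move=> mf; apply: (measurableT_comp measurable_Phi).
by apply: measurable_funM => //; exact: measurableT_comp.
Qed.

(* The Zygmund class through its Young function; [rearr_Phi] relates it to the rearrangement. *)
Definition Zyg f := [/\ measurable_fun setT f, supp f & L1r (fun x => Phi `|f x|)].

Let I11 : set R := `]-1, 1[%classic.

Let measurable_I11 : measurable_fun setT (\1_I11 : R -> R).
Proof. by apply: measurable_indic; exact: measurable_itv. Qed.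

Lemma L1r_I : L1r (\1_I11 : R -> R).
Proof.
apply: L1r_itv; rewrite lebesgue_measure_itv/=.
by case: ifP => _; rewrite -?EFinB ltry.
Qed.

Lemma supp_indic f x : supp f -> f x = \1_I11 x * f x.
Proof.
move=> sf; rewrite indicE mem_setE in_itv/=.
by case: (boolP (-1 < x < 1)) => h; rewrite ?mul1r// sf// mul0r.
Qed.

Lemma Zyg_L1 f : Zyg f -> L1r f.
Proof.
move=> [mf sf LP].
apply: (@L1r_le R f (fun x => expR 1 * \1_I11 x + Phi `|f x|) mf).
  by apply: L1rD => //; apply: L1rZ; exact: L1r_I.
move=> x; rewrite {1}(supp_indic x sf) normrM (ger0_norm (indic_ge0 _ _)).
have := le_Phi_lin (normr_ge0 (f x)); have := Phi_ge0 (normr_ge0 (f x)).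
rewrite indicE; case: (_ \in _) => /= a b; rewrite ?mul1r ?mulr1// mul0r mulr0 add0r//.
Qed.

Lemma Zyg_M f (M : R) : 0 <= M -> Zyg f -> L1r (fun x => Phi (M * `|f x|)).
Proof.
move=> M0 Zf; have Lf := Zyg_L1 Zf; case: Zf => mf sf LP.
apply: (@L1r_le R _ (fun x => M * ln (1 + M) * `|f x| + M * Phi `|f x|)).
- exact: measurable_Phi_abs.
- by apply: L1rD; apply: L1rZ => //; exact: L1r_abs.
move=> x; rewrite ger0_norm; first exact: PhiM.
by apply: Phi_ge0; rewrite mulr_ge0.
Qed.

Lemma Zyg_D f g : Zyg f -> Zyg g -> Zyg (fun x => f x + g x).
Proof.
move=> Zf Zg; have L1 := Zyg_M (ler0n _ 2) Zf; have L2 := Zyg_M (ler0n _ 2) Zg.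
case: Zf => mf sf _; case: Zg => mg sg _.
have mD : measurable_fun setT (fun x => f x + g x) by exact: measurable_funD.
split => //; first by move=> x h; rewrite sf// sg// addr0.
apply: (@L1r_le R _ _ _ (L1rD L1 L2)).
  have := measurable_Phi_abs 1 mD; under eq_fun do rewrite mul1r; exact.
move=> x; rewrite ger0_norm ?Phi_ge0//.
apply: le_trans (PhiD _ _) => //.
by apply: le_Phi => //; exact: ler_normD.
Qed.

Lemma Zyg_Z f (c : R) : Zyg f -> Zyg (fun x => c * f x).
Proof.
move=> Zf; have L := Zyg_M (normr_ge0 c) Zf.
case: Zf => mf sf _; split; first exact: measurable_funM.
  by move=> x h; rewrite sf// mulr0.
by under eq_fun do rewrite normrM.
Qed.

Lemma Zyg_B f g : Zyg f -> Zyg g -> Zyg (fun x => f x - g x).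
Proof.
move=> Zf Zg; have := Zyg_D Zf (Zyg_Z (-1) Zg).
by under eq_fun do rewrite mulN1r.
Qed.

Lemma Zyg_bounded f (C : R) : measurable_fun setT f -> supp f -> (forall x, `|f x| <= C) ->
  Zyg f.
Proof.
move=> mf sf fC; split => //.
have C0 : 0 <= C by rewrite (le_trans _ (fC 0)).
apply: (@L1r_bounded _ _ (Phi C)).
- by have := measurable_Phi_abs 1 mf; under eq_fun do rewrite mul1r; exact.
- by move=> x h; rewrite sf// normr0 Phi0.
- by move=> x; rewrite ger0_norm ?Phi_ge0//; exact: le_Phi.
Qed.

Definition normI f : R := Int (fun t => \1_I11 t * `|f t|).

Lemma L1r_normI_bounded f (C : R) : measurable_fun setT f -> (forall x, `|f x| <= C) ->
  L1r (fun t => \1_I11 t * `|f t|).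
Proof.
move=> mf fC; apply: (@L1rM_bounded _ _ _ C); first exact: L1r_I.
  exact: measurableT_comp.
by move=> x; rewrite normr_id.
Qed.

Lemma kQN (s u : R) : kQ s (- u) = - kQ s u.
Proof. by rewrite /kQ sqrrN mulNr. Qed.

(* Duality: test [conv (kQ s) f] against its own sign, and use Young's inequality with the
   uniform exponential integrability of [conv (kQ s)] of functions bounded by one. *)
Lemma L1_bound : exists2 C0 : R, 0 < C0 & forall f (s M : R), Zyg f -> 0 < s -> s < 1 -> 0 < M ->
  normI (conv (kQ s) f) <= (al * M)^-1 * (Int (fun x => Phi (M * `|f x|)) + C0).
Proof.
have [C0 C00 HC] := @expN_bound R; exists C0 => //.
move=> f s M Zf s0 s1 M0.
have Lf := Zyg_L1 Zf; have LM := Zyg_M (ltW M0) Zf; case: Zf => mf sf LP.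
have kQb := fun u => kQ_le u s0.
have mQ := measurable_kQ s.
have mc := measurable_conv Lf mQ kQb.
pose sg (t : R) : R := \1_I11 t * (if 0 <= conv (kQ s) f t then 1 else -1).
have msg : measurable_fun setT sg.
  apply: measurable_funM; first exact: measurable_I11.
  by apply: measurable_fun_ifT => //; exact: measurable_fun_ler.
have ssg : supp sg.
  by move=> x h; rewrite /sg indicE mem_setE in_itv/= (negbTE h) mul0r.
have bsg x : `|sg x| <= 1.
  rewrite /sg normrM (ger0_norm (indic_ge0 _ _)).
  by case: ifP => _; rewrite ?normrN normr1 mulr1 indic_le1.
have -> : normI (conv (kQ s) f) = Int (fun t => sg t * conv (kQ s) f t).
  by apply: eq_Int => t; rewrite /sg -mulrA; congr (_ * _); case: ifPn => h;
     [rewrite mul1r ger0_norm|rewrite mulN1r ltr0_norm// ltNge].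
have al0 := @al_gt0 R.
have aM : 0 < al * M by rewrite mulr_gt0.
have ptw x : `|f x * - conv (kQ s) sg x| <= (al * M)^-1 * (Phi (M * `|f x|) +
    \1_`[-2, 2] x * expR (al * `|conv (kQ s) sg x|)).
  rewrite normrM normrN ler_pdivlMl//.
  have [h|h] := boolP (-1 < x < 1); last first.
    rewrite sf// normr0 mul0r !mulr0 Phi0 add0r.
    by apply: mulr_ge0; [exact: indic_ge0|exact: expR_ge0].
  rewrite indicE mem_setE in_itv/= (_ : (-2 <= x <= 2) = true); last first.
    by move: h => /andP[h1 h2]; apply/andP; split; lra.
  rewrite mul1r (_ : al * M * _ = (M * `|f x|) * (al * `|conv (kQ s) sg x|)); last by ring.
  apply: young; first by rewrite mulr_ge0// (ltW M0).
  by rewrite mulr_ge0// (ltW al0).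
have eN x : `|expR (al * `|conv (kQ s) sg x|)| = expR (al * `|conv (kQ s) sg x|).
  by rewrite ger0_norm// expR_ge0.
have Lsg := L1r_bounded msg ssg bsg.
have cN x : Int (fun t => sg t * kQ s (x - t)) = - conv (kQ s) sg x.
  rewrite /conv -IntN; last exact: L1rM_bounded Lsg (measurable_sh x mQ) (fun t => kQb (t - x)).
  by apply: eq_Int => t; rewrite -mulrN -kQN opprB.
have Le : L1r (fun x => \1_`[-2, 2] x * expR (al * `|conv (kQ s) sg x|)).
  apply: (@L1r_itv_bounded R _ _ (expR (al * (s^-1 * Int (fun x => `|sg x|))))).
    apply: (measurableT_comp (@measurable_expR R)).
    apply: measurable_funM; first exact: measurable_cst.
    apply: measurableT_comp; first exact: normr_measurable.
    exact: measurable_conv Lsg mQ kQb.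
  by move=> x; rewrite eN ler_expR (ler_pM2l al0); exact: conv_bounded.
have Lh := L1rD LM Le.
have [_ L2 ->] := FubiniK Lf Lsg mQ kQb.
apply: (le_trans (ler_norm _)).
apply: (le_trans (Int_abs_le L2 (L1rZ (al * M)^-1 Lh) _)).
  by move=> x; rewrite cN; exact: ptw.
rewrite (IntZ _ Lh) (IntD LM Le) Int_itv.
apply: ler_wpM2l; first by rewrite invr_ge0 (ltW aM).
by rewrite lerD2l; exact: HC.
Qed.

(* The regularised Hilbert transforms of [f] are Cauchy in [L^1(-1,1)]. *)
Definition Good f := forall e, 0 < e -> exists2 d, 0 < d & forall s s', 0 < s -> s < d ->
  0 < s' -> s' < d -> normI (fun t => conv (kQ s) f t - conv (kQ s') f t) <= e.

Lemma convB k f g (C t : R) : measurable_fun setT k -> (forall u, `|k u| <= C) -> L1r f -> L1r g ->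
  conv k (fun x => f x - g x) t = conv k f t - conv k g t.
Proof.
move=> mk kC Lf Lg; rewrite /conv -IntB.
- by apply: eq_Int => x; rewrite mulrBl.
- exact: L1rM_bounded Lf (measurable_sh t mk) (fun x => kC (x - t)).
- exact: L1rM_bounded Lg (measurable_sh t mk) (fun x => kC (x - t)).
Qed.

Lemma L1r_conv_normI f (s : R) : L1r f -> 0 < s -> L1r (fun t => \1_I11 t * `|conv (kQ s) f t|).
Proof.
move=> Lf s0; apply: L1r_normI_bounded.
  exact: measurable_conv Lf (measurable_kQ s) (fun u => kQ_le u s0).
by move=> x; exact: conv_bounded Lf (measurable_kQ s) (fun u => kQ_le u s0).
Qed.

Lemma L1r_convB_normI f g (s s' : R) : L1r f -> L1r g -> 0 < s -> 0 < s' ->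
  L1r (fun t => \1_I11 t * `|conv (kQ s) f t - conv (kQ s') g t|).
Proof.
move=> Lf Lg s0 s'0.
have b1 x := conv_bounded x Lf (measurable_kQ s) (fun u => kQ_le u s0).
have b2 x := conv_bounded x Lg (measurable_kQ s') (fun u => kQ_le u s'0).
apply: L1r_normI_bounded.
  apply: measurable_funB; first exact: measurable_conv Lf (measurable_kQ s) (fun u => kQ_le u s0).
  exact: measurable_conv Lg (measurable_kQ s') (fun u => kQ_le u s'0).
by move=> x; apply: (le_trans (ler_normB _ _)); exact: lerD (b1 x) (b2 x).
Qed.

(** The constant in [L1_bound] does not shrink with [f]; the free scale [M] makes up for this. If
    the integral of [Phi (M * |f - g|)] is at most one, the regularised transforms of [f - g] have
    norm at most [(1 + C0) / (al * M)], which is [e / 4] for the [M] chosen, at every height below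
    one. *)
Lemma Good_approx f : Zyg f ->
  (forall M, 0 < M -> exists g, [/\ Zyg g, Good g &
     Int (fun x => Phi (M * `|f x - g x|)) <= 1]) -> Good f.
Proof.
move=> Zf H e e0; have [C0 C00 HC] := L1_bound.
pose M := 4 * (1 + C0) / (al * e).
have M0 : 0 < M by rewrite /M divr_gt0 ?mulr_gt0 ?addr_gt0 ?al_gt0.
have [g [Zg Gg le1]] := H M M0.
have e20 : 0 < e / 2 by rewrite divr_gt0.
have [d d0 dP] := Gg _ e20.
exists (Num.min d 1); first by rewrite lt_min d0 ltr01.
move=> s s'; rewrite !lt_min => s0 /andP[sd s1] s'0 /andP[s'd s'1].
have Lf := Zyg_L1 Zf; have Lg := Zyg_L1 Zg.
have Zfg := Zyg_B Zf Zg; have Lfg := Zyg_L1 Zfg.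
have small q : 0 < q -> q < 1 -> normI (conv (kQ q) (fun x => f x - g x)) <= e / 4.
  move=> q0 q1; apply: (le_trans (HC _ _ _ Zfg q0 q1 M0)).
  have aM : 0 < al * M by rewrite mulr_gt0// al_gt0.
  apply: (@le_trans _ _ ((al * M)^-1 * (1 + C0))).
    by rewrite ler_pM2l ?invr_gt0// lerD2r.
  rewrite /M le_eqVlt; apply/orP; left; apply/eqP; field.
  by rewrite !gt_eqF ?al_gt0// addr_gt0.
have cB q (q0 : 0 < q) t : conv (kQ q) (fun x => f x - g x) t = conv (kQ q) f t - conv (kQ q) g t.
  exact: convB (measurable_kQ q) (fun u => kQ_le u q0) Lf Lg.
have E : e = e / 4 + (e / 2 + e / 4) by lra.
rewrite E; apply: le_trans (lerD (small s s0 s1) (lerD (dP s s' s0 sd s'0 s'd) (small s' s'0 s'1))).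
have L1 := L1r_conv_normI Lfg s0; have L2 := L1r_conv_normI Lfg s'0.
have L3 := L1r_convB_normI Lg Lg s0 s'0.
have L4 := L1r_convB_normI Lf Lf s0 s'0.
rewrite /normI -!IntD//; last exact: L1rD.
apply: Int_le => //; first by apply: L1rD => //; exact: L1rD.
move=> t; rewrite -!mulrDr ler_wpM2l ?indic_ge0// !cB//.
set a := conv _ f t; set b := conv _ g t; set c := conv _ f t; set d' := conv _ g t.
have -> : a - c = (a - b) + ((b - d') + (d' - c)) by ring.
by rewrite (le_trans (ler_normD _ _))// lerD2l (le_trans (ler_normD _ _))// lerD2l distrC.
Qed.

End zygmund.

(** * Convergence in L^1(-1,1): from Lipschitz functions to the Zygmund class *)

Section good.
Context {R : realType}.
Notation mu := (@lebesgue_measure R).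
Implicit Types f g k : R -> R.

Let I11 : set R := `]-1, 1[%classic.

Lemma kP_abs_le (s u : R) : 0 < s -> `|kP s u| <= s^-1.
Proof. by move=> s0; rewrite ger0_norm ?kP_ge0// kP_le. Qed.

Lemma Int_I_le : Int (\1_I11 : R -> R) <= 2.
Proof.
have -> : (2 : R) = Int (fun x => \1_`[-1, 1] x * 1).
  by rewrite Int_itv Rint_cst_cc; lra.
apply: Int_le; [exact: L1r_I|exact: L1r_itv_cst|].
move=> x; rewrite !indicE !mem_setE !in_itv/= mulr1.
by case: (boolP (-1 < x < 1)) => [/andP[/ltW -> /ltW ->]|].
Qed.

(** The kernel being odd on the window, [f x] may be replaced by [f x - f t]. The factor [|x - t|]
    gained from the Lipschitz bound removes the singularity: as [u * kQ s u = 1 - s * kP s u], the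
    difference of two regularisations is at most [L] times the integral of [s * kP s + s' * kP s'],
    that is [L * ((s + s') * pi)]. *)
Lemma Good_lipschitz f (L : R) : measurable_fun setT f -> supp f -> 0 <= L ->
  (forall x y, `|f x - f y| <= L * `|x - y|) -> L1r f -> Good f.
Proof.
move=> mf sf L0 lip Lf e e0.
have pi0 := @pi_gt0 R.
have K0 : 0 < 4 * (L + 1) * pi by rewrite !mulr_gt0// ltr_pwDr.
(* The pointwise bound [L * ((s + s') * pi)] is integrated over a set of length two; the 4 accounts
   for this and for the two heights. *)
exists (e / (4 * (L + 1) * pi)); first by rewrite divr_gt0.
move=> s s' s0; rewrite ltr_pdivlMr// => sd s'0; rewrite ltr_pdivlMr// => s'd.
have LJ (t q : R) (q0 : 0 < q) := L1r_itv_bounded (t - 3) (t + 3) (measurable_sh t (measurable_kQ q))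
  (fun x => kQ_le (x - t) q0).
have LP (t q : R) (q0 : 0 < q) := L1r_itv_bounded (t - 3) (t + 3) (measurable_sh t (measurable_kP q))
  (fun x => kP_abs_le (x - t) q0).
have bound t : -1 < t < 1 ->
    `|conv (kQ s) f t - conv (kQ s') f t| <= L * ((s + s') * pi).
  move=> /andP[t1 t2].
  have t3 : t - 3 < t + 3 by lra.
  have Lc (q : R) : 0 < q -> L1r (fun x => f x * kQ q (x - t)).
    by move=> q0; exact: L1rM_bounded Lf (measurable_sh t (measurable_kQ q)) (fun x => kQ_le (x - t) q0).
  have cE (q : R) : 0 < q -> conv (kQ q) f t = Int (fun x => \1_`[t - 3, t + 3] x * ((f x - f t) * kQ q (x - t))).
    move=> q0; have z : f t * Int (fun x => \1_`[t - 3, t + 3] x * kQ q (x - t)) = 0.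
      by rewrite Int_itv int_kQ// mulr0.
    rewrite /conv -[LHS]subr0 -z -IntZ; last exact: LJ.
    rewrite -IntB; [|exact: Lc|exact/L1rZ/LJ].
    apply: eq_Int => x; rewrite indicE mem_setE in_itv/=.
    have [h|h] := boolP (t - 3 <= x <= t + 3); first by rewrite !mul1r mulrBl.
    rewrite !mul0r mulr0 subr0 sf ?mul0r//.
    by apply: contra h => /andP[? ?]; apply/andP; split; lra.
  have Ld (q : R) : 0 < q -> L1r (fun x => \1_`[t - 3, t + 3] x * ((f x - f t) * kQ q (x - t))).
    move=> q0; have := L1rB (L1r_itvf (t - 3) (t + 3) (Lc q q0)) (L1rZ (f t) (LJ t q q0)).
    rewrite (_ : (fun x => _ - _) = (fun x => \1_`[t - 3, t + 3] x * ((f x - f t) * kQ q (x - t))))//.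
    by apply/funext => x; ring.
  rewrite !cE// -IntB; [|exact: Ld..].
  have Lb : L1r (fun x => L * (s * (\1_`[t - 3, t + 3] x * kP s (x - t)) +
                              s' * (\1_`[t - 3, t + 3] x * kP s' (x - t)))).
    by apply: L1rZ; apply: L1rD; apply: L1rZ; exact: LP.
  apply: le_trans (Int_abs_le _ Lb _) _.
  - by apply: L1rB; exact: Ld.
  - move=> x; rewrite -mulrBr normrM (ger0_norm (indic_ge0 _ _)).
    rewrite [leRHS](_ : _ = \1_`[t - 3, t + 3] x *
       (L * (s * kP s (x - t) + s' * kP s' (x - t)))); last by ring.
    apply: ler_wpM2l; first exact: indic_ge0.
    rewrite -mulrBr normrM.
    have uE (q : R) : 0 < q -> (x - t) * kQ q (x - t) = 1 - q * kP q (x - t).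
      move=> q0; rewrite /kQ /kP; have := sqD_gt0 (x - t) q0; move=> D; field.
      by rewrite gt_eqF.
    apply: (@le_trans _ _ (L * `|x - t| * `|kQ s (x - t) - kQ s' (x - t)|)).
      by apply: ler_wpM2r => //; exact: lip.
    rewrite -mulrA; apply: ler_wpM2l => //.
    rewrite -normrM mulrBr !uE//.
    rewrite [X in `|X|](_ : _ = s' * kP s' (x - t) - s * kP s (x - t)); last by ring.
    have a1 := mulr_ge0 (ltW s0) (kP_ge0 (x - t) s0).
    have a2 := mulr_ge0 (ltW s'0) (kP_ge0 (x - t) s'0).
    by rewrite (le_trans (ler_normB _ _))// (ger0_norm a1) (ger0_norm a2) addrC.
  rewrite IntZ; last by apply: L1rD; apply: L1rZ; exact: LP.
  apply: ler_wpM2l => //.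
  rewrite IntD; [|exact/L1rZ/LP..].
  rewrite !IntZ; [|exact: LP..].
  rewrite !Int_itv mulrDl; apply: lerD.
    by apply: ler_wpM2l; [exact: ltW|exact: int_kP_le_pi].
  by apply: ler_wpM2l; [exact: ltW|exact: int_kP_le_pi].
apply: (@le_trans _ _ (Int (fun t => (L * ((s + s') * pi)) * \1_I11 t))).
  rewrite /normI; apply: Int_le.
  - exact: L1r_convB_normI.
  - by apply: L1rZ; exact: L1r_I.
  move=> t; rewrite indicE mem_setE in_itv/=.
  case: (boolP (-1 < t < 1)) => h; last by rewrite mul0r mulr0.
  by rewrite mul1r mulr1; exact: bound.
rewrite IntZ; last exact: L1r_I.
have h2 := Int_I_le; have h0 : 0 <= Int (\1_I11 : R -> R).
  by apply: Int_ge0 => x; exact: indic_ge0.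
have p1 : 0 <= s + s' by apply: addr_ge0; exact: ltW.
have Lp : 0 <= L * ((s + s') * pi) := mulr_ge0 L0 (mulr_ge0 p1 (ltW pi0)).
rewrite (le_trans (ler_wpM2l Lp h2))//.
have := mulr_gt0 s0 pi0; have := mulr_gt0 s'0 pi0; nra.
Qed.

(* A Lipschitz weight: [cut] times a Poisson integral is Lipschitz and supported in [[-1,1]],
   and such functions approximate the bounded ones divisible by [cut]. *)
Definition cut (x : R) : R := if -1 < x < 1 then 1 - x ^+ 2 else 0.

Lemma cut_supp : supp cut. Proof. by move=> x h; rewrite /cut (negbTE h). Qed.

Lemma cut_gt0 (x : R) : -1 < x < 1 -> 0 < cut x.
Proof. by move=> h; rewrite /cut h; move: h => /andP[h1 h2]; nra. Qed.

Lemma cut_ge0 (x : R) : 0 <= cut x.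
Proof. by rewrite /cut; case: ifP => // /andP[h1 h2]; nra. Qed.

Lemma cut_le1 (x : R) : `|cut x| <= 1.
Proof.
by rewrite ger0_norm ?cut_ge0// /cut; case: ifP => // _; rewrite gerBl sqr_ge0.
Qed.

Lemma cut_lip (x y : R) : `|cut x - cut y| <= 2 * `|x - y|.
Proof.
wlog xy : x y / x <= y.
  move=> H; case: (leP x y) => h; first exact: H.
  by rewrite distrC (distrC x); apply: H; exact: ltW.
have -> : `|x - y| = y - x by rewrite distrC ger0_norm// subr_ge0.
have hx := cut_ge0 x; have hy := cut_ge0 y.
rewrite ler_norml /cut in hx hy *.
case: (boolP (-1 < x < 1)) hx => [/andP[x1 x2]|nx] hx;
  case: (boolP (-1 < y < 1)) hy => [/andP[y1 y2]|ny] hy.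
- apply/andP; split; nra.
- have yy : 1 <= y by rewrite leNgt; apply: contra ny => h; apply/andP; split; lra.
  apply/andP; split; nra.
- have yy : x <= -1 by rewrite leNgt; apply: contra nx => h; apply/andP; split; lra.
  apply/andP; split; nra.
- rewrite subr0; apply/andP; split; lra.
Qed.

Lemma measurable_cut : measurable_fun setT cut.
Proof.
apply: measurable_fun_ifT => //; last by apply: measurable_funB => //; exact: measurable_funX.
by apply: measurable_and; exact: measurable_fun_ltr.
Qed.

Lemma kP_lip (s u v : R) : 0 < s -> `|kP s u - kP s v| <= (s ^+ 2)^-1 * `|u - v|.
Proof.
move=> s0; have D1 := sqD_gt0 u s0; have D2 := sqD_gt0 v s0.
have -> : kP s u - kP s v = s * (u + v) / ((u ^+ 2 + s ^+ 2) * (v ^+ 2 + s ^+ 2)) * (v - u).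
  by rewrite /kP; field; rewrite !gt_eqF.
rewrite normrM distrC; apply: ler_wpM2r => //.
rewrite normrM normfV [X in _ / X]gtr0_norm; last exact: mulr_gt0.
rewrite ler_pdivrMr ?mulr_gt0// ler_pdivlMl ?exprn_gt0//.
have h : `|s * (u + v)| <= u ^+ 2 + v ^+ 2 + s ^+ 2.
  rewrite ler_norml; have := sqr_ge0 (u + v + s); have := sqr_ge0 (u + v - s).
  have := sqr_ge0 (u - v); have := sqr_ge0 s; have := sqr_ge0 u; have := sqr_ge0 v.
  by move=> ? ? ? ? ? ?; apply/andP; split; nra.
have := sqr_ge0 u; have := sqr_ge0 v; have : 0 < s ^+ 2 by rewrite exprn_gt0.
move: h; set a := u ^+ 2; set b := v ^+ 2; set c := s ^+ 2; set d := `|_|.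
move=> h c0 b0 a0; apply: (@le_trans _ _ (c * (a + b + c))); first by rewrite ler_pM2l.
nra.
Qed.

Lemma conv_kP_le f (K t s : R) : measurable_fun setT f -> supp f -> 0 < K ->
  (forall x, `|f x| <= K) -> 0 < s -> `|conv (kP s) f t| <= K * pi.
Proof.
move=> mf sf K0 fK s0.
have mg : measurable_fun setT (fun x => K^-1 * f x) by exact: measurable_funM.
have sg : supp (fun x => K^-1 * f x) by move=> x h; rewrite sf// mulr0.
have bg x : `|K^-1 * f x| <= 1.
  by rewrite normrM normfV (gtr0_norm K0) ler_pdivrMl// mulr1.
have := cP_le mg sg bg t s0; rewrite /cP /conv.
have Lf := L1r_bounded mf sf fK.
under eq_Int do rewrite -mulrA.
rewrite IntZ; last exact: L1rM_bounded Lf (measurable_sh t (measurable_kP s)) (fun x => kP_abs_le (x - t) s0).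
by rewrite normrM normfV (gtr0_norm K0) ler_pdivrMl.
Qed.

(** The Poisson integral of [F], divided by [pi], is bounded by [K], is Lipschitz at each fixed
    height, and tends to [F] at its Lebesgue points. So the integral of [Phi (M * |f - g s|)] tends
    to zero by dominated convergence, the majorant being a constant on (-1,1). *)
Lemma Good_bounded_cut F (K : R) : measurable_fun setT F -> supp F -> 0 < K ->
  (forall x, `|F x| <= K) -> Good (fun x => cut x * F x).
Proof.
move=> mF sF K0 FK.
have LF := L1r_bounded mF sF FK.
have pi0 := @pi_gt0 R.
pose f x := cut x * F x.
have mf : measurable_fun setT f by apply: measurable_funM => //; exact: measurable_cut.
have sf : supp f by move=> x h; rewrite /f sF// mulr0.
have fK x : `|f x| <= K.
  by rewrite /f normrM -[leRHS]mul1r; apply: ler_pM => //; exact: cut_le1.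
have Zf := Zyg_bounded mf sf fK.
apply: Good_approx => // M M0.
pose g (s x : R) : R := cut x * (pi^-1 * conv (kP s) F x).
have mc s : 0 < s -> measurable_fun setT (conv (kP s) F).
  by move=> s0; exact: measurable_conv LF (measurable_kP s) (fun u => kP_abs_le u s0).
have mg s : 0 < s -> measurable_fun setT (g s).
  move=> s0; apply: measurable_funM; first exact: measurable_cut.
  by apply: measurable_funM => //; exact: mc.
have sg s : supp (g s) by move=> x h; rewrite /g (cut_supp h) mul0r.
have cK s x : 0 < s -> `|pi^-1 * conv (kP s) F x| <= K.
  move=> s0; rewrite normrM normfV (gtr0_norm pi0) ler_pdivrMl// mulrC.
  exact: conv_kP_le.
have gK s x : 0 < s -> `|g s x| <= K.
  move=> s0; rewrite /g normrM -[leRHS]mul1r; apply: ler_pM => //; first exact: cut_le1.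
  exact: cK.
have Zg s : 0 < s -> Zyg (g s).
  by move=> s0; apply: (Zyg_bounded (mg s s0)) => // x; exact: gK.
have Gg s : 0 < s -> Good (g s).
  move=> s0.
  pose IF := Int (fun x => `|F x|).
  have IF0 : 0 <= IF by exact: Int_ge0.
  have C0 : 0 <= (s ^+ 2)^-1 * IF by rewrite mulr_ge0// invr_ge0 sqr_ge0.
  have clip x y : `|conv (kP s) F x - conv (kP s) F y| <= (s ^+ 2)^-1 * IF * `|x - y|.
    have L (t : R) := L1rM_bounded LF (measurable_sh t (measurable_kP s)) (fun x => kP_abs_le (x - t) s0).
    rewrite /conv -IntB//.
    have La : L1r (fun z => ((s ^+ 2)^-1 * `|x - y|) * `|F z|) by apply: L1rZ; exact: L1r_abs.
    apply: le_trans (Int_abs_le _ La _) _.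
    - exact: L1rB.
    - move=> z; rewrite -mulrBr normrM mulrC; apply: ler_wpM2r => //.
      apply: (le_trans (kP_lip _ _ s0)); rewrite (_ : z - x - (z - y) = y - x); last by ring.
      by rewrite distrC.
    - by rewrite IntZ; [rewrite mulrAC|exact: L1r_abs].
  pose L := 2 * K + pi^-1 * ((s ^+ 2)^-1 * IF).
  apply: (@Good_lipschitz (g s) L) => //; first exact: mg.
  - by rewrite addr_ge0// mulr_ge0 ?invr_ge0 ?(ltW pi0) ?(ltW K0)//.
  - move=> x y; rewrite /g.
    set cx := cut x; set cy := cut y; set px := conv _ _ x; set py := conv _ _ y.
    have -> : cx * (pi^-1 * px) - cy * (pi^-1 * py) =
       (cx - cy) * (pi^-1 * px) + cy * (pi^-1 * (px - py)) by ring.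
    apply: (le_trans (ler_normD _ _)); rewrite /L [leRHS]mulrDl; apply: lerD.
      rewrite normrM mulrAC; apply: ler_pM => //; [exact: cut_lip|exact: cK].
    rewrite normrM -[leRHS]mul1r; apply: ler_pM => //; first exact: cut_le1.
    rewrite normrM normfV (gtr0_norm pi0) -mulrA; apply: ler_wpM2l; last exact: clip.
    by rewrite invr_ge0 ltW.
  - by apply: Zyg_L1; exact: Zg.
have cvg0 : Int (fun x => Phi (M * `|f x - g s x|)) @[s --> 0^'+] --> 0.
  have z : Int (fun=> 0) = 0 :> R by rewrite /Int Rintegral_cst// mul0r.
  rewrite -[X in _ --> X]z.
  apply: (@Int_cvgr R (fun s x => Phi (M * `|f x - g s x|)) (fun=> 0)
    (fun x => Phi (M * (2 * K)) * \1_I11 x)).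
  - move=> s s0; apply: measurable_Phi_abs; exact: measurable_funB (mg s s0).
  - exact: measurable_cst.
  - by apply: L1rZ; exact: L1r_I.
  - apply: aeS (ae_LPt LF) => x LPx.
    have [h|h] := boolP (-1 < x < 1); last first.
      rewrite (_ : (fun s => _) = fun=> 0); first exact: cvg_cst.
      by apply/funext => s; rewrite sf// sg// subrr normr0 mulr0 Phi0.
    have c1 := conv_kP_cvg LF sF h LPx.
    have c2 : (M * `|f x - g s x|) @[s --> 0^'+] --> 0.
      have z' : M * `|f x - cut x * (pi^-1 * (pi * F x))| = 0.
        by rewrite mulKf ?gt_eqF// subrr normr0 mulr0.
      rewrite -[X in _ --> X]z'.
      apply: cvgM; first exact: cvg_cst.
      apply: cvg_norm; apply: cvgB; first exact: cvg_cst.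
      apply: cvgM; first exact: cvg_cst.
      by apply: cvgM => //; exact: cvg_cst.
    rewrite -[X in _ --> X]Phi0.
    apply: (@cvg_comp _ _ _ _ Phi _ (nbhs (0:R)) _ c2).
    apply: differentiable_continuous; apply/derivable1_diffP.
    rewrite /Phi; apply: derivableM => //.
    have h1 : is_derive (0 : R) (1:R) (fun v : R => 1 + v) 1.
      by apply: is_derive_eq; ring.
    have h0 : 0 < 1 + (0:R) by rewrite addr0.
    have := @is_derive1_comp R (@ln R) (fun v : R => 1 + v) 0 _ _ (is_derive1_ln h0) h1.
    by move=> h2; exact: ex_derive.
  - move=> s x s0; rewrite ger0_norm; last by rewrite Phi_ge0// mulr_ge0// ltW.
    rewrite indicE mem_setE in_itv/=.
    have [h|h] := boolP (-1 < x < 1); last first.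
      by rewrite sf// sg// subrr normr0 !mulr0 Phi0.
    rewrite mulr1; apply: le_Phi; first by rewrite mulr_ge0// ltW.
    rewrite ler_pM2l//; apply: (le_trans (ler_normB _ _)).
    by have := fK x; have := gK s x s0; lra.
have /cvgrPdist_le /(_ 1 ltr01) [d /= d0 dP] := cvg0.
have d20 : 0 < d / 2 by rewrite divr_gt0.
exists (g (d / 2)); split; [exact: Zg|exact: Gg|].
have := dP (d / 2); rewrite /= sub0r normrN gtr0_norm// ltr_pdivrMr// ltr_pMr// ltr1n => /(_ isT d20).
by rewrite sub0r normrN => /(le_trans (ler_norm _)).
Qed.

(** Truncation is applied to [f / cut] and not to [f], so that the result [g n] is [cut] times a
    bounded function. At each point [g n] equals [f] or zero, and [Phi (M * |f|)] dominates. *)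
Lemma Zyg_Good f : Zyg f -> Good f.
Proof.
move=> Zf; apply: Good_approx => // M M0.
have LM := Zyg_M (ltW M0) Zf.
have [mf sf LPf] := Zf.
pose F n x : R := if `|f x / cut x| <= n%:R then f x / cut x else 0.
have mfc : measurable_fun setT (fun x => f x / cut x).
  by apply: measurable_funM => //; apply: measurable_funV; exact: measurable_cut.
have mF n : measurable_fun setT (F n).
  by apply: measurable_fun_ifT => //; apply: measurable_fun_ler => //; exact: measurableT_comp.
have sF n : supp (F n).
  by move=> x h; rewrite /F sf// mul0r; case: ifP.
have FK n x : `|F n x| <= n%:R by rewrite /F; case: ifP => // _; rewrite normr0.
pose g n x := cut x * F n x.
have gE n x : g n x = if `|f x / cut x| <= n%:R then f x else 0.
  rewrite /g /F; case: ifP => _; last by rewrite mulr0.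
  have [h|h] := boolP (-1 < x < 1); first by rewrite mulrC divfK// gt_eqF// cut_gt0.
  by rewrite sf// mul0r mulr0.
have mg n : measurable_fun setT (g n) by apply: measurable_funM => //; exact: measurable_cut.
have Gg n : Good (g n.+1).
  by apply: (@Good_bounded_cut (F n.+1) n.+1%:R).
have Zg n : Zyg (g n.+1).
  apply: (@Zyg_bounded _ _ n.+1%:R) => //.
    by move=> x h; rewrite /g (cut_supp h) mul0r.
  move=> x; rewrite /g normrM -[leRHS]mul1r; apply: ler_pM => //; exact: cut_le1.
have cvg0 : Int (fun x => Phi (M * `|f x - g n x|)) @[n --> \oo] --> 0.
  have z : Int (fun=> 0) = 0 :> R by rewrite /Int Rintegral_cst// mul0r.
  rewrite -[X in _ --> X]z.
  apply: (@Int_cvg R (fun n x => Phi (M * `|f x - g n x|)) (fun=> 0)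
    (fun x => Phi (M * `|f x|))) => //.
  - move=> n; apply: measurable_Phi_abs; exact: measurable_funB (mg n).
  - apply: aeW => x; apply: cvg_near_cst; near=> n.
    rewrite gE ifT ?subrr ?normr0 ?mulr0 ?Phi0//.
    by near: n; exact: nbhs_infty_ger.
  - move=> n x; rewrite ger0_norm; last by rewrite Phi_ge0// mulr_ge0// ltW.
    apply: le_Phi; first by rewrite mulr_ge0// ltW.
    rewrite ler_pM2l// gE; case: ifP => _; last by rewrite subr0.
    by rewrite subrr normr0.
have /cvgrPdist_le /(_ 1 ltr01) [N _ /(_ N.+1 (leqnSn N))] := cvg0.
rewrite sub0r normrN => h; exists (g N.+1); split => //.
exact: le_trans (ler_norm _) h.
Unshelve. all: end_near. Qed.

End good.

(** * Completeness of L^1, for rapidly Cauchy sequences *)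

Section completeness.
Context {R : realType}.
Notation mu := (@lebesgue_measure R).
Implicit Types f g : R -> R.

(** The argument of Riesz and Fischer: the sum [H] of the increments has integral at most one, so it
    is finite a.e., where the sequence converges absolutely and is dominated by [|u 0| + H]. *)
Lemma L1_complete (u : nat -> R -> R) : (forall n, L1r (u n)) ->
  (forall n, Int (fun x => `|u n.+1 x - u n x|) <= 1 / (2 ^ n.+1)%:R) ->
  exists2 G, L1r G & Int (fun x => `|u n x - G x|) @[n --> \oo] --> 0.
Proof.
move=> Lu du.
pose d n x := `|u n.+1 x - u n x|.
have Ld n : L1r (d n) by apply: L1r_abs; exact: L1rB.
pose H x : \bar R := (\sum_(0 <= n <oo) (d n x)%:E)%E.
have H0 x : (0 <= H x)%E by apply: nneseries_ge0 => n _ _; rewrite lee_fin /d.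
have mH : measurable_fun (setT : set (measurableTypeR R)) H.
  apply: (@ge0_emeasurable_sum _ (measurableTypeR R) R setT (fun n x => (d n x)%:E) xpredT).
    by move=> n x _ _; rewrite lee_fin /d.
  by move=> n _; exact: EFin_meas (L1r_meas (Ld n)).
have iH : (\int[mu]_x H x < +oo)%E.
  rewrite (@integral_nneseries _ _ R mu setT measurableT (fun n x => (d n x)%:E)
     (fun n => EFin_meas (L1r_meas (Ld n)))); last by move=> n x _; rewrite lee_fin /d.
  apply: (@le_lt_trans _ _ (1%:E)); last exact: ltry.
  apply: le_trans (epsilon_trick0 xpredT (@ler01 R)).
  apply: lee_nneseries => [n _ _|n _]; first by apply: integral_ge0 => x _; rewrite lee_fin /d.
  by rewrite -EFin_Int// lee_fin; exact: du.
have intH : mu.-integrable setT H.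
  apply/integrableP; split => //.
  by under eq_integral do rewrite gee0_abs//.
pose A : set R := [set x | H x \is a fin_num].
have mA : measurable A.
  rewrite -[A]setTI; exact: emeasurable_fin_num.
have aeA : {ae mu, forall x, A x}.
  by apply: aeS (integrable_ae measurableT intH) => x /=; apply.
pose Hr x := if H x \is a fin_num then fine (H x) else 0.
have bA : measurable_fun (setT : set R) (fun x => H x \is a fin_num).
  apply: (measurable_fun_bool true).
  by rewrite setTI (_ : _ @^-1` _ = A)//; apply/seteqP; split => x /=.
have LHr : L1r Hr.
  have mHr : measurable_fun (setT : set R) Hr.
    apply: measurable_fun_ifT => //.
    exact: (measurableT_comp (@fine_measurable R setT measurableT) mH).
  apply/integrableP; split; first exact: EFin_meas.
  apply: le_lt_trans iH; apply: ge0_le_integral => //.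
  - by apply: (measurableT_comp (@abse_measurable R setT)); exact: EFin_meas.
  - move=> x _ /=; rewrite /Hr; case: ifPn => h; last by rewrite normr0.
    by rewrite ger0_norm ?fine_ge0// fineK.
(* Setting the sequence to zero on the null set where [H] is infinite makes convergence and
   domination hold everywhere, so that the limit [G] is defined and bounded at every point. *)
pose v n x := if H x \is a fin_num then u n x else 0.
have Hr0 x : 0 <= Hr x by rewrite /Hr; case: ifP => // _; rewrite fine_ge0.
have part x n : A x -> \sum_(0 <= k < n) d k x <= Hr x.
  move=> Ax; rewrite /Hr ifT// -lee_fin fineK// -sumEFin.
  rewrite /H; apply: (@nneseries_lim_ge R (fun k => (d k x)%:E) xpredT 0%N) => k _ _.
  by rewrite lee_fin /d.
have ub n x : A x -> `|u n x| <= `|u 0%N x| + Hr x.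
  move=> Ax; have -> : u n x = u 0%N x + \sum_(0 <= k < n) (u k.+1 x - u k x).
    by rewrite (telescope_sumr (u ^~ x))// addrC subrK.
  rewrite (le_trans (ler_normD _ _))// lerD2l (le_trans (ler_norm_sum _ _ _))//.
  exact: part.
have vb n x : `|v n x| <= `|u 0%N x| + Hr x.
  rewrite /v; case: ifPn => [h|_]; first exact: ub.
  by rewrite normr0 addr_ge0.
have cv x : cvgn (fun n => v n x).
  have [h|h] := boolP (H x \is a fin_num); last first.
    rewrite (_ : (fun n => v n x) = (fun=> 0)); first exact: is_cvg_cst.
    by apply/funext => n; rewrite /v (negbTE h).
  rewrite (_ : (fun n => v n x) = u ^~ x); last by apply/funext => n; rewrite /v h.
  have c1 : cvgn [normed (series (fun n => u n.+1 x - u n x))].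
    apply: nondecreasing_is_cvgn.
      apply/nondecreasing_seqP => n; rewrite /normed_series_of /series/= big_nat_recr//=.
      by rewrite lerDl.
    by exists (Hr x) => _ [n _ <-]; exact: part.
  have /cvg_ex[l lP] := normed_cvg c1.
  apply/cvg_ex; exists (u 0%N x + l).
  rewrite (_ : (fun n => u n x) = (fun n => u 0%N x + series (fun n => u n.+1 x - u n x) n)).
    by apply: cvgD => //; exact: cvg_cst.
  apply/funext => n; rewrite /series/= (telescope_sumr (u ^~ x))// addrC subrK//.
pose G x := limn (fun n => v n x).
have vG x : v n x @[n --> \oo] --> G x by exact: cv.
have mv n : measurable_fun (setT : set R) (v n).
  by apply: measurable_fun_ifT => //; exact: L1r_meas.
have mG : measurable_fun (setT : set R) G.
  by apply: (@measurable_fun_cvg _ _ _ _ v) => // x _; exact: vG.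
have LD : L1r (fun x => `|u 0%N x| + Hr x) by apply: L1rD => //; exact: L1r_abs.
have Gb x : `|G x| <= `|u 0%N x| + Hr x.
  have : `|v n x| @[n --> \oo] --> `|G x| by apply: cvg_norm; exact: vG.
  move=> h; rewrite -(cvg_lim _ h)//; apply: limr_le; first exact: cvgP h.
  exact: nearW.
have LG : L1r G by apply: L1r_le LD _.
exists G => //.
have Lv n : L1r (v n) by apply: L1r_le LD _.
have E n : Int (fun x => `|u n x - G x|) = Int (fun x => `|v n x - G x|).
  apply: Int_ae.
  - by apply: L1r_abs; exact: L1rB.
  - by apply: L1r_abs; exact: L1rB.
  by apply: aeS aeA => x Ax; rewrite /v ifT.
rewrite (_ : (fun n => Int (fun x => `|u n x - G x|)) =
  (fun n => Int (fun x => `|v n x - G x|))); last exact/funext.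
have z : Int (fun=> 0) = 0 :> R by rewrite /Int Rintegral_cst// mul0r.
rewrite -[X in _ --> X]z.
apply: (@Int_cvg R (fun n x => `|v n x - G x|) (fun=> 0)
    (fun x => 2 * (`|u 0%N x| + Hr x))) => //.
- by move=> n; apply: measurableT_comp => //; exact: measurable_funB.
- exact: L1rZ.
- apply: aeW => x; have z' : `|G x - G x| = 0 by rewrite subrr normr0.
  rewrite -[X in _ --> X]z'; apply: cvg_norm; apply: cvgB; first exact: vG.
  exact: cvg_cst.
- move=> n x; rewrite normr_id (le_trans (ler_normB _ _))// mulr2n mulrDl !mul1r.
  by rewrite lerD.
Qed.

End completeness.

(** * The Hilbert transform as a limit in L^1(-1,1) *)

Section hilbert_limit.
Context {R : realType}.
Notation mu := (@lebesgue_measure R).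
Implicit Types f g : R -> R.

Let I11 : set R := `]-1, 1[%classic.

Let mI : measurable_fun setT (\1_I11 : R -> R).
Proof. by apply: measurable_indic; exact: measurable_itv. Qed.

(** A sequence of heights chosen below the Cauchy thresholds gives a rapidly Cauchy sequence, and
    the Cauchy property carries its limit over to all heights tending to zero. [G] is [pi] times the
    Hilbert transform. *)
Lemma hilbert_L1 f : Zyg f -> exists G, [/\ measurable_fun setT G, supp G, L1r G &
  normI (fun t => conv (kQ s) f t - G t) @[s --> 0^'+] --> 0].
Proof.
move=> Zf; have Lf := Zyg_L1 Zf; have Gf := Zyg_Good Zf.
have e0 n : 0 < 1 / (2 ^ n.+1)%:R :> R by rewrite divr_gt0// ltr0n expn_gt0.
have /choice[d dP] : forall n, exists d, 0 < d /\ forall s s', 0 < s -> s < d ->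
    0 < s' -> s' < d -> normI (fun t => conv (kQ s) f t - conv (kQ s') f t) <= 1 / (2 ^ n.+1)%:R.
  by move=> n; have [d d0 dP] := Gf _ (e0 n); exists d.
(* Halving the minimum yields both [s n.+1 < s n] and [s n.+1 < d n.+1]. *)
pose s := fix s n := if n is m.+1 then Num.min (s m) (d n) / 2 else d 0%N / 2.
have half (x : R) : 0 < x -> 0 < x / 2 < x by move=> x0; apply/andP; split; lra.
have s0 n : 0 < s n.
  elim: n => [|n IH] /=; first by rewrite divr_gt0//; exact: (dP _).1.
  by rewrite divr_gt0// lt_min IH; exact: (dP _).1.
have min0 n : 0 < Num.min (s n) (d n.+1) by rewrite lt_min s0; exact: (dP _).1.
have sd n : s n < d n.
  case: n => [|n] /=; first by have /andP[] := half _ (dP 0%N).1.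
  by have /andP[_] := half _ (min0 n); rewrite lt_min => /andP[].
have sS n : s n.+1 < s n.
  by have /andP[_] := half _ (min0 n); rewrite lt_min => /andP[].
pose u n t := \1_I11 t * conv (kQ (s n)) f t.
have Lu n : L1r (u n).
  have b t := conv_bounded t Lf (measurable_kQ (s n)) (fun v => kQ_le v (s0 n)).
  apply: L1rM_bounded b; first exact: L1r_I.
  exact: measurable_conv Lf (measurable_kQ (s n)) (fun v => kQ_le v (s0 n)).
have Iabs (a b : R -> R) t : `|\1_I11 t * a t - \1_I11 t * b t| = \1_I11 t * `|a t - b t|.
  by rewrite -mulrBr normrM ger0_norm// indic_ge0.
have du n : Int (fun x => `|u n.+1 x - u n x|) <= 1 / (2 ^ n.+1)%:R.
  under eq_Int do rewrite Iabs.
  by apply: (dP n).2 => //; exact: lt_trans (sS n) (sd n).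
have [G0 LG0 cG] := L1_complete Lu du.
pose G t := \1_I11 t * G0 t.
have LG : L1r G.
  rewrite /G; under eq_fun do rewrite mulrC.
  apply: (@L1rM_bounded _ _ _ 1) => // t.
  by rewrite ger0_norm ?indic_ge0// indic_le1.
exists G; split => //; first exact: L1r_meas.
  by move=> x h; rewrite /G indicE mem_setE in_itv/= (negbTE h) mul0r.
apply/cvgrPdist_le => e epos.
have e20 : 0 < e / 2 by rewrite divr_gt0.
have cz : 1 / (2 ^ n.+1)%:R @[n --> \oo] --> (0 : R).
  rewrite (_ : (fun n => _) = (fun n => geometric (1 : R) 2^-1 n.+1)).
    rewrite (cvg_shiftS (geometric (1 : R) 2^-1)).
    by apply: cvg_geometric; rewrite ger0_norm// invf_lt1// ltr1n.
  by apply/funext => n /=; rewrite exprVn -natrX.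
have /cvgrPdist_le/(_ _ e20) H1 := cG.
have /cvgrPdist_le/(_ _ e20) H2 := cz.
have [n [h1 h2]] := filter_ex (filterI H1 H2).
have {}h1 : Int (fun x => `|u n x - G0 x|) <= e / 2.
  by apply: le_trans h1; rewrite sub0r normrN; exact: ler_norm.
have {}h2 : 1 / (2 ^ n.+1)%:R <= e / 2.
  by apply: le_trans h2; rewrite sub0r normrN; exact: ler_norm.
near=> q.
have q0 : 0 < q by near: q; exact: nbhs_right_gt.
have qd : q < d n by near: q; apply: nbhs_right_lt; exact: (dP _).1.
rewrite sub0r normrN ger0_norm; last first.
  by apply: Int_ge0 => t; rewrite mulr_ge0// indic_ge0.
have h3 := (dP n).2 q (s n) q0 qd (s0 n) (sd n).
have LQ := L1r_convB_normI Lf Lf q0 (s0 n).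
have Lq := L1r_conv_normI Lf q0.
have LB : L1r (fun x => `|u n x - G0 x|) by apply: L1r_abs; exact: L1rB.
rewrite (splitr e); apply: le_trans (lerD (le_trans h3 h2) h1).
rewrite /normI -IntD//; apply: Int_le.
- rewrite (_ : (fun t => _) = (fun t => `|\1_I11 t * conv (kQ q) f t - G t|)); last first.
    apply/funext => t; rewrite /G Iabs indicE; case: (t \in I11) => /=; rewrite ?mul0r ?mul1r//.
  apply: L1r_abs; apply: L1rB => //.
  have b t := conv_bounded t Lf (measurable_kQ q) (fun v => kQ_le v q0).
  apply: L1rM_bounded b; first exact: L1r_I.
  exact: measurable_conv Lf (measurable_kQ q) (fun v => kQ_le v q0).
- exact: L1rD.
move=> t; rewrite /u /G indicE; case: (t \in I11) => /=; last first.
  by rewrite !mul0r add0r.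
by rewrite !mul1r -[X in `|X|](subrKA (conv (kQ (s n)) f t)) ler_normD.
Unshelve. all: end_near. Qed.

(** [kQ s] is odd, so moving it from [f] to [phi] by Fubini costs a sign; the other side converges
    because [phi] is bounded and the regularisations converge in L^1(-1,1). *)
Lemma pairing f G (phi : R -> R) (C : R) : Zyg f -> measurable_fun setT G -> supp G -> L1r G ->
  normI (fun t => conv (kQ s) f t - G t) @[s --> 0^'+] --> 0 ->
  measurable_fun setT phi -> supp phi -> (forall x, `|phi x| <= C) ->
  - Int (fun x => f x * conv (kQ s) phi x) @[s --> 0^'+] --> Int (fun t => G t * phi t).
Proof.
move=> Zf mG sG LG cG mphi sphi bphi; have Lf := Zyg_L1 Zf.
have Lphi := L1r_bounded mphi sphi bphi.
have C0 : 0 <= C by rewrite (le_trans _ (bphi 0)).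
have E s : 0 < s -> - Int (fun x => f x * conv (kQ s) phi x) =
    Int (fun t => phi t * conv (kQ s) f t).
  move=> s0.
  have [L1 L2 ->] := FubiniK Lf Lphi (measurable_kQ s) (fun u => kQ_le u s0).
  have cN x : Int (fun t => phi t * kQ s (x - t)) = - conv (kQ s) phi x.
    rewrite /conv -IntN; last first.
      exact: L1rM_bounded Lphi (measurable_sh x (measurable_kQ s)) (fun t => kQ_le (t - x) s0).
    by apply: eq_Int => t; rewrite -mulrN -kQN opprB.
  under [RHS]eq_Int do rewrite cN mulrN.
  rewrite IntN//; move: L2; under eq_fun do rewrite cN mulrN.
  by move=> /L1rN; under eq_fun do rewrite opprK.
apply/cvgrPdist_le => e e0.
have e10 : 0 < e / (C + 1) by rewrite divr_gt0// ltr_pwDr.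
have /cvgrPdist_le/(_ _ e10) H := cG.
near=> s.
have s0 : 0 < s by near: s; exact: nbhs_right_gt.
rewrite E//.
have b t := conv_bounded t Lf (measurable_kQ s) (fun v => kQ_le v s0).
have mc := measurable_conv Lf (measurable_kQ s) (fun v => kQ_le v s0).
have LGp : L1r (fun t => G t * phi t) by exact: L1rM_bounded bphi.
have Lpc : L1r (fun t => phi t * conv (kQ s) f t) by exact: L1rM_bounded b.
rewrite -IntB//.
have LN : L1r (fun t => C * (\1_I11 t * `|conv (kQ s) f t - G t|)).
  apply: L1rZ.
  rewrite (_ : (fun t => _) = (fun t => `|\1_I11 t * conv (kQ s) f t - G t|)); last first.
    apply/funext => t; rewrite indicE mem_setE in_itv/=.
    case: (boolP (-1 < t < 1)) => h /=; rewrite ?mul0r ?mul1r// sG// sub0r normrN normr0//.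
  by apply: L1r_abs; apply: L1rB => //; apply: L1rM_bounded b => //; exact: L1r_I.
apply: (@le_trans _ _ (C * normI (fun t => conv (kQ s) f t - G t))).
  rewrite /normI -IntZ; last first.
    rewrite (_ : (fun t => _) = (fun t => `|\1_I11 t * conv (kQ s) f t - G t|)); last first.
      apply/funext => t; rewrite indicE mem_setE in_itv/=.
      case: (boolP (-1 < t < 1)) => h /=; rewrite ?mul0r ?mul1r// sG// sub0r normrN normr0//.
    by apply: L1r_abs; apply: L1rB => //; apply: L1rM_bounded b => //; exact: L1r_I.
  apply: Int_abs_le => //; first exact: L1rB.
  move=> t; rewrite indicE mem_setE in_itv/=.
  case: (boolP (-1 < t < 1)) => h; last first.
    by rewrite sphi// sG// !mul0r subr0 normr0 mulr0.
  rewrite mul1r (mulrC (phi t)) -mulrBl normrM distrC mulrC.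
  exact: ler_wpM2r.
have : `|0 - normI (fun t => conv (kQ s) f t - G t)| <= e / (C + 1) by near: s.
rewrite sub0r normrN => /(le_trans (ler_norm _)).
rewrite ler_pdivlMr ?ltr_pwDr//; apply: le_trans.
rewrite mulrC ler_wpM2l//; last by rewrite lerDl.
by apply: Int_ge0 => t; rewrite mulr_ge0// indic_ge0.
Unshelve. all: end_near. Qed.

End hilbert_limit.

(** * The weight and its Hilbert transform *)

Section weight.
Context {R : realType}.
Notation mu := (@lebesgue_measure R).

(** Off (-1,1) the conventions that [Num.sqrt] is zero on negative numbers and that [0^-1 = 0] make
    [Sq], and then [wt], vanish, so both are supported functions without a case distinction. *)
Definition Sq (x : R) : R := Num.sqrt (1 - x ^+ 2).
Definition wt (x : R) : R := (Sq x)^-1.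

Lemma Sq_gt0 (x : R) : -1 < x < 1 -> 0 < Sq x.
Proof. by move=> /andP[h1 h2]; rewrite sqrtr_gt0; nra. Qed.

Lemma Sq_supp : supp Sq.
Proof.
move=> x h; rewrite /Sq ler0_sqrtr//.
move: h; rewrite negb_and -!leNgt => /orP[] h; nra.
Qed.

Lemma wt_supp : supp wt.
Proof. by move=> x h; rewrite /wt Sq_supp// invr0. Qed.

Lemma Sq_ge0 (x : R) : 0 <= Sq x. Proof. exact: sqrtr_ge0. Qed.

Lemma wt_ge0 (x : R) : 0 <= wt x. Proof. by rewrite invr_ge0 Sq_ge0. Qed.

Lemma Sq_sqr (x : R) : -1 < x < 1 -> Sq x ^+ 2 = 1 - x ^+ 2.
Proof. by move=> /andP[h1 h2]; rewrite sqr_sqrtr//; nra. Qed.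

Lemma Sq_le1 (x : R) : Sq x <= 1.
Proof.
by rewrite -[leRHS]sqrtr1 ler_wsqrtr// gerBl sqr_ge0.
Qed.

Lemma continuous_Sq : continuous Sq.
Proof.
move=> x; apply: (@continuous_comp _ _ _ (fun x : R => 1 - x ^+ 2) Num.sqrt); last exact: sqrt_continuous.
apply: cvgB; first exact: cvg_cst.
exact: exprn_continuous.
Qed.

Lemma measurable_Sq : measurable_fun setT Sq.
Proof. by apply: continuous_measurable_fun; exact: continuous_Sq. Qed.

Lemma measurable_wt : measurable_fun setT wt.
Proof. by apply: measurable_funV; exact: measurable_Sq. Qed.

Lemma L1r_Sq : L1r Sq.
Proof.
apply: (@L1r_bounded _ _ 1 measurable_Sq Sq_supp) => x.
by rewrite ger0_norm ?Sq_ge0// Sq_le1.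
Qed.

Lemma is_derive_Sq (x : R) : -1 < x < 1 -> is_derive x (1:R) Sq (- x / Sq x).
Proof.
move=> h; have S0 := Sq_gt0 h.
have p : 0 < 1 - x ^+ 2 by rewrite -Sq_sqr// exprn_gt0.
have h1 : is_derive x (1:R) (fun x : R => 1 - x ^+ 2) (- (2 * x)).
  by apply: is_derive_eq; rewrite /GRing.scale/=; ring.
have := @is_derive1_comp R Num.sqrt (fun x : R => 1 - x ^+ 2) x _ _ (is_derive1_sqrt p) h1.
rewrite (_ : (2 * Num.sqrt (1 - x ^+ 2))^-1 * - (2 * x) = - x / Sq x)//.
rewrite /Sq; field; by rewrite gt_eqF.
Qed.

Lemma continuous_wt (x : R) : -1 < x < 1 -> {for x, continuous wt}.
Proof.
move=> h; apply: (@continuousV _ _ Sq); first by rewrite gt_eqF// Sq_gt0.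
exact: continuous_Sq.
Qed.

(** [atan (x * wt x)] is the arcsine of [x]; in this form its limits at the ends come from those of
    [atan] at infinity. *)
Lemma is_derive_atan_wt (x : R) : -1 < x < 1 ->
  is_derive x (1:R) (fun x => atan (x * wt x)) (wt x).
Proof.
move=> h; have S0 := Sq_gt0 h; have S2 := Sq_sqr h.
have hS := is_derive_Sq h.
have h1 : is_derive x (1:R) (fun x => x * wt x) (wt x ^+ 3).
  have := @is_derive_div R id Sq x 1 (- x / Sq x) _ hS.
  rewrite (_ : (1 * Sq x - id x * (- x / Sq x)) / Sq x ^+ 2 = wt x ^+ 3); last first.
    have -> : 1 * Sq x - id x * (- x / Sq x) = (Sq x ^+ 2 + x ^+ 2) / Sq x.
      by field; rewrite gt_eqF.
    rewrite {1}S2 subrK /wt; field; by rewrite gt_eqF.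
  by apply; rewrite gt_eqF.
have := @is_derive1_comp R atan (fun x => x * wt x) x _ _ (is_derive1_atan _) h1.
rewrite (_ : (1 + (x * wt x) ^+ 2)^-1 * wt x ^+ 3 = wt x)//.
have -> : 1 + (x * wt x) ^+ 2 = wt x ^+ 2.
  have -> : 1 + (x * wt x) ^+ 2 = (Sq x ^+ 2 + x ^+ 2) * wt x ^+ 2.
    by rewrite /wt; field; rewrite gt_eqF.
  by rewrite S2 subrK mul1r.
by rewrite /wt; field; rewrite gt_eqF.
Qed.

Lemma atan_wt_right : atan (x * wt x) @[x --> (1:R)^'-] --> pi / 2.
Proof.
suff h : (x * wt x) @[x --> (1:R)^'-] --> +oo%R by exact: (cvg_comp _ _ h (@cvgy_atan R)).
apply/cvgryPge => A.
have A0 : 0 < (2 * (`|A| + 1))^-1 by rewrite invr_gt0 mulr_gt0// ltr_pwDr.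
have : Sq x @[x --> (1:R)^'-] --> Sq 1.
  apply: cvg_at_left_filter; exact: continuous_Sq.
rewrite /Sq expr1n subrr sqrtr0 => /cvgrPdist_lt/(_ _ A0) H.
near=> x.
have x1 : x < 1 by near: x; exact: nbhs_left_lt.
have x2 : 2^-1 < x by near: x; apply: nbhs_left_gt; rewrite invf_lt1// ltr1n.
have hx : -1 < x < 1 by apply/andP; split; lra.
have S0 := Sq_gt0 hx.
have : `|0 - Num.sqrt (1 - x ^+ 2)| < (2 * (`|A| + 1))^-1 by near: x.
rewrite -/(Sq x) sub0r normrN gtr0_norm// => h.
have h2 : 2 * (`|A| + 1) < wt x.
  by rewrite /wt -[ltLHS]invrK ltf_pV2 ?posrE// invr_gt0.
have := ler_norm A; have := normr_ge0 A; nra.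
Unshelve. all: end_near. Qed.

Lemma SqN (x : R) : Sq (- x) = Sq x. Proof. by rewrite /Sq sqrrN. Qed.

Lemma atan_wt_left : atan (x * wt x) @[x --> (-1:R)^'+] --> - (pi / 2).
Proof.
apply/cvg_at_rightNP; rewrite opprK.
rewrite (_ : _ \o _ = fun x : R => - atan (x * wt x)); last first.
  by apply/funext => x /=; rewrite /wt SqN mulNr atanN.
exact: (cvgN atan_wt_right).
Qed.

Lemma Sq_right : Sq x @[x --> (1:R)^'-] --> (0:R).
Proof.
have : Sq x @[x --> (1:R)^'-] --> Sq 1.
  apply: cvg_at_left_filter; exact: continuous_Sq.
by rewrite {2}/Sq expr1n subrr sqrtr0.
Qed.

Lemma Sq_left : Sq x @[x --> (-1:R)^'+] --> (0:R).
Proof.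
have : Sq x @[x --> (-1:R)^'+] --> Sq (-1).
  apply: cvg_at_right_filter; exact: continuous_Sq.
by rewrite {2}/Sq sqrrN expr1n subrr sqrtr0.
Qed.

Lemma wt_open (f : R -> R) : supp f -> mu.-integrable `]-1, 1[ (EFin \o f) ->
  L1r f /\ Int f = \int[mu]_(x in `]-1, 1[) f x.
Proof.
move=> sf Lf.
have E : (fun x => \1_`]-1, 1[ x * f x) = f.
  by apply/funext => x; rewrite -supp_indic.
split; first by have := L1r_itv_mul Lf; rewrite E.
by rewrite -Int_itv E.
Qed.

Let N11 : (-1 : R) < 1. Proof. lra. Qed.

Lemma wt_int : L1r wt /\ Int wt = pi.
Proof.
have [L E] := @FTC_oo R _ wt (-1) 1 _ _ N11 (fun x h => is_derive_atan_wt h)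
  (fun x h => continuous_wt h) (fun x _ => wt_ge0 x) atan_wt_left atan_wt_right.
have [L1 E1] := wt_open wt_supp L.
split => //; rewrite E1 E; by field.
Qed.

(** The primitive of [x * wt x] is [- Sq], but [FTC_oo] asks for a nonnegative integrand; so
    [(1 + x) * wt x] is integrated and [wt] subtracted. *)
Lemma Int_xwt : L1r (fun x => x * wt x) /\ Int (fun x => x * wt x) = 0.
Proof.
have [Lw Ew] := wt_int.
have h (x : R) : -1 < x < 1 ->
    is_derive x (1:R) (fun x => atan (x * wt x) - Sq x) ((1 + x) * wt x).
  move=> hx; have h1 := is_derive_atan_wt hx; have h2 := is_derive_Sq hx.
  by apply: is_derive_eq; rewrite /wt; ring.
have c1 : (atan (x * wt x) - Sq x) @[x --> (-1:R)^'+] --> - (pi / 2).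
  by rewrite -[X in _ --> X]subr0; apply: cvgB; [exact: atan_wt_left|exact: Sq_left].
have c2 : (atan (x * wt x) - Sq x) @[x --> (1:R)^'-] --> pi / 2.
  by rewrite -[X in _ --> X]subr0; apply: cvgB; [exact: atan_wt_right|exact: Sq_right].
have [||L E] := @FTC_oo R _ (fun x => (1 + x) * wt x) (-1) 1 _ _ N11 h _ _ c1 c2.
- move=> x hx; apply: cvgM; last exact: continuous_wt.
  by apply: cvgD; [exact: cvg_cst|exact: cvg_id].
- by move=> x /andP[x1 x2]; rewrite mulr_ge0 ?wt_ge0//; lra.
have s1 : supp (fun x => (1 + x) * wt x) by move=> x hx; rewrite wt_supp// mulr0.
have [L1 E1] := wt_open s1 L.
have F : (fun x => x * wt x) = (fun x => (1 + x) * wt x - wt x).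
  by apply/funext => x; ring.
rewrite F; split; first exact: L1rB.
by rewrite IntB// E1 E Ew; field.
Qed.

(* [(ln `|x - t| - ln (Dn t x)) / Sq t] is a primitive of [wt x / (x - t)]. *)
Definition Dn (t x : R) := 1 - x * t + Sq x * Sq t.

Lemma Dn_gt0 (t x : R) : -1 < t < 1 -> -1 <= x <= 1 -> 0 < Dn t x.
Proof.
move=> /andP[t1 t2] /andP[x1 x2]; have := Sq_ge0 x; have := Sq_ge0 t => h1 h2.
have h3 := mulr_ge0 h2 h1.
have h4 : x * t < 1.
  by case: (lerP 0 t) => t0; nra.
by rewrite /Dn; lra.
Qed.

Lemma is_derive_lnD (t x : R) : -1 < t < 1 -> -1 < x < 1 -> x != t ->
  is_derive x (1:R) (fun x => (ln `|x - t| - ln (Dn t x)) / Sq t) (wt x / (x - t)).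
Proof.
move=> ht hx xt.
have S0 := Sq_gt0 hx; have S2 := Sq_sqr hx; have T0 := Sq_gt0 ht; have T2 := Sq_sqr ht.
have D0 : 0 < Dn t x by apply: Dn_gt0 => //; move: hx => /andP[? ?]; apply/andP; split; lra.
have hS := is_derive_Sq hx.
have xt0 : x - t != 0 by rewrite subr_eq0.
have hD : is_derive x (1:R) (Dn t) (- t - x * Sq t / Sq x).
  by rewrite /Dn; apply: is_derive_eq; rewrite /GRing.scale/=; field; rewrite gt_eqF.
have hlD := @is_derive1_comp R (@ln R) (Dn t) x _ _ (is_derive1_ln D0) hD.
have hlx : is_derive x (1:R) (fun x => ln `|x - t|) (x - t)^-1.
  have h1 : is_derive x (1:R) (fun x : R => x - t) 1.
    by apply: is_derive_eq; rewrite subr0.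
  have [lt|gt] := ltP x t.
    have p : 0 < - (x - t) by rewrite oppr_gt0 subr_lt0.
    have h2 : is_derive x (1:R) (fun x : R => - (x - t)) (-1).
      by apply: is_derive_eq.
    have := @is_derive1_comp R (@ln R) (fun x : R => - (x - t)) x _ _ (is_derive1_ln p) h2.
    rewrite mulrN1 invrN opprK => h3.
    apply: near_eq_is_derive h3.
    near=> y; rewrite /= ltr0_norm// subr_lt0; near: y; exact: lt_nbhsl.
  have p : 0 < x - t by rewrite subr_gt0 lt_neqAle eq_sym xt.
  have := @is_derive1_comp R (@ln R) (fun x : R => x - t) x _ _ (is_derive1_ln p) h1.
  rewrite mulr1 => h3.
  apply: near_eq_is_derive h3.
  near=> y; rewrite /= gtr0_norm// subr_gt0; near: y; apply: lt_nbhsr.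
  by rewrite -subr_gt0.
have {}hlD : is_derive x (1:R) (fun x => ln (Dn t x)) ((Dn t x)^-1 * (- t - x * Sq t / Sq x)) by [].
have -> : (fun x => (ln `|x - t| - ln (Dn t x)) / Sq t) =
  ((fun x => ln `|x - t|) - (fun x => ln (Dn t x))) * (cst (Sq t)^-1) by [].
apply: is_derive_eq; rewrite /GRing.scale/= mulr0 add0r.
(* Over the common denominator [(x - t) * Dn t x], the derivative of the difference of logarithms
   has this numerator; the relation between [Sq x ^+ 2] and [x ^+ 2], and the one for [t], make
   [Dn t x] cancel. *)
have key : Dn t x + (x - t) * (t + x * Sq t / Sq x) = Sq t / Sq x * Dn t x.
  have -> : Dn t x + (x - t) * (t + x * Sq t / Sq x) =
     (1 - t ^+ 2) + Sq x * Sq t + (Sq t / Sq x) * (x ^+ 2 - x * t).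
    by rewrite /Dn; field; rewrite gt_eqF.
  have -> : x ^+ 2 = 1 - Sq x ^+ 2 by rewrite S2; ring.
  by rewrite -T2 /Dn; field; rewrite gt_eqF.
rewrite (_ : _ - _ = (Dn t x + (x - t) * (t + x * Sq t / Sq x)) / ((x - t) * Dn t x)).
  by rewrite key /wt; field; rewrite xt0 !gt_eqF.
by field; rewrite xt0 !gt_eqF.
Unshelve. all: end_near. Qed.

End weight.

(** * Transforms of [wt] and [Sq], with bounds uniform in the height *)

Section weight_transform.
Context {R : realType}.
Notation mu := (@lebesgue_measure R).
Implicit Types f : R -> R.

Lemma conv_kTE f (t e : R) : L1r f -> supp f -> 0 < e ->
  conv (kT e) f t = \int[mu]_(x in `]-1, t - e[) (f x / (x - t)) +
                    \int[mu]_(x in `]t + e, 1[) (f x / (x - t)).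
Proof.
move=> Lf sf e0.
have Lk : L1r (fun x => f x * kT e (x - t)).
  exact: L1rM_bounded Lf (measurable_sh t (measurable_kT e)) (fun x => kT_le (x - t) e0).
have LI (i : interval R) : L1r (fun x => \1_[set` i] x * (f x * kT e (x - t))).
  under eq_fun do rewrite mulrC; apply: (@L1rM_bounded _ _ _ 1) => //.
  by move=> x; rewrite ger0_norm ?indic_ge0// indic_le1.
have EA x : \1_`]-1, t - e[ x * (f x * kT e (x - t)) = \1_`]-1, t - e[ x * (f x / (x - t)).
  rewrite indicE mem_setE in_itv/=; case: (boolP (-1 < x < t - e)) => [/andP[_ h]|_].
    rewrite /kT ifT// lter_normr; apply/orP; right; lra.
  by rewrite !mul0r.
have EB x : \1_`]t + e, 1[ x * (f x * kT e (x - t)) = \1_`]t + e, 1[ x * (f x / (x - t)).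
  rewrite indicE mem_setE in_itv/=; case: (boolP (t + e < x < 1)) => [/andP[h _]|_].
    rewrite /kT ifT// lter_normr; apply/orP; left; lra.
  by rewrite !mul0r.
rewrite -!Int_itv.
rewrite -(eq_Int EA) -(eq_Int EB) -IntD//.
apply: eq_Int => x; rewrite -mulrDl !indicE !mem_setE !in_itv/=.
have [h|h] := boolP (-1 < x < 1); last by rewrite sf// mul0r mulr0.
move: h => /andP[x1 x2]; rewrite x1 x2 andbT /= /kT.
have [h|h] := ltP e `|x - t|; last by rewrite !mulr0.
move: h; rewrite lter_normr => /orP[] h.
  rewrite (_ : (x < t - e) = false); last by apply/negbTE; rewrite -leNgt; lra.
  by rewrite (_ : t + e < x) ?add0r ?mul1r//; lra.
rewrite (_ : (t + e < x) = false); last by apply/negbTE; rewrite -leNgt; lra.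
by rewrite (_ : x < t - e) ?addr0 ?mul1r//; lra.
Qed.

Lemma continuous_Dn (t : R) : continuous (Dn t).
Proof.
move=> x; apply: cvgD.
  apply: cvgB; first exact: cvg_cst.
  by apply: cvgM; [exact: cvg_id|exact: cvg_cst].
by apply: cvgM; [exact: continuous_Sq|exact: cvg_cst].
Qed.

Lemma continuous_lnD (t x : R) : -1 < t < 1 -> -1 <= x <= 1 -> x != t ->
  {for x, continuous (fun x => (ln `|x - t| - ln (Dn t x)) / Sq t)}.
Proof.
move=> ht hx xt.
apply: cvgM; last exact: cvg_cst.
apply: cvgB.
  apply: (@continuous_comp _ _ _ (fun x : R => `|x - t|) (@ln R)).
    by apply: cvg_norm; apply: cvgB; [exact: cvg_id|exact: cvg_cst].
  by apply: continuous_ln; rewrite normr_gt0 subr_eq0.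
apply: (@continuous_comp _ _ _ (Dn t) (@ln R)); first exact: continuous_Dn.
by apply: continuous_ln; exact: Dn_gt0.
Qed.

(** The primitive vanishes at both ends, because [Dn t x = |x - t|] at [x = 1] and [x = -1]; at
    [t - e] and [t + e] the terms [ln e] cancel. Continuity of [Dn t] then makes the principal value
    zero. *)
Lemma conv_kT_wt (t e : R) : -1 < t < 1 -> 0 < e -> -1 < t - e -> t + e < 1 ->
  conv (kT e) wt t = (ln (Dn t (t + e)) - ln (Dn t (t - e))) / Sq t.
Proof.
move=> ht e0 e1 e2; have [Lw Ew] := @wt_int R.
have T0 := Sq_gt0 ht; case/andP: (ht) => t1 t2.
rewrite (conv_kTE t Lw (@wt_supp R) e0).
pose F x := (ln `|x - t| - ln (Dn t x)) / Sq t.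
have F1 : F 1 = 0.
  by rewrite /F /Dn /Sq expr1n subrr sqrtr0 mul0r addr0 mul1r ger0_norm ?subrr ?mul0r// subr_ge0 ltW.
have FN1 : F (-1) = 0.
  rewrite /F /Dn /Sq sqrrN expr1n subrr sqrtr0 mul0r addr0 mulN1r opprK.
  by rewrite -opprD normrN [1 + t]addrC ger0_norm ?[t + 1]addrC ?subrr ?mul0r//; lra.
have c x : -1 <= x <= 1 -> x != t -> {for x, continuous F}.
  by move=> hx xt; exact: continuous_lnD.
have ne (x : R) : x < t -> x != t by move=> h; rewrite lt_eqF.
have ne' (x : R) : t < x -> x != t by move=> h; rewrite gt_eqF.
have cw (x : R) : -1 < x < 1 -> x != t -> {for x, continuous (fun x => wt x / (x - t))}.
  move=> hx xt; apply: cvgM; first exact: continuous_wt.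
  apply: cvgV; first by rewrite subr_eq0.
  by apply: cvgB; [exact: cvg_id|exact: cvg_cst].
have [|||||_ IR] := @FTC_oo R F (fun x => wt x / (x - t)) (t + e) 1 (F (t + e)) 0 e2.
- move=> x /andP[h1 h2]; apply: is_derive_lnD => //; last by apply: ne'; lra.
  by apply/andP; split; lra.
- move=> x /andP[h1 h2]; apply: cw; last by apply: ne'; lra.
  by apply/andP; split; lra.
- by move=> x /andP[h1 h2]; rewrite divr_ge0 ?wt_ge0//; lra.
- apply: cvg_at_right_filter; apply: c; last by apply: ne'; lra.
  by apply/andP; split; lra.
- rewrite -F1; apply: cvg_at_left_filter; apply: c; last by apply: ne'; lra.
  by apply/andP; split; lra.
(* To the left of [t] the integrand is negative, so [FTC_oo] is applied to its opposite. *)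
have [|||||LL IL] := @FTC_oo R (fun x => - F x) (fun x => - (wt x / (x - t))) (-1) (t - e) 0 (- F (t - e)) e1.
- move=> x /andP[h1 h2]; apply: is_deriveN; apply: is_derive_lnD => //; last by apply: ne; lra.
  by apply/andP; split; lra.
- move=> x /andP[h1 h2]; apply: cvgN; apply: cw; last by apply: ne; lra.
  by apply/andP; split; lra.
- by move=> x /andP[h1 h2]; rewrite -mulrN -invrN; apply: divr_ge0; [exact: wt_ge0|lra].
- rewrite -oppr0 -FN1; apply: cvgN; apply: cvg_at_right_filter; apply: c; last by apply: ne; lra.
  by apply/andP; split; lra.
- apply: cvgN; apply: cvg_at_left_filter; apply: c; last by apply: ne; lra.
  by apply/andP; split; lra.
have IL' : \int[mu]_(x in `]-1, t - e[) (wt x / (x - t)) = F (t - e).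
  have -> : F (t - e) = - (- F (t - e) - 0) by rewrite subr0 opprK.
  rewrite -IL -[RHS]mulN1r -RintegralZl//.
  by apply: eq_Rintegral => x _; rewrite mulN1r opprK.
rewrite IL' IR /F.
have -> : `|t - e - t| = e by rewrite addrAC subrr sub0r normrN gtr0_norm.
have -> : `|t + e - t| = e by rewrite addrAC subrr add0r gtr0_norm.
by field; rewrite gt_eqF.
Qed.

Lemma conv_kT_wt_cvg (t : R) : -1 < t < 1 -> conv (kT e) wt t @[e --> 0^'+] --> (0:R).
Proof.
move=> ht; case/andP: (ht) => t1 t2.
have h : ((ln (Dn t (t + e)) - ln (Dn t (t - e))) / Sq t) @[e --> (0:R)^'+] --> (0:R).
  have z : (ln (Dn t (t + 0)) - ln (Dn t (t - 0))) / Sq t = 0.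
    by rewrite addr0 subr0 subrr mul0r.
  rewrite -[X in _ --> X]z; apply: cvgM; last exact: cvg_cst.
  have cl : {for t, continuous (fun x => ln (Dn t x))}.
    apply: (@continuous_comp _ _ _ (Dn t) (@ln R)); first exact: continuous_Dn.
    by apply: continuous_ln; apply: Dn_gt0 => //; apply/andP; split; lra.
  have g0 : {for (0:R), continuous (fun e : R => ln (Dn t (t + e)))}.
    apply: (@continuous_comp _ _ _ (fun e : R => t + e) (fun x => ln (Dn t x))).
      by apply: cvgD; [exact: cvg_cst|exact: cvg_id].
    by rewrite addr0.
  have g1 : {for (0:R), continuous (fun e : R => ln (Dn t (t - e)))}.
    apply: (@continuous_comp _ _ _ (fun e : R => t - e) (fun x => ln (Dn t x))).
      by apply: cvgB; [exact: cvg_cst|exact: cvg_id].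
    by rewrite subr0.
  apply: cvgB; [exact: cvg_at_right_filter g0|exact: cvg_at_right_filter g1].
apply: cvg_trans h; apply: near_eq_cvg; near=> e.
have e0 : 0 < e by near: e; exact: nbhs_right_gt.
rewrite conv_kT_wt//.
  have : e < 1 + t by near: e; apply: nbhs_right_lt; lra.
  lra.
have : e < 1 - t by near: e; apply: nbhs_right_lt; lra.
lra.
Unshelve. all: end_near. Qed.

(** Write [Sq x] as [Sq x ^+ 2 * wt x] with [Sq x ^+ 2 = Sq t ^+ 2 - (x - t) * (x + t)]. The first
    part is a multiple of the transform of [wt], which tends to zero; in the second [x - t] cancels
    the kernel, and [(x + t) * wt x] has integral [pi * t]. *)
Lemma conv_kT_Sq_cvg (t : R) : -1 < t < 1 -> conv (kT e) Sq t @[e --> 0^'+] --> - (pi * t).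
Proof.
move=> ht; have [Lw Ew] := @wt_int R; have [Lx Ex] := @Int_xwt R.
have T2 := Sq_sqr ht.
pose g x := (x + t) * wt x.
have Lg : L1r g.
  have := L1rD Lx (L1rZ t Lw); rewrite (_ : (fun x => _ + _) = g)//.
  by apply/funext => x; rewrite /g mulrDl.
have Ig : Int g = pi * t.
  have -> : g = (fun x => x * wt x + t * wt x) by apply/funext => x; rewrite /g mulrDl.
  rewrite IntD//; last exact: L1rZ.
  by rewrite IntZ// Ex Ew add0r mulrC.
pose ind e (x : R) : R := if e < `|x - t| then 1 else 0.
have mind e : measurable_fun setT (ind e).
  apply: measurable_fun_ifT => //; apply: measurable_fun_ltr => //.
  by apply: measurableT_comp => //; exact: measurable_shift.
have indb e x : `|ind e x| <= 1 by rewrite /ind; case: ifP; rewrite ?normr1 ?normr0.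
have E e : 0 < e -> conv (kT e) Sq t =
    - Int (fun x => g x * ind e x) + Sq t ^+ 2 * conv (kT e) wt t.
  move=> e0; rewrite /conv.
  have L1 : L1r (fun x => wt x * kT e (x - t)).
    exact: L1rM_bounded Lw (measurable_sh t (measurable_kT e)) (fun x => kT_le (x - t) e0).
  have L2 : L1r (fun x => g x * ind e x) by exact: L1rM_bounded Lg (mind e) (indb e).
  rewrite -IntZ// -IntN// -IntD//; [|exact: L1rN|exact: L1rZ].
  apply: eq_Int => x; rewrite /g /ind /kT; case: ifPn => h; last by rewrite !mulr0 oppr0 addr0.
  have [hx|hx] := boolP (-1 < x < 1); last first.
    by rewrite wt_supp// Sq_supp// !(mul0r, mulr0) oppr0 addr0.
  have S0 := Sq_gt0 hx; have S2 := Sq_sqr hx.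
  have xt : x - t != 0.
    by apply: contraTneq h => ->; rewrite normr0 -leNgt (ltW e0).
  have -> : Sq x = Sq x ^+ 2 * wt x by rewrite /wt expr2 mulfK// gt_eqF.
  by rewrite S2 T2; field.
have c1 : Int (fun x => g x * ind e x) @[e --> (0:R)^'+] --> pi * t.
  rewrite -Ig; apply: (@Int_cvgr R (fun e x => g x * ind e x) g (fun x => `|g x|)).
  - move=> e _; apply: measurable_funM => //; exact: L1r_meas.
  - exact: L1r_meas.
  - exact: L1r_abs.
  - have : {ae mu, forall x : R, x <> t}.
      exists [set t]; split => //; first exact: lebesgue_measure_set1.
      by move=> x /= /contrapT.
    apply: aeS => x xt; apply: cvg_near_cst; near=> e.
    rewrite /ind ifT ?mulr1//; near: e; apply: nbhs_right_lt.
    by rewrite normr_gt0 subr_eq0; apply/eqP.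
  - by move=> e x _; rewrite normrM -[leRHS]mulr1 ler_wpM2l.
have z : - (pi * t) = - (pi * t) + Sq t ^+ 2 * 0 by rewrite mulr0 addr0.
have : (- Int (fun x => g x * ind e x) + Sq t ^+ 2 * conv (kT e) wt t) @[e --> (0:R)^'+] --> - (pi * t).
  rewrite [X in _ --> X]z; apply: cvgD; first exact: cvgN.
  by apply: cvgM; [exact: cvg_cst|exact: conv_kT_wt_cvg].
apply: cvg_trans; apply: near_eq_cvg; near=> e.
by rewrite E//; near: e; exact: nbhs_right_gt.
Unshelve. all: end_near. Qed.

Lemma conv_kQ_Sq_cvg (t : R) : -1 < t < 1 -> conv (kQ s) Sq t @[s --> 0^'+] --> - (pi * t).
Proof.
move=> ht.
have h1 := conv_kT_Sq_cvg ht.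
have h2 := conv_kQ_sub_kT (@L1r_Sq R) (@Sq_supp R) ht
  (continuous_LPt (@L1r_Sq R) (@continuous_Sq R t)).
rewrite -[X in _ --> X]add0r.
rewrite (_ : (fun s => conv (kQ s) Sq t) =
  (fun s => (conv (kQ s) Sq t - conv (kT s) Sq t) + conv (kT s) Sq t)); last first.
  by apply/funext => s; rewrite subrK.
exact: cvgD h2 h1.
Qed.

(** For nonnegative [a] and [b], [(a - b) ^+ 2] is at most [|a ^+ 2 - b ^+ 2|], and [Sq ^+ 2] is the
    Lipschitz function [cut]. *)
Lemma Sq_holder (x y : R) : (Sq x - Sq y) ^+ 2 <= 2 * `|x - y|.
Proof.
have E z : Sq z ^+ 2 = cut z.
  rewrite /cut; case: ifPn => h; first exact: Sq_sqr.
  by rewrite Sq_supp// expr0n.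
apply: (@le_trans _ _ `|cut x - cut y|); last exact: cut_lip.
rewrite -!E; have := Sq_ge0 x; have := Sq_ge0 y; set a := Sq x; set b := Sq y => b0 a0.
case: (lerP b a) => h.
  by rewrite ger0_norm; nra.
by rewrite ltr0_norm; nra.
Qed.

(** With [m = |x - t| + s], the Hölder exponent 1/2 gives [2 * sqrt m] against a kernel of size
    [2 / m]: the singularity left is integrable uniformly in [s]. *)
Lemma kQ_Sq_bound (s t x : R) : 0 < s ->
  `|(Sq x - Sq t) * kQ s (x - t)| <= 4 / Num.sqrt (`|x - t| + s).
Proof.
move=> s0; set m := `|x - t| + s.
have u0 := normr_ge0 (x - t).
have m0 : 0 < m by rewrite /m ltr_wpDl.
have r0 : 0 < Num.sqrt m by rewrite sqrtr_gt0.
have r2 : Num.sqrt m ^+ 2 = m by rewrite sqr_sqrtr// ltW.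
have D := sqD_gt0 (x - t) s0.
have h1 : `|Sq x - Sq t| <= 2 * Num.sqrt m.
  have m1 : 0 <= 2 * Num.sqrt m by rewrite mulr_ge0// sqrtr_ge0.
  rewrite -ler_sqr ?nnegrE//.
  rewrite real_normK ?num_real// exprMn r2; apply: (le_trans (Sq_holder _ _)).
  by rewrite /m; lra.
have h2 : `|kQ s (x - t)| <= 2 / m.
  rewrite /kQ normrM normfV (gtr0_norm D) ler_pdivrMr// mulrAC ler_pdivlMr//.
  rewrite -[(x - t) ^+ 2]real_normK ?num_real// /m; nra.
rewrite normrM; apply: (le_trans (ler_pM _ _ h1 h2)) => //.
rewrite -[X in 2 / X]r2 le_eqVlt; apply/orP; left; apply/eqP; field.
by rewrite gt_eqF.
Qed.

Lemma int_sqrt_right (s t : R) : 0 < s ->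
  mu.-integrable `[t, t + 3] (EFin \o (fun x => 4 / Num.sqrt (`|x - t| + s))) /\
  \int[mu]_(x in `[t, t + 3]) (4 / Num.sqrt (`|x - t| + s)) = 8 * (Num.sqrt (3 + s) - Num.sqrt s).
Proof.
move=> s0; have h3 : t < t + 3 by lra.
have [||L I] := @FTC R (fun x => 8 * Num.sqrt (x - t + s)) (fun x => 4 / Num.sqrt (x - t + s)) t (t + 3) h3.
- move=> x /andP[x1 x2]; have p : 0 < x - t + s by lra.
  have r0 : 0 < Num.sqrt (x - t + s) by rewrite sqrtr_gt0.
  have h1 : is_derive x (1:R) (fun x : R => x - t + s) 1.
    by apply: is_derive_eq; ring.
  have h2 := @is_derive1_comp R Num.sqrt (fun x : R => x - t + s) x _ _ (is_derive1_sqrt p) h1.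
  have -> : (fun x => 8 * Num.sqrt (x - t + s)) = (cst 8) * (Num.sqrt \o (fun x : R => x - t + s)) by [].
  by apply: is_derive_eq; rewrite /GRing.scale/=; field; rewrite gt_eqF.
- move=> x /andP[x1 x2]; have p : 0 < x - t + s by lra.
  apply: cvgM; first exact: cvg_cst.
  apply: cvgV; first by rewrite gt_eqF// sqrtr_gt0.
  apply: (@continuous_comp _ _ _ (fun x : R => x - t + s) Num.sqrt); last exact: sqrt_continuous.
  apply: cvgD; last exact: cvg_cst.
  by apply: cvgB; [exact: cvg_id|exact: cvg_cst].
have E : {in `[t, t + 3]%classic, (fun x => 4 / Num.sqrt (x - t + s)) =1 (fun x => 4 / Num.sqrt (`|x - t| + s))}.
  by move=> x; rewrite inE/= in_itv/= => /andP[x1 _]; rewrite ger0_norm// subr_ge0.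
split.
  by apply: eq_integrable L => // x hx /=; rewrite E.
transitivity (\int[mu]_(x in `[t, t + 3]) (4 / Num.sqrt (x - t + s))).
  by apply: eq_Rintegral => x hx; rewrite E.
rewrite I [t + 3 - t]addrAC subrr !add0r; ring.
Qed.

Lemma int_sqrt_left (s t : R) : 0 < s ->
  mu.-integrable `[t - 3, t] (EFin \o (fun x => 4 / Num.sqrt (`|x - t| + s))) /\
  \int[mu]_(x in `[t - 3, t]) (4 / Num.sqrt (`|x - t| + s)) = 8 * (Num.sqrt (3 + s) - Num.sqrt s).
Proof.
move=> s0; have h3 : t - 3 < t by lra.
have [||L I] := @FTC R (fun x => - 8 * Num.sqrt (t - x + s)) (fun x => 4 / Num.sqrt (t - x + s)) (t - 3) t h3.
- move=> x /andP[x1 x2]; have p : 0 < t - x + s by lra.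
  have r0 : 0 < Num.sqrt (t - x + s) by rewrite sqrtr_gt0.
  have h1 : is_derive x (1:R) (fun x : R => t - x + s) (- 1).
    by apply: is_derive_eq; ring.
  have h2 := @is_derive1_comp R Num.sqrt (fun x : R => t - x + s) x _ _ (is_derive1_sqrt p) h1.
  have -> : (fun x => - 8 * Num.sqrt (t - x + s)) = (cst (- 8)) * (Num.sqrt \o (fun x : R => t - x + s)) by [].
  by apply: is_derive_eq; rewrite /GRing.scale/=; field; rewrite gt_eqF.
- move=> x /andP[x1 x2]; have p : 0 < t - x + s by lra.
  apply: cvgM; first exact: cvg_cst.
  apply: cvgV; first by rewrite gt_eqF// sqrtr_gt0.
  apply: (@continuous_comp _ _ _ (fun x : R => t - x + s) Num.sqrt); last exact: sqrt_continuous.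
  apply: cvgD; last exact: cvg_cst.
  by apply: cvgB; [exact: cvg_cst|exact: cvg_id].
have E : {in `[t - 3, t]%classic, (fun x => 4 / Num.sqrt (t - x + s)) =1 (fun x => 4 / Num.sqrt (`|x - t| + s))}.
  by move=> x; rewrite inE/= in_itv/= => /andP[_ x1]; rewrite distrC ger0_norm// subr_ge0.
split.
  by apply: eq_integrable L => // x hx /=; rewrite E.
transitivity (\int[mu]_(x in `[t - 3, t]) (4 / Num.sqrt (t - x + s))).
  by apply: eq_Rintegral => x hx; rewrite E.
rewrite I subrr add0r (_ : t - (t - 3) = 3); ring.
Qed.

(** This uniform bound supplies the dominating function when [s] tends to zero in integrals against
    [f], which is merely integrable. Since [kQ s] is odd on the window, [Sq x] is replaced by
    [Sq x - Sq t]; each half of the window contributes at most [8 * sqrt (3 + s)], that is at most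
    16. *)
Lemma conv_kQ_Sq_bound (s t : R) : -1 < t < 1 -> 0 < s -> s < 1 -> `|conv (kQ s) Sq t| <= 32.
Proof.
move=> ht s0 s1; case/andP: (ht) => t1 t2.
have [Ll Il] := int_sqrt_left t s0; have [Lr Ir] := int_sqrt_right t s0.
have LQ : L1r (fun x => \1_`[t - 3, t + 3] x * kQ s (x - t)).
  exact: L1r_itv_bounded (measurable_sh t (measurable_kQ s)) (fun x => kQ_le (x - t) s0).
have LSQ : L1r (fun x => Sq x * kQ s (x - t)).
  exact: L1rM_bounded (@L1r_Sq R) (measurable_sh t (measurable_kQ s)) (fun x => kQ_le (x - t) s0).
have z : Sq t * Int (fun x => \1_`[t - 3, t + 3] x * kQ s (x - t)) = 0.
  by rewrite Int_itv int_kQ// mulr0.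
have L1 := L1r_itv_mul Ll; have L2 := L1r_itv_mul Lr.
rewrite /conv -[X in `|X|]subr0 -z -IntZ// -IntB//; last exact: L1rZ.
apply: (@le_trans _ _ (8 * (Num.sqrt (3 + s) - Num.sqrt s) + 8 * (Num.sqrt (3 + s) - Num.sqrt s))); last first.
  have : Num.sqrt (3 + s) <= 2.
    have -> : (2 : R) = Num.sqrt (2 ^+ 2) by rewrite sqrtr_sqr ger0_norm.
    by apply: ler_wsqrtr; rewrite expr2; lra.
  by have := sqrtr_ge0 s; lra.
rewrite -{1}Il -Ir -!Int_itv -IntD//.
apply: Int_abs_le.
- by apply: L1rB => //; exact: L1rZ.
- exact: L1rD.
move=> x; have hb := kQ_Sq_bound t x s0.
have b0 : 0 <= 4 / Num.sqrt (`|x - t| + s) by rewrite divr_ge0// sqrtr_ge0.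
rewrite -mulrDl !indicE !mem_setE !in_itv/=.
have [h|h] := boolP (t - 3 <= x <= t + 3); last first.
  rewrite mul0r mulr0 subr0 Sq_supp ?mul0r ?normr0.
    by rewrite mulr_ge0// addr_ge0.
  by apply: contra h => /andP[? ?]; apply/andP; split; lra.
move: h => /andP[h1 h2]; rewrite h1 h2 andbT /= mul1r -mulrBl.
apply: (le_trans hb); rewrite -[leLHS]mul1r ler_wpM2r//.
by case: (lerP x t) => h /=; [rewrite lerDl ler0n|rewrite add0r (ltW h)].
Qed.

End weight_transform.

(** * Inversion *)

Section cauchy_identity.
Context {R : realType}.
Notation mu := (@lebesgue_measure R).
Implicit Types f G : R -> R.

(** Replacing the parameter [n] by [min n (b / 2)] changes nothing near zero and makes the
    domination global. *)
Lemma Int_cvgr_near (b : R) (f_ : R -> R -> R) f g : 0 < b ->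
  (forall n, 0 < n -> measurable_fun setT (f_ n)) ->
  measurable_fun setT f -> L1r g ->
  {ae mu, forall x, f_ n x @[n --> 0^'+] --> f x} ->
  (forall n x, 0 < n -> n < b -> `|f_ n x| <= g x) ->
  Int (f_ n) @[n --> 0^'+] --> Int f.
Proof.
move=> b0 mf_ mf Lg ff fg.
pose m n := Num.min n (b / 2).
have b2 : 0 < b / 2 < b by apply/andP; split; lra.
case/andP: b2 => b20 b2b.
have m0 n : 0 < n -> 0 < m n by move=> n0; rewrite lt_min n0.
have mE (n : R) : n < b / 2 -> m n = n by move=> /ltW h; rewrite /m min_l.
have := @Int_cvgr R (fun n => f_ (m n)) f g (fun n n0 => mf_ _ (m0 n n0)) mf Lg.
move=> h; have {}h : Int (f_ (m n)) @[n --> 0^'+] --> Int f.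
  apply: h.
    apply: aeS ff => x; apply: cvg_trans; apply: near_eq_cvg; near=> n.
    by rewrite mE//; near: n; exact: nbhs_right_lt.
  move=> n x n0; apply: fg; first exact: m0.
  by rewrite (le_lt_trans _ b2b)// ge_min lexx orbT.
apply: cvg_trans h; apply: near_eq_cvg; near=> n.
by rewrite mE//; near: n; exact: nbhs_right_lt.
Unshelve. all: end_near. Qed.

Lemma one_sub_kP (s u : R) : 0 < s -> u * kQ s u = 1 - s * kP s u.
Proof.
move=> s0; rewrite /kQ /kP; have := sqD_gt0 u s0; move=> D; field.
by rewrite gt_eqF.
Qed.

Lemma one_sub_kP_le (s u : R) : 0 < s -> `|1 - s * kP s u| <= 1.
Proof.
move=> s0; have h0 := mulr_ge0 (ltW s0) (kP_ge0 u s0).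
have : s * kP s u <= 1 by rewrite -ler_pdivlMl// mulr1; exact: kP_le.
by move=> h1; rewrite ger0_norm; lra.
Qed.

(* [- c] is the difference quotient of [k] at [tau]: [(x - tau) kQ s (x - tau)] tends to one,
   so the singular kernel disappears from the second term of [conv_test]. *)
Section test_function.
Variables (k c : R -> R) (M tau : R).
Hypothesis mk : measurable_fun setT k.
Hypothesis mc : measurable_fun setT c.
Hypothesis kM : forall x, `|k x| <= M.
Hypothesis cM : forall x, `|c x| <= M.
Hypothesis kc : forall x, k x - k tau = - ((x - tau) * c x).

Let LSc : L1r (fun x => Sq x * c x).
Proof. exact: L1rM_bounded (@L1r_Sq R) mc cM. Qed.

Let mw s : measurable_fun setT (fun x : R => 1 - s * kP s (x - tau)).
Proof.
apply: measurable_funB => //; apply: measurable_funM => //.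
exact: measurable_sh (measurable_kP s).
Qed.

Lemma conv_test s : 0 < s -> conv (kQ s) (fun x => Sq x * k x) tau =
  k tau * conv (kQ s) Sq tau - Int (fun x => Sq x * c x * (1 - s * kP s (x - tau))).
Proof.
move=> s0; rewrite /conv.
have LS : L1r (fun x => Sq x * kQ s (x - tau)).
  exact: L1rM_bounded (@L1r_Sq R) (measurable_sh tau (measurable_kQ s)) (fun x => kQ_le (x - tau) s0).
rewrite -IntZ// -IntB; last 2 first.
- exact: L1rZ.
- exact: L1rM_bounded LSc (mw s) (fun x => one_sub_kP_le (x - tau) s0).
apply: eq_Int => x; rewrite -one_sub_kP//.
have -> : k x = k tau - (x - tau) * c x by rewrite -kc addrC subrK.
by ring.
Qed.

Lemma conv_test_cvg : -1 < tau < 1 -> conv (kQ s) (fun x => Sq x * k x) tau @[s --> 0^'+] -->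
  k tau * - (pi * tau) - Int (fun x => Sq x * c x).
Proof.
move=> ht.
have c1 : Int (fun x => Sq x * c x * (1 - s * kP s (x - tau))) @[s --> (0:R)^'+] -->
    Int (fun x => Sq x * c x).
  apply: (@Int_cvgr R (fun s x => Sq x * c x * (1 - s * kP s (x - tau))) _ (fun x => `|Sq x * c x|)).
  - by move=> s s0; apply: measurable_funM => //; exact: L1r_meas.
  - exact: L1r_meas.
  - exact: L1r_abs.
  - have : {ae mu, forall x : R, x <> tau}.
      exists [set tau]; split => //; first exact: lebesgue_measure_set1.
      by move=> x /= /contrapT.
    apply: aeS => x xt.
    have u0 : x - tau != 0 by rewrite subr_eq0; apply/eqP.
    have z : Sq x * c x * (1 - 0 * (0 / ((x - tau) ^+ 2 + 0 ^+ 2))) = Sq x * c x.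
      by rewrite mul0r subr0 mulr1.
    rewrite -[X in _ --> X]z; apply: cvgM; first exact: cvg_cst.
    apply: cvgB; first exact: cvg_cst.
    apply: (@cvg_at_right_filter _ _ (fun s : R => s * kP s (x - tau)) 0).
    apply: cvgM; first exact: cvg_id.
    apply: cvgM; first exact: cvg_id.
    apply: cvgV; first by rewrite expr0n addr0 sqrf_eq0.
    apply: cvgD; first exact: cvg_cst.
    exact: exprn_continuous.
  - by move=> s x s0; rewrite normrM -[leRHS]mulr1 ler_wpM2l// one_sub_kP_le.
have h : (k tau * conv (kQ s) Sq tau - Int (fun x => Sq x * c x * (1 - s * kP s (x - tau))))
    @[s --> (0:R)^'+] --> k tau * - (pi * tau) - Int (fun x => Sq x * c x).
  apply: cvgB => //; apply: cvgM; first exact: cvg_cst.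
  exact: conv_kQ_Sq_cvg.
apply: cvg_trans h; apply: near_eq_cvg; near=> s.
by rewrite conv_test//; near: s; exact: nbhs_right_gt.
Unshelve. all: end_near. Qed.

Lemma conv_test_bound s : -1 < tau < 1 -> 0 < s -> s < 1 ->
  `|conv (kQ s) (fun x => Sq x * k x) tau| <= M * 32 + M * Int Sq.
Proof.
move=> ht s0 s1; rewrite conv_test//; apply: (le_trans (ler_normB _ _)); apply: lerD.
  by rewrite normrM; apply: ler_pM => //; exact: conv_kQ_Sq_bound.
rewrite -IntZ; last exact: L1r_Sq.
apply: Int_abs_le.
- exact: L1rM_bounded LSc (mw s) (fun x => one_sub_kP_le (x - tau) s0).
- by apply: L1rZ; exact: L1r_Sq.
move=> x; rewrite normrM -[leRHS]mulr1; apply: ler_pM => //; last exact: one_sub_kP_le.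
by rewrite normrM mulrC (ger0_norm (Sq_ge0 x)) ler_wpM2r// Sq_ge0.
Qed.

End test_function.

Section identity.
Variables (f G : R -> R).
Hypothesis Zf : Zyg f.
Hypothesis mG : measurable_fun setT G.
Hypothesis sG : supp G.
Hypothesis LG : L1r G.
Hypothesis cG : normI (fun t => conv (kQ s) f t - G t) @[s --> 0^'+] --> 0.

Let Lf := Zyg_L1 Zf.

(** [pairing] with the test function [Sq * k] turns the left side into the limit of minus the
    integral of [f] against a regularised transform. [conv_test_cvg] gives its pointwise limit and
    [conv_test_bound] the domination. The real and imaginary parts of [1 / (x - z)] are the two
    instances of [k]. *)
Lemma identity_gen (k d : R -> R) (c : R -> R -> R) (M : R) :
  measurable_fun setT k -> (forall tau, measurable_fun setT (c tau)) -> measurable_fun setT d ->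
  (forall x, `|k x| <= M) -> (forall tau x, `|c tau x| <= M) ->
  (forall tau x, k x - k tau = - ((x - tau) * c tau x)) ->
  (forall tau, Int (fun x => Sq x * c tau x) = d tau) ->
  Int (fun t => G t * (Sq t * k t)) = Int (fun x => f x * (pi * (x * k x) + d x)).
Proof.
move=> mk mc md kM cM kc dE.
have M0 : 0 <= M by rewrite (le_trans _ (kM 0)).
have mSk : measurable_fun setT (fun x => Sq x * k x).
  by apply: measurable_funM => //; exact: measurable_Sq.
have sSk : supp (fun x => Sq x * k x) by move=> x h; rewrite Sq_supp// mul0r.
have bSk x : `|Sq x * k x| <= M.
  rewrite normrM -[leRHS]mul1r; apply: ler_pM => //.
  by rewrite (ger0_norm (Sq_ge0 x)) Sq_le1.
have c1 := pairing Zf mG sG LG cG mSk sSk bSk.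
pose lim x := k x * - (pi * x) - d x.
have mlim : measurable_fun setT lim.
  apply: measurable_funB => //; apply: measurable_funM => //.
  by apply: measurableT_comp => //; exact: measurable_funM.
have LSk := L1r_bounded mSk sSk bSk.
have c2 : Int (fun x => f x * conv (kQ s) (fun x => Sq x * k x) x) @[s --> (0:R)^'+] -->
    Int (fun x => f x * lim x).
  apply: (@Int_cvgr_near 1 (fun s x => f x * conv (kQ s) (fun x => Sq x * k x) x) _
    (fun x => (M * 32 + M * Int Sq) * `|f x|)) => //.
  - move=> s s0; apply: measurable_funM; first exact: L1r_meas.
    exact: measurable_conv LSk (measurable_kQ s) (fun u => kQ_le u s0).
  - by apply: measurable_funM => //; exact: L1r_meas.
  - by apply: L1rZ; exact: L1r_abs.
  - apply: aeW => x.
    have [hx|hx] := boolP (-1 < x < 1); last first.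
      have [_ sf _] := Zf; rewrite sf// mul0r.
      rewrite (_ : (fun s => _) = fun=> 0); first exact: cvg_cst.
      by apply/funext => s; rewrite mul0r.
    apply: cvgM; first exact: cvg_cst.
    rewrite /lim -dE; apply: (@conv_test_cvg k (c x) M) => //.
  - move=> s x s0 s1.
    have [hx|hx] := boolP (-1 < x < 1); last first.
      by have [_ sf _] := Zf; rewrite sf// mul0r normr0 mulr0.
    rewrite normrM mulrC; apply: ler_wpM2r => //.
    exact: (@conv_test_bound k (c x) M).
have c3 : (- Int (fun x => f x * conv (kQ s) (fun x => Sq x * k x) x)) @[s --> (0:R)^'+] -->
    - Int (fun x => f x * lim x) by exact: cvgN.
have -> : Int (fun t => G t * (Sq t * k t)) = - Int (fun x => f x * lim x).
  by rewrite -(cvg_lim _ c1)// (cvg_lim _ c3).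
rewrite -IntN; first by apply: eq_Int => x; rewrite /lim; ring.
have hb x : `|f x * lim x| <= (M * pi + (M * Int Sq)) * `|f x|.
  have [hx|hx] := boolP (-1 < x < 1); last first.
    by have [_ sf _] := Zf; rewrite sf// mul0r normr0 mulr0.
  rewrite normrM mulrC; apply: ler_wpM2r => //.
  rewrite /lim; apply: (le_trans (ler_normB _ _)); apply: lerD.
    rewrite normrM normrN normrM (gtr0_norm (@pi_gt0 R)); apply: ler_pM => //.
      by rewrite mulr_ge0// pi_ge0.
    rewrite -[leRHS]mulr1 ler_wpM2l ?pi_ge0// ler_norml.
    by move: hx => /andP[h1 h2]; rewrite !ltW.
  rewrite -dE -IntZ; last exact: L1r_Sq.
  apply: Int_abs_le.
  - exact: L1rM_bounded (@L1r_Sq R) (mc x) (cM x).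
  - by apply: L1rZ; exact: L1r_Sq.
  by move=> z; rewrite normrM mulrC (ger0_norm (Sq_ge0 z)) ler_wpM2r// Sq_ge0.
apply: (@L1r_le R _ (fun x => (M * pi + (M * Int Sq)) * `|f x|)) => //.
  by apply: measurable_funM => //; exact: L1r_meas.
by apply: L1rZ; exact: L1r_abs.
Qed.

Variables (y t : R).
Hypothesis y0 : 0 < y.

Let a x := kQ y (x - t).
Let b x := kP y (x - t).
Let q := conv (kQ y) Sq t.
Let p := conv (kP y) Sq t.
(** A common bound for the kernels, at most [1 / y], and for their difference quotients, which are
    sums of two products of kernels. *)
Let M := y^-1 + 2 / y ^+ 2.

Let ma : measurable_fun setT a. Proof. exact: measurable_sh (measurable_kQ y). Qed.
Let mb : measurable_fun setT b. Proof. exact: measurable_sh (measurable_kP y). Qed.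
Let a_y x : `|a x| <= y^-1. Proof. exact: kQ_le. Qed.
Let b_y x : `|b x| <= y^-1. Proof. exact: kP_abs_le. Qed.
Let y1 : 0 <= y^-1. Proof. by rewrite invr_ge0 ltW. Qed.
Let y2 : 0 <= 2 / y ^+ 2. Proof. by rewrite divr_ge0// sqr_ge0. Qed.
Let aM x : `|a x| <= M. Proof. by rewrite (le_trans (a_y x))// lerDl. Qed.
Let bM x : `|b x| <= M. Proof. by rewrite (le_trans (b_y x))// lerDl. Qed.

Let prod_le (x1 x2 x3 x4 : R) : `|x1| <= y^-1 -> `|x2| <= y^-1 -> `|x3| <= y^-1 ->
  `|x4| <= y^-1 -> `|x1 * x2 + x3 * x4| <= M.
Proof.
move=> h1 h2 h3 h4; apply: (@le_trans _ _ (2 / y ^+ 2)); last by rewrite lerDr.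
have -> : 2 / y ^+ 2 = y^-1 * y^-1 + y^-1 * y^-1 by field; rewrite gt_eqF.
apply: (le_trans (ler_normD _ _)); rewrite !normrM; apply: lerD; exact: ler_pM.
Qed.

Let LSa : L1r (fun x => Sq x * a x). Proof. exact: L1rM_bounded (@L1r_Sq R) ma a_y. Qed.
Let LSb : L1r (fun x => Sq x * b x). Proof. exact: L1rM_bounded (@L1r_Sq R) mb b_y. Qed.
Let Lfa : L1r (fun x => f x * a x). Proof. exact: L1rM_bounded Lf ma a_y. Qed.
Let Lfb : L1r (fun x => f x * b x). Proof. exact: L1rM_bounded Lf mb b_y. Qed.

Let xa x : (x - t) * a x = 1 - y * b x. Proof. exact: one_sub_kP. Qed.
Let xb x : (x - t) * b x = y * a x. Proof. by rewrite /a /b /kQ /kP; ring. Qed.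

(* Real and imaginary parts of the Cauchy transform of [Sq * G] at [t + i y], from
   [kQ y (x - t) - kQ y (tau - t) = - (x - tau) (kQ kQ - kP kP)] and
   [kP y (x - t) - kP y (tau - t) = - (x - tau) (kQ kP + kP kQ)]. *)
Lemma identity_re : conv (kQ y) (fun x => Sq x * G x) t =
  pi * Int f + (pi * t + q) * conv (kQ y) f t - (pi * y + p) * conv (kP y) f t.
Proof.
transitivity (Int (fun x => G x * (Sq x * a x))).
  by apply: eq_Int => x; rewrite /a; ring.
rewrite (@identity_gen a (fun tau => a tau * q - b tau * p)
  (fun tau x => a x * a tau - b x * b tau) M) //.
- have E x : f x * (pi * (x * a x) + (a x * q - b x * p)) =
     pi * f x + (pi * t + q) * (f x * a x) - (pi * y + p) * (f x * b x).
    have -> : x * a x = t * a x + (1 - y * b x) by rewrite -xa; ring.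
    by ring.
  rewrite (eq_Int E) IntB; [|by apply: L1rD; exact: L1rZ|exact: L1rZ].
  by rewrite IntD; [rewrite !IntZ|exact: L1rZ|exact: L1rZ].
- by move=> tau; apply: measurable_funB; apply: measurable_funM.
- by apply: measurable_funB; apply: measurable_funM.
- by move=> tau x; rewrite -mulrN; apply: prod_le => //; rewrite normrN.
- move=> tau x; rewrite /a /b /kQ /kP; have D1 := sqD_gt0 (x - t) y0; have D2 := sqD_gt0 (tau - t) y0.
  by field; rewrite !gt_eqF.
- move=> tau; rewrite /q /p /conv -!IntZ// -IntB; [|exact: L1rZ|exact: L1rZ].
  by apply: eq_Int => x; rewrite -/(a x) -/(b x); ring.
Qed.

Lemma identity_im : conv (kP y) (fun x => Sq x * G x) t =
  (pi * t + q) * conv (kP y) f t + (pi * y + p) * conv (kQ y) f t.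
Proof.
transitivity (Int (fun x => G x * (Sq x * b x))).
  by apply: eq_Int => x; rewrite /b; ring.
rewrite (@identity_gen b (fun tau => b tau * q + a tau * p)
  (fun tau x => a x * b tau + b x * a tau) M) //.
- have E x : f x * (pi * (x * b x) + (b x * q + a x * p)) =
     (pi * t + q) * (f x * b x) + (pi * y + p) * (f x * a x).
    have -> : x * b x = t * b x + y * a x by rewrite -xb; ring.
    by ring.
  by rewrite (eq_Int E) IntD; [rewrite !IntZ|exact: L1rZ|exact: L1rZ].
- by move=> tau; apply: measurable_funD; apply: measurable_funM.
- by apply: measurable_funD; apply: measurable_funM.
- by move=> tau x; apply: prod_le.
- move=> tau x; rewrite /a /b /kQ /kP; have D1 := sqD_gt0 (x - t) y0; have D2 := sqD_gt0 (tau - t) y0.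
  by field; rewrite !gt_eqF.
- move=> tau; rewrite /q /p /conv -!IntZ// -IntD; [|exact: L1rZ|exact: L1rZ].
  by apply: eq_Int => x; rewrite -/(a x) -/(b x); ring.
Qed.

End identity.

(** A limit [y -> 0] in the two identities, at common Lebesgue points of [f] and [Sq * G], where the
    Poisson terms converge. The imaginary part comes first: solved for [conv (kQ y) f t], it shows
    that this converges to [G t], which identifies the L^1 limit with the principal value. The real
    part then gives the transform of [Sq * G]. *)
Lemma hilbert_inversion f : Zyg f -> exists G, [/\ measurable_fun setT G, supp G, L1r G &
  {ae mu, forall t, -1 < t < 1 ->
     conv (kT e) f t @[e --> 0^'+] --> G t /\
     conv (kT e) (fun x => Sq x * G x) t @[e --> 0^'+] -->
       pi * Int f - pi * Sq t * (pi * f t)}].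
Proof.
move=> Zf; have [G [mG sG LG cG]] := hilbert_L1 Zf; exists G; split => //.
have Lf := Zyg_L1 Zf; have [_ sf _] := Zf.
pose h x := Sq x * G x.
have Lh : L1r h.
  rewrite /h; under eq_fun do rewrite mulrC.
  apply: (@L1rM_bounded _ _ _ 1) => //; first exact: measurable_Sq.
  by move=> x; rewrite (ger0_norm (Sq_ge0 x)) Sq_le1.
have sh : supp h by move=> x hx; rewrite /h Sq_supp// mul0r.
apply: aeS (aeI (ae_LPt Lf) (ae_LPt Lh)) => t [LPf LPh] ht.
have S0 := Sq_gt0 ht; have pi0 := @pi_gt0 R.
have PS := conv_kP_cvg (@L1r_Sq R) (@Sq_supp R) ht
  (continuous_LPt (@L1r_Sq R) (@continuous_Sq R t)).
have QS := conv_kQ_Sq_cvg ht.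
have Pf := conv_kP_cvg Lf sf ht LPf.
have Ph := conv_kP_cvg Lh sh ht LPh.
(* [al y + i be y] is [pi * z] plus the Cauchy transform of [Sq] at [z = t + i y]. It tends to
   [i pi Sq t], because the transform of [Sq] at [t] is [- (pi * t)]. This local [al] is unrelated
   to the exponent of the exponential bound. *)
pose al y := pi * t + conv (kQ y) Sq t.
pose be y := pi * y + conv (kP y) Sq t.
have ca : al y @[y --> (0:R)^'+] --> (0:R).
  have z : pi * t + - (pi * t) = 0 by rewrite subrr.
  by rewrite -[X in _ --> X]z; apply: cvgD => //; exact: cvg_cst.
have cb : be y @[y --> (0:R)^'+] --> pi * Sq t.
  rewrite -[X in _ --> X]add0r; apply: cvgD => //.
  rewrite -[X in _ --> X](mulr0 pi).
  apply: (@cvg_at_right_filter _ _ (fun y : R => pi * y) 0).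
  by apply: cvgM; [exact: cvg_cst|exact: cvg_id].
have pS : pi * Sq t != 0 by rewrite gt_eqF// mulr_gt0.
(* In the imaginary identity [conv (kQ y) f t] has coefficient [be y], which is positive for small
   [y]: its limit is [pi * Sq t]. *)
have QfG : conv (kQ y) f t @[y --> (0:R)^'+] --> G t.
  have c1 : ((conv (kP y) h t - al y * conv (kP y) f t) / be y) @[y --> (0:R)^'+] --> G t.
    have z : (pi * h t - 0 * (pi * f t)) / (pi * Sq t) = G t.
      by rewrite mul0r subr0 /h mulrA mulrC mulKf.
    rewrite -[X in _ --> X]z; apply: cvgM; last exact: cvgV.
    by apply: cvgB => //; exact: cvgM.
  apply: cvg_trans c1; apply: near_eq_cvg.
  near=> y.
  have y0 : 0 < y by near: y; exact: nbhs_right_gt.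
  have b0 : 0 < be y.
    by near: y; apply: (cvgr_gt (pi * Sq t)) => //; exact: mulr_gt0.
  rewrite (identity_im Zf mG sG LG cG t y0) -/(al y) -/(be y).
  by rewrite [X in X - _]addrC addrK mulrC mulKf// gt_eqF.
have Qh : conv (kQ y) h t @[y --> (0:R)^'+] --> pi * Int f - pi * Sq t * (pi * f t).
  have c1 : (pi * Int f + al y * conv (kQ y) f t - be y * conv (kP y) f t)
      @[y --> (0:R)^'+] --> pi * Int f - pi * Sq t * (pi * f t).
    apply: cvgB; last exact: cvgM.
    rewrite -[X in _ --> X]addr0; apply: cvgD; first exact: cvg_cst.
    by rewrite -[X in _ --> X](mul0r (G t)); exact: cvgM.
  apply: cvg_trans c1; apply: near_eq_cvg; near=> y.
  have y0 : 0 < y by near: y; exact: nbhs_right_gt.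
  by rewrite (identity_re Zf mG sG LG cG t y0).
have toT (g : R -> R) (l : R) : L1r g -> supp g -> LPt g t -> conv (kQ y) g t @[y --> (0:R)^'+] --> l ->
    conv (kT y) g t @[y --> (0:R)^'+] --> l.
  move=> Lg sg LPg cg; have c0 := conv_kQ_sub_kT Lg sg ht LPg.
  have z : l - 0 = l by rewrite subr0.
  rewrite -[X in _ --> X]z.
  rewrite (_ : (fun y => conv (kT y) g t) =
    (fun y => conv (kQ y) g t - (conv (kQ y) g t - conv (kT y) g t))); last first.
    by apply/funext => y; rewrite opprB addrC subrK.
  exact: cvgB.
by split; apply: toT.
Unshelve. all: end_near. Qed.

End cauchy_identity.

(** * Lebesgue and Borel measurability *)

Section completion.
Context {R : realType}.
Implicit Types (A D : set R) (P : R -> Prop).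
Notation mu := (@lebesgue_measure R).

Lemma leb_measurable A : measurable (A : set (measurableTypeR R)) ->
  measurable (A : set (lebesgueTypeR R)).
Proof.
by move=> mA; apply: sub_caratheodory; exact: mA.
Qed.

Lemma lebE A : leb (A : set (lebesgueTypeR R)) = mu A.
Proof. by []. Qed.

Lemma leb_measurableP A : measurable (A : set (lebesgueTypeR R)) ->
  exists B N : set (measurableTypeR R), [/\ measurable B, mu.-negligible N & A = B `|` N].
Proof.
move=> mA; have : completed_algebra_gen mu A.
  by rewrite -g_sigma_completed_algebra_genE completed_caratheodory_measurable.
by move=> [B mB [N nN BN]]; exists B, N.
Qed.

Lemma leb_negligible A : leb.-negligible (A : set (lebesgueTypeR R)) <->
  mu.-negligible (A : set (measurableTypeR R)).
Proof.
split=> -[E [mE E0 AE]]; last first.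
  by exists E; split => //; exact: leb_measurable.
have [B [N [mB [M [mM M0 NM]] EBN]]] := leb_measurableP mE.
exists (B `|` M); split; first exact: measurableU.
- apply/eqP; rewrite eq_le measure_ge0 andbT.
  have B0 : mu B = 0%E.
    apply/eqP; rewrite eq_le measure_ge0 andbT -E0 -[leb E]/(leb E) -lebE.
    apply: le_measure; rewrite ?inE//; first exact: leb_measurable.
    by rewrite EBN; exact: subsetUl.
  have := measureU2 mu mB mM.
  by rewrite [X in (_ <= X + _)%E]B0 [X in (_ <= _ + X)%E]M0 adde0.
- by apply: (subset_trans AE); rewrite EBN; exact: setUS.
Qed.

Lemma ae_leb P : {ae leb, forall x : lebesgueTypeR R, P x} <-> {ae mu, forall x, P x}.
Proof. exact: leb_negligible. Qed.

Lemma leb_measurable_fun (d : measure_display) (T : measurableType d) D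
    (F : R -> T) : measurable (D : set (measurableTypeR R)) ->
  @measurable_fun _ _ (measurableTypeR R) T D F ->
  @measurable_fun _ _ (lebesgueTypeR R) T D F.
Proof.
move=> mD mF _ B mB; apply: leb_measurable.
exact: mF.
Qed.

(** [mu] is the image of [leb] under the identity, seen as a map from the Lebesgue to the Borel
    structure. The change of variables is for nonnegative functions, hence the positive and negative
    parts. *)
Lemma integral_leb D (F : R -> \bar R) : measurable (D : set (measurableTypeR R)) ->
  @measurable_fun _ _ (measurableTypeR R) _ D F ->
  (\int[leb]_(x in (D : set (lebesgueTypeR R))) F x = \int[mu]_(x in D) F x)%E.
Proof.
move=> mD.
pose phi : lebesgueTypeR R -> measurableTypeR R := id.
have mphi : measurable_fun setT phi.
  by move=> _ B mB; rewrite setTI; exact: leb_measurable.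
have key (g : R -> \bar R) : @measurable_fun _ _ (measurableTypeR R) _ D g ->
    (forall x, 0 <= g x)%E ->
    (\int[leb]_(x in (D : set (lebesgueTypeR R))) g x = \int[mu]_(x in D) g x)%E.
  move=> mg g0.
  have <- : (\int[pushforward leb phi]_(x in D) g x = \int[mu]_(x in D) g x)%E.
    exact: eq_measure_integral.
  by rewrite (ge0_integral_pushforward mphi).
move=> mF; rewrite integralE [RHS]integralE; congr (_ - _)%E.
  by apply: key => //; exact: measurable_funepos.
by apply: key => //; exact: measurable_funeneg.
Qed.

Lemma leb_ae_measurable (D : set (lebesgueTypeR R)) (f g : lebesgueTypeR R -> R) :
  measurable D -> measurable_fun D g ->
  {ae leb, forall x, D x -> f x = g x} -> measurable_fun D f.
Proof.
move=> mD mg [N [mN N0 sN]] _ B mB.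
have nm (X : set (lebesgueTypeR R)) : X `<=` N -> measurable X.
  move=> XN; apply: completed_lebesgue_measure_is_complete.
  by exists N.
rewrite (_ : D `&` f @^-1` B =
  (D `&` g @^-1` B) `\` N `|` (D `&` f @^-1` B) `&` N); last first.
  apply/seteqP; split => x /=.
    move=> [Dx Bx]; have [Nx|Nx] := pselect (N x); first by right.
    left; split => //; split => //; rewrite -(_ : f x = g x)//.
    by apply: contrapT => h; apply: Nx; apply: sN => /(_ Dx).
  move=> [[[Dx Bx] Nx]|[]//]; split => //.
  rewrite (_ : f x = g x)//.
  by apply: contrapT => h; apply: Nx; apply: sN => /(_ Dx).
apply: measurableU; last exact: nm (@subIsetr _ _ _).
by apply: measurableD => //; exact: mg.
Qed.

Lemma leb_ae_le (A B : set (lebesgueTypeR R)) : measurable A -> measurable B ->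
  {ae leb, forall x, A x -> B x} -> (leb A <= leb B)%E.
Proof.
move=> mA mB [Z [mZ Z0 sZ]].
apply: (@le_trans _ _ (leb (B `|` Z))).
  apply: le_measure; rewrite ?inE//; first exact: measurableU.
  move=> x Ax; have [Bx|Bx] := pselect (B x); [by left|right].
  by apply: sZ => /(_ Ax).
by apply: (le_trans (measureU2 leb mB mZ)); rewrite [X in (_ + X)%E]Z0 adde0.
Qed.

(** Each superlevel set at a rational level is a Borel set up to a negligible one. These are
    countably many, so a single Borel null set [Z] contains all the exceptions, and setting [f] to
    zero off [D] and on [Z] makes it Borel. *)
Lemma leb_ae_borel D (f : lebesgueTypeR R -> R) :
  measurable (D : set (measurableTypeR R)) ->
  measurable_fun (D : set (lebesgueTypeR R)) f ->
  exists F : R -> R, [/\ @measurable_fun _ _ (measurableTypeR R) _ setT F,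
    forall x, ~ D x -> F x = 0 & {ae leb, forall x, D x -> f x = F x}].
Proof.
move=> mD mf.
(* An enumeration of the rationals; numbers that code none are sent to zero. *)
pose r (n : nat) : R := ratr (odflt (0 : rat) (unpickle n)).
have rP x y : x < y -> exists n, x < r n < y.
  move=> /rat_in_itvoo[q]; rewrite in_itv/= => qxy.
  by exists (pickle q); rewrite /r pickleK.
pose E n : set (lebesgueTypeR R) := D `&` f @^-1` `]r n, +oo[.
have mE n : measurable (E n) by apply: mf; [exact: leb_measurable|].
have /choice[B /choice[N hBN]] n : exists B N : set (measurableTypeR R),
    [/\ measurable B, mu.-negligible N & E n = B `|` N].
  exact: leb_measurableP.
have [Z [mZ Z0 NZ]] : mu.-negligible (\bigcup_n N n).
  by apply: negligible_bigcup => n; have [] := hBN n.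
have EZ n : E n `\` Z = B n `\` Z.
  have [_ _ ->] := hBN n; apply/seteqP; split => x [/= h Zx]; split => //; last by left.
  by case: h => // Nx; exfalso; apply/Zx/NZ; exists n.
exists (fun x => \1_(D `\` Z) x * f x); split.
- apply: (measurability _ (@RGenOInfty.measurableE R)) => _ [_ [a ->] <-].
  rewrite setTI.
  (* The new function is zero off [D] minus [Z], so the complement of that set belongs to a
     superlevel set exactly when the level is negative. *)
  rewrite (_ : _ @^-1` _ = \bigcup_n (if a <= r n then
      (B n `\` Z) `|` (if r n < 0 then ~` (D `\` Z) else set0) else set0)).
    apply: bigcupT_measurable => n; case: ifP => // _.
    have [mB _ _] := hBN n.
    apply: measurableU; first exact: measurableD.
    by case: ifP => // _; apply: measurableC; exact: measurableD.
  apply/seteqP; split => x /=; rewrite in_itv/= andbT.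
    move=> /rP[n /andP[arn rnx]]; exists n => //; rewrite (ltW arn).
    move: rnx; rewrite indicE; have [DZx|DZx] := pselect ((D `\` Z) x).
      rewrite mem_set// mul1r => rnx; left; rewrite -EZ; case: DZx => Dx Zx.
      by split => //; split => //=; rewrite in_itv/= rnx.
    by rewrite memNset// mul0r => ->; right.
  move=> [n _]; case: ifPn => // arn [|].
    rewrite -EZ => -[[/= Dx]]; rewrite in_itv/= andbT => rnx Zx.
    by rewrite indicE mem_set ?mul1r; [exact: le_lt_trans rnx|].
  case: ifPn => // rn0 DZx.
  by rewrite indicE memNset// mul0r; exact: le_lt_trans rn0.
- by move=> x Dx; rewrite indicE memNset ?mul0r// => -[].
- apply/ae_leb; exists Z; split => // x /= /not_implyP[Dx fx].
  apply: contrapT => Zx; apply: fx.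
  by rewrite indicE mem_set ?mul1r.
Qed.

End completion.

(** * Decreasing rearrangement *)

Section equimeasurable.
Context {R : realType}.
Notation mu := (@lebesgue_measure R).
Implicit Types N M h : R -> R.

Lemma measurable_gt N (l : R) : measurable_fun setT N -> measurable [set x | l < N x].
Proof.
move=> mN; rewrite [X in measurable X](_ : _ = setT `&` N @^-1` `]l, +oo[%classic).
  exact: mN.
by apply/seteqP; split => x /=; rewrite in_itv/= andbT; [split|case].
Qed.

(** Both integrals are integrals of [h] against an image measure on the positive reals, and the two
    measures agree on the rays, which form a generating family closed under intersection. The
    restriction to positive values, harmless as [h 0 = 0], makes the measures finite: [N] and [M]
    may vanish on a set of infinite measure. *)
Lemma equimeasurable_integral N M h : measurable_fun setT N -> measurable_fun setT M ->
  measurable_fun setT h -> (forall x, 0 <= N x) -> (forall x, 0 <= M x) ->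
  (forall v : R, 0 <= v -> 0 <= h v) -> h 0 = 0 ->
  (forall l : R, 0 <= l -> mu [set x | l < N x] = mu [set x | l < M x]) ->
  (mu [set x | (0 < N x)%R] < +oo)%E ->
  (\int[mu]_x (h (N x))%:E = \int[mu]_x (h (M x))%:E)%E.
Proof.
move=> mN mM mh N0 M0 h0 h00 NM fin.
pose D : set R := `]0, +oo[%classic.
have mD : measurable D by exact: measurable_itv.
have key (F : R -> R) : measurable_fun setT F -> (forall x, 0 <= F x) ->
    (\int[mu]_x (h (F x))%:E = \int[pushforward mu F]_(x in D) (h x)%:E)%E.
  move=> mF F0; transitivity (\int[mu]_(x in F @^-1` D) (h (F x))%:E)%E; last first.
    apply/esym; apply: (@ge0_integral_pushforward _ _ (measurableTypeR R)) => //.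
      by apply: measurable_funTS; exact: EFin_meas.
    by move=> y /set_mem; rewrite /D/= in_itv/= andbT lee_fin => /ltW; exact: h0.
  rewrite [RHS]integral_mkcond; apply: eq_integral => x _.
  rewrite patchE; case: ifPn => //; rewrite notin_setE /D/= in_itv/= andbT => /negP.
  by rewrite -leNgt => Fx; rewrite (_ : F x = 0) ?h00//; apply/eqP; rewrite eq_le Fx F0.
rewrite (key N)// (key M)//; apply: eq_measure_integral => A mA AD.
pose m1 : {measure set R -> \bar R} := measure_function_pushforward__canonical__measure_function_Measure mu mN.
pose m2 : {measure set R -> \bar R} := measure_function_pushforward__canonical__measure_function_Measure mu mM.
have ray (F : R -> R) (l : R) : F @^-1` (`]l, +oo[%classic `&` D) = [set x | Num.max l 0 < F x].
  apply/seteqP; split => x; rewrite /D/= !in_itv/= !andbT gt_max.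
    by move=> [-> ->].
  by move=> /andP[-> ->].
suff : mrestr m1 mD A = mrestr m2 mD A by rewrite /mrestr/= setIidl.
pose n1 : {measure set R -> \bar R} := mrestr m1 mD.
pose n2 : {measure set R -> \bar R} := mrestr m2 mD.
rewrite -[LHS]/(n1 A) -[RHS]/(n2 A).
pose G : set (set R) := [set `]l, +oo[%classic | l in setT].
pose g (n : nat) : set R := `](- n%:R), +oo[%classic.
apply: (measure_unique G g) => //.
- rewrite -[LHS]/(@measurable _ (measurableTypeR R)) RGenOInfty.measurableE; congr (<<s _ >>).
  by apply/seteqP; split => X [l]; [move=> ->; exists l|move=> _ <-; exists l].
- move=> _ _ [a _ <-] [b _ <-]; exists (Num.max a b) => //.
  apply/seteqP; split => x /=; rewrite !in_itv/= !andbT gt_max.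
    by move=> /andP[-> ->].
  by move=> [-> ->].
- by move=> i; exists (- i%:R).
- rewrite -subTset => x _; exists (Num.truncn `|x|).+1 => //=.
  rewrite /g/= in_itv/= andbT ltrNl; apply: (le_lt_trans (ler_norm _)).
  by rewrite normrN; exact: truncnS_gt.
- move=> _ [l _ <-]; rewrite /n1 /n2/= /mrestr /m1 /m2/= /pushforward !ray.
  by apply: NM; rewrite le_max lexx orbT.
- move=> k; rewrite /n1/= /mrestr /m1/= /pushforward ray; apply: le_lt_trans fin.
  apply: le_measure; rewrite ?inE; try exact: measurable_gt.
  by move=> x /=; rewrite gt_max => /andP[].
Qed.

End equimeasurable.

Section rearrangement.
Context {R : realType}.
Notation mu := (@lebesgue_measure R).
Variable N : R -> R.
Hypotheses (mN : measurable_fun setT N) (N0 : forall x, 0 <= N x) (sN : supp N).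

Let nu (l : R) : \bar R := mu [set x | l < N x].

Definition rearr (t : R) : \bar R :=
  ereal_inf [set l%:E | l in [set l : R | 0 <= l /\ (nu l <= t%:E)%E]].

Lemma nu_le2 (l : R) : 0 <= l -> (nu l <= 2%:E)%E.
Proof.
move=> l0; have -> : (2:R)%:E = mu `]-1, 1[%classic.
  rewrite lebesgue_measure_itv/= lte_fin ifT; last lra.
  by rewrite -EFinB; congr EFin; lra.
apply: le_measure; rewrite ?inE; [exact: measurable_gt|exact: measurable_itv|].
move=> x /= h; rewrite in_itv/=; apply: contraPT h => /sN ->.
by apply/negP; rewrite -leNgt.
Qed.

Let nu_anti (a b : R) : a <= b -> (nu b <= nu a)%E.
Proof.
move=> ab; apply: le_measure; rewrite ?inE; try exact: measurable_gt.
by move=> x /=; exact: le_lt_trans.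
Qed.

(** Continuity of the measure from below makes the distribution function right-continuous, so
    [t < nu l] persists slightly above [l]; this is what strictness of the inequality on the left
    requires. *)
Lemma lt_rearr (l t : R) : 0 <= l -> ((l%:E < rearr t)%E <-> (t%:E < nu l)%E).
Proof.
move=> l0; split => h.
  rewrite ltNge; apply/negP => nt; move: h; rewrite ltNge => /negP; apply.
  by apply: ereal_inf_lbound; exists l.
have [n hn] : exists n : nat, (t%:E < nu (l + n.+1%:R^-1))%E.
  apply: contrapT => /forallNP hn; move: h; rewrite ltNge => /negP; apply.
  pose F (n : nat) := [set x | l + n.+1%:R^-1 < N x].
  have FU : \bigcup_n F n = [set x | l < N x].
    apply/seteqP; split => [x [n _]|x]; rewrite /F/=.
      by apply: le_lt_trans; rewrite lerDl invr_ge0.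
    rewrite -subr_gt0 => /ltr_add_invr[n]; rewrite add0r => hk; exists n => //=.
    by rewrite -ltrBrDl.
  have mF n : measurable (F n) by exact: measurable_gt.
  have cF : mu \o F @ \oo --> mu (\bigcup_n F n).
    apply: nondecreasing_cvg_mu => //; first exact: bigcupT_measurable.
    move=> m n mn; apply/subsetPset => x /=; apply: le_lt_trans.
    by rewrite lerD2l lef_pV2 ?posrE// ler_nat.
  rewrite /nu -FU -(cvg_lim _ cF)//; apply: lime_le; first exact: cvgP cF.
  by apply: nearW => n; rewrite leNgt; apply/negP; exact: hn.
apply: (@lt_le_trans _ _ (l + n.+1%:R^-1)%:E).
  by rewrite lte_fin ltrDl invr_gt0.
apply: le_ereal_inf_tmp => _ [k [k0 nk] <-]; rewrite lee_fin leNgt; apply/negP => kl.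
move: hn; rewrite ltNge => /negP; apply; apply: le_trans nk.
exact/nu_anti/ltW.
Qed.

Lemma rearr_ge0 t : (0 <= rearr t)%E.
Proof. by apply: le_ereal_inf_tmp => _ [k [k0 nk] <-]. Qed.

Lemma rearr_fin (t : R) : 0 < t -> rearr t \is a fin_num.
Proof.
move=> t0; rewrite ge0_fin_numE ?rearr_ge0//.
have [n hn] : exists n : nat, (nu n%:R <= t%:E)%E.
  apply: contrapT => /forallNP hn; move: t0; apply/negP; rewrite -leNgt.
  pose F (n : nat) := [set x | n%:R < N x].
  have FI : \bigcap_n F n = set0.
    rewrite -subset0 => x Fx; have := Fx (Num.truncn (N x)).+1 I.
    by rewrite /F/= ltNge ltW// truncnS_gt.
  have mF n : measurable (F n) by exact: measurable_gt.
  have cF : mu \o F @ \oo --> mu (\bigcap_n F n).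
    apply: nonincreasing_cvg_mu => //; first by apply: le_lt_trans (nu_le2 _) _; rewrite ?ltry.
      by rewrite FI.
    move=> m n mn; apply/subsetPset => x /=; apply: le_lt_trans.
    by rewrite ler_nat.
  suff : (t%:E <= mu (\bigcap_n F n))%E by rewrite FI measure0 lee_fin.
  rewrite -(cvg_lim _ cF)//; apply: lime_ge; first exact: cvgP cF.
  by apply: nearW => n; apply: ltW; rewrite ltNge; apply/negP; exact: hn.
by apply: le_lt_trans (ltry n%:R); apply: ereal_inf_lbound; exists n%:R => //; split.
Qed.

(** A real function on the whole line: the rearrangement is finite for [0 < t], may be infinite at
    zero, and only [0 < t < 2] matters. The value zero elsewhere makes it equimeasurable with [N] at
    all levels [l >= 0]. *)
Definition rearrR (t : R) : R := if 0 < t < 2 then fine (rearr t) else 0.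

Lemma rearrRE (t : R) : 0 < t < 2 -> (rearrR t)%:E = rearr t.
Proof. by move=> /[dup] ht /andP[t0 _]; rewrite /rearrR ht fineK// rearr_fin. Qed.

Lemma rearrR_ge0 t : 0 <= rearrR t.
Proof. by rewrite /rearrR; case: ifP => // _; rewrite fine_ge0// rearr_ge0. Qed.

Lemma rearrR_gt (l : R) : 0 <= l -> [set t | l < rearrR t] = `]0, fine (nu l)[%classic.
Proof.
move=> l0.
have nf : nu l \is a fin_num.
  by rewrite ge0_fin_numE ?measure_ge0//; apply: (le_lt_trans (nu_le2 l0)); rewrite ltry.
have n2 : fine (nu l) <= 2 by rewrite -lee_fin fineK// nu_le2.
apply/seteqP; split => t /=; rewrite in_itv/=.
  move=> h; have ht : 0 < t < 2.
    by apply: contraPT h => /negPf; rewrite /rearrR => ->; apply/negP; rewrite -leNgt.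
  move: h; rewrite -lte_fin rearrRE// => /(lt_rearr _ l0).
  by rewrite -{1}(fineK nf) lte_fin => ->; case/andP: ht => ->.
move=> /andP[t0 tn]; rewrite -lte_fin rearrRE; last by rewrite t0 (lt_le_trans tn).
by apply/(lt_rearr _ l0); rewrite -(fineK nf) lte_fin.
Qed.

Lemma rearrR_equi (l : R) : 0 <= l -> mu [set x | l < N x] = mu [set t | l < rearrR t].
Proof.
move=> l0; rewrite rearrR_gt// lebesgue_measure_itv/= lte_fin.
have nf : nu l \is a fin_num.
  by rewrite ge0_fin_numE ?measure_ge0//; apply: (le_lt_trans (nu_le2 l0)); rewrite ltry.
case: ifPn; first by rewrite oppr0 adde0 fineK.
rewrite -leNgt => h; apply/eqP; rewrite eq_le measure_ge0 andbT -/(nu l) -(fineK nf).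
by rewrite lee_fin.
Qed.

Lemma measurable_rearrR : measurable_fun setT rearrR.
Proof.
apply: (measurability _ (@RGenOInfty.measurableE R)) => _ [_ [a ->] <-].
rewrite setTI.
have -> : rearrR @^-1` `]a, +oo[%classic = [set t | a < rearrR t].
  by apply/seteqP; split => t /=; rewrite in_itv/= andbT.
have [a0|a0] := leP 0 a; first by rewrite rearrR_gt//; exact: measurable_itv.
rewrite (_ : [set t | _] = setT); first exact: measurableT.
by rewrite -subTset => t _ /=; exact: lt_le_trans (rearrR_ge0 t).
Qed.

Lemma rearrR_anti (s t : R) : 0 < s -> s <= t -> rearrR t <= rearrR s.
Proof.
move=> s0 st; have [ht|ht] := boolP (0 < t < 2); last first.
  by rewrite {1}/rearrR (negPf ht) rearrR_ge0.
have hs : 0 < s < 2 by rewrite s0; case/andP: ht => _; exact: le_lt_trans.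
rewrite -lee_fin !rearrRE//; apply: ereal_inf_le_tmp => _ [k [k0 nk] <-].
by exists k => //; split => //; apply: (le_trans nk); rewrite lee_fin.
Qed.

End rearrangement.

(** * The rearrangement norm compared with the Young function *)

Section rearrangement_Zygmund.
Context {R : realType}.
Notation mu := (@lebesgue_measure R).

Lemma L1r_ge0P (f : R -> R) : measurable_fun setT f -> (forall x, 0 <= f x) ->
  L1r f <-> (\int[mu]_x (f x)%:E < +oo)%E.
Proof.
move=> mf f0.
have e : (\int[mu]_x `|(EFin \o f) x| = \int[mu]_x (f x)%:E)%E.
  by apply: eq_integral => x _ /=; rewrite ger0_norm.
split=> [/integrableP[_]|h]; first by rewrite e.
by apply/integrableP; split; [exact: EFin_meas|rewrite e].
Qed.

Let ell (t : R) : R := ln (2 * expR 1 / t).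

Let e2 : (2 : R) <= expR 1.
Proof. by rewrite (le_trans _ (expR_ge1Dx _))//; lra. Qed.

Let ell_ge1 (t : R) : 0 < t < 2 -> 1 <= ell t.
Proof.
move=> /andP[t0 t2]; rewrite -[leLHS](@expRK R) ler_ln ?posrE ?expR_gt0 ?divr_gt0 ?mulr_gt0 ?expR_gt0//.
by rewrite ler_pdivlMr// mulrC ler_wpM2r ?expR_ge0// (ltW t2).
Qed.

Let measurable_ell : measurable_fun setT ell.
Proof.
apply: (measurableT_comp (@measurable_ln R)); apply: measurable_funM => //.
exact: measurable_inv.
Qed.

Lemma invsqrt_int (r : R) : 0 < r ->
  mu.-integrable `]0, r[ (EFin \o (fun t => (Num.sqrt t)^-1)).
Proof.
move=> r0; have := @FTC_oo _ (fun t : R => 2 * Num.sqrt t) (fun t => (Num.sqrt t)^-1) 0 r 0 (2 * Num.sqrt r) r0.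
case=> //.
- move=> x /andP[x0 _]; have s0 : 0 < Num.sqrt x by rewrite sqrtr_gt0.
  have d := is_derive1_sqrt x0.
  by apply: is_derive_eq; rewrite /GRing.scale/=; field; rewrite gt_eqF.
- move=> x /andP[x0 _]; apply: continuousV; first by rewrite gt_eqF// sqrtr_gt0.
  exact: sqrt_continuous.
- have z : 2 * Num.sqrt (0:R) = 0 by rewrite sqrtr0 mulr0.
  rewrite -[X in _ --> X]z; apply: cvgM; first exact: cvg_cst.
  by apply: cvg_at_right_filter; exact: sqrt_continuous.
- apply: cvgM; first exact: cvg_cst.
  by apply: cvg_at_left_filter; exact: sqrt_continuous.
Qed.

Variable N : R -> R.
Hypotheses (mN : measurable_fun setT N) (N0 : forall x, 0 <= N x) (sN : supp N).

Let M := rearrR N.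
Let M0 := rearrR_ge0 N.
Let mM : measurable_fun setT M := measurable_rearrR mN sN.

Let M_out t : ~~ (0 < t < 2) -> M t = 0.
Proof. by rewrite /M /rearrR => /negPf ->. Qed.

Let Mell_ge0 t : 0 <= M t * ell t.
Proof.
have [ht|/M_out ->] := boolP (0 < t < 2); last by rewrite mul0r.
by rewrite mulr_ge0 ?M0// (le_trans _ (ell_ge1 ht)).
Qed.

Let mMell : measurable_fun setT (fun t => M t * ell t).
Proof. exact: measurable_funM. Qed.

Let integral_Mell : (\int[mu]_(t in `]0%R, 2%R[) (rearr N t * (ell t)%:E) =
  \int[mu]_t (M t * ell t)%:E)%E.
Proof.
rewrite integral_mkcond; apply: eq_integral => t _; rewrite patchE.
case: ifPn; first by rewrite inE/= in_itv/= => ht; rewrite EFinM -rearrRE.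
by rewrite notin_setE/= in_itv/= => /negP h; rewrite M_out ?mul0r.
Qed.

Lemma measurable_rearr_ln :
  measurable_fun (`]0, 2[%classic : set R) (fun t => rearr N t * (ln (2 * expR 1 / t))%:E)%E.
Proof.
apply: (@eq_measurable_fun _ _ _ _ _ (fun t => (M t * ell t)%:E)).
  by move=> t; rewrite inE/= in_itv/= => ht; rewrite EFinM -rearrRE.
by apply: measurable_funTS; exact: EFin_meas.
Qed.

Let L1r_PhiM : L1r (fun x => Phi (N x)) <-> L1r (fun t => Phi (M t)).
Proof.
rewrite !L1r_ge0P; last 4 first.
- exact: (measurableT_comp (@measurable_Phi R)).
- by move=> t; exact/Phi_ge0/M0.
- exact: (measurableT_comp (@measurable_Phi R)).
- by move=> t; exact: Phi_ge0.
rewrite (@equimeasurable_integral _ N M Phi)//.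
- exact: measurable_Phi.
- by move=> v; exact: Phi_ge0.
- exact: Phi0.
- by move=> l l0; exact: rearrR_equi.
- by apply: (le_lt_trans (nu_le2 mN sN (lexx 0))); rewrite ltry.
Qed.

(** By equimeasurability [N] may be replaced by its rearrangement [M]. If [M * ell] has integral
    [I], monotonicity of [M] on [[t / 2, t]] gives [t * M t <= 2 * I], so [ln (1 + M t)] is at most
    [ell t] plus a constant. Conversely, Young's inequality is applied to [M t] and half of [ell t]:
    halving turns the exponential into [sqrt (2 e / t)], which is integrable at zero, whereas
    [2 e / t] is not. *)
Lemma rearr_Phi :
  (\int[mu]_(t in `]0%R, 2%R[) (rearr N t * (ln (2 * expR 1 / t))%:E) < +oo)%E <->
  L1r (fun x => Phi (N x)).
Proof.
rewrite integral_Mell -L1r_ge0P// L1r_PhiM; split=> L.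
  pose I := Int (fun t => M t * ell t).
  have I0 : 0 <= I by exact: Int_ge0.
  have tM t : 0 < t < 2 -> t * M t <= 2 * I.
    move=> /andP[t0 t2].
    have h : Int (fun s => \1_`[t / 2, t] s * M t) <= I.
      apply: Int_le => //; first exact: L1r_itv_cst.
      move=> s; rewrite indicE; case: (boolP (s \in _)) => [|_]; last by rewrite mul0r.
      rewrite inE/= in_itv/= mul1r => /andP[ts st].
      have s0 : 0 < s by rewrite (lt_le_trans _ ts)// divr_gt0.
      have l1 : 1 <= ell s by apply: ell_ge1; rewrite s0 (le_lt_trans st).
      rewrite (le_trans (rearrR_anti mN sN s0 st))// -[leLHS]mulr1.
      by rewrite ler_wpM2l// M0.
    move: h; rewrite Int_itv Rint_cst_cc; last lra.
    lra.
  apply: (@L1r_le _ _ (fun t => (1 + ln (1 + 2 * I)) * (M t * ell t))).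
  - exact: (measurableT_comp (@measurable_Phi R)).
  - exact: L1rZ.
  move=> t; rewrite ger0_norm ?Phi_ge0 ?M0//.
  have [ht|/M_out ->] := boolP (0 < t < 2); last by rewrite Phi0 mul0r mulr0.
  have := tM _ ht; have l1 := ell_ge1 ht; case/andP: ht => t0 t2 tMt.
  rewrite /Phi mulrCA ler_wpM2l ?M0//.
  have lI : 0 <= ln (1 + 2 * I) by apply: ln_ge0; rewrite lerDl mulr_ge0.
  have : ln (1 + M t) <= ell t + ln (1 + 2 * I).
    have p1 : 0 < 2 * expR 1 / t by rewrite divr_gt0// mulr_gt0// expR_gt0.
    have p2 : 0 < 1 + 2 * I by rewrite ltr_pwDl// mulr_ge0.
    rewrite /ell -lnM ?posrE// ler_ln ?posrE ?(mulr_gt0 p1 p2) ?ltr_pwDl ?M0//.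
    rewrite mulrAC ler_pdivlMr//.
    have e1 := e2; have m := M0 t; nra.
  by move=> h; apply: (le_trans h); nra.
pose J (t : R) : R := \1_`]0, 2[%classic t * (Num.sqrt t)^-1.
have LJ : L1r J by apply: L1r_itv_mul; exact: invsqrt_int.
pose c : R := Num.sqrt (2 * expR 1).
apply: (@L1r_le _ _ (fun t => 2 * Phi (M t) + 2 * c * J t)) => //.
  by apply: L1rD; exact: L1rZ.
move=> t; rewrite ger0_norm//.
have J0 : 0 <= J t by rewrite mulr_ge0 ?indic_ge0// invr_ge0 sqrtr_ge0.
have [ht|/M_out ->] := boolP (0 < t < 2); last first.
  by rewrite mul0r Phi0 mulr0 add0r mulr_ge0// mulr_ge0// sqrtr_ge0.
have l1 := ell_ge1 ht.
have l2 : 0 <= ell t / 2 by rewrite divr_ge0// (le_trans _ l1).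
have := @young R (M t) _ (M0 t) l2.
have -> : expR (ell t / 2) = c * J t.
  rewrite /J indicE mem_set ?mul1r//; case/andP: ht => t0 t2.
  have p : 0 < 2 * expR 1 / t by rewrite divr_gt0// mulr_gt0// expR_gt0.
  apply/eqP; rewrite -(@eqrXn2 _ 2)// ?expR_ge0 ?mulr_ge0 ?invr_ge0 ?sqrtr_ge0//.
  rewrite -expRM_natl /= mulrC divfK//.
  rewrite lnK ?posrE// exprMn exprVn !sqr_sqrtr// ?(ltW t0)// ?mulr_ge0 ?expR_ge0//.
lra.
Qed.

End rearrangement_Zygmund.

(** * The weight belongs to the Zygmund class *)

Section Zyg_wt.
Context {R : realType}.
Notation mu := (@lebesgue_measure R).

(** [q a] is [a] to the power -3/4, with primitive four times the fourth root; in these terms [wt]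
    to the power 3/2 is [q (1 + x) * q (1 - x)]. *)
Let q (a : R) : R := (Num.sqrt a * Num.sqrt (Num.sqrt a))^-1.

Let q_ge0 a : 0 <= q a.
Proof. by rewrite invr_ge0 mulr_ge0// sqrtr_ge0. Qed.

Let q_le1 a : 1 <= a -> q a <= 1.
Proof.
move=> a1; have s1 : 1 <= Num.sqrt a by rewrite -[leLHS]sqrtr1 ler_wsqrtr.
have ss1 : 1 <= Num.sqrt (Num.sqrt a) by rewrite -[leLHS]sqrtr1 ler_wsqrtr.
by rewrite invf_le1 ?mulr_ege1// mulr_gt0// (lt_le_trans ltr01).
Qed.

Let is_derive_q (a : R) : 0 < a ->
  is_derive a (1:R) (fun y => 4 * Num.sqrt (Num.sqrt y)) (q a).
Proof.
move=> a0; have s0 : 0 < Num.sqrt a by rewrite sqrtr_gt0.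
have ss0 : 0 < Num.sqrt (Num.sqrt a) by rewrite sqrtr_gt0.
have d := is_derive1_sqrt a0; have d' := is_derive1_sqrt s0.
have dd := is_derive1_comp d' d.
apply: is_derive_eq; rewrite /GRing.scale/= /q; field.
by rewrite !gt_eqF.
Qed.

Let continuous_sqrt2 : continuous (fun y : R => 4 * Num.sqrt (Num.sqrt y)).
Proof.
move=> x; apply: cvgM; first exact: cvg_cst.
exact: (continuous_comp (@sqrt_continuous R x) (@sqrt_continuous R _)).
Qed.

Let continuous_q (a : R) : 0 < a -> {for a, continuous q}.
Proof.
move=> a0; apply: continuousV.
  by rewrite gt_eqF// mulr_gt0 ?sqrtr_gt0// sqrtr_gt0.
apply: cvgM; first exact: sqrt_continuous.
exact: (continuous_comp (@sqrt_continuous R a) (@sqrt_continuous R _)).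
Qed.

Let q_left : L1r (fun x => \1_`]-1, 1[%classic x * q (1 + x)).
Proof.
apply: L1r_itv_mul.
have h11 : (-1 : R) < 1 by lra.
pose F (x : R) := 4 * Num.sqrt (Num.sqrt (1 + x)).
have cF : continuous F.
  move=> x; apply: (@continuous_comp _ _ _ (fun x : R => 1 + x) (fun y => 4 * Num.sqrt (Num.sqrt y))).
    by apply: cvgD; [exact: cvg_cst|exact: cvg_id].
  exact: continuous_sqrt2.
have [] // := @FTC_oo _ F (fun x => q (1 + x)) (-1) 1 (F (-1)) (F 1) h11.
- move=> x /andP[x0 _]; have a0 : 0 < 1 + x by lra.
  have d := is_derive_q a0.
  have d1 : is_derive x (1:R) (fun x : R => 1 + x) 1.
    by apply: is_derive_eq; ring.
  by have := is_derive1_comp d d1; rewrite mulr1.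
- move=> x /andP[x0 _]; apply: (@continuous_comp _ _ _ (fun x : R => 1 + x) q).
    by apply: cvgD; [exact: cvg_cst|exact: cvg_id].
  by apply: continuous_q; lra.
- by apply: cvg_at_right_filter; exact: cF.
- by apply: cvg_at_left_filter; exact: cF.
Qed.

Let q_right : L1r (fun x => \1_`]-1, 1[%classic x * q (1 - x)).
Proof.
apply: L1r_itv_mul.
have h11 : (-1 : R) < 1 by lra.
pose F (x : R) := - (4 * Num.sqrt (Num.sqrt (1 - x))).
have cF : continuous F.
  move=> x; apply: cvgN.
  apply: (@continuous_comp _ _ _ (fun x : R => 1 - x) (fun y => 4 * Num.sqrt (Num.sqrt y))).
    by apply: cvgB; [exact: cvg_cst|exact: cvg_id].
  exact: continuous_sqrt2.
have [] // := @FTC_oo _ F (fun x => q (1 - x)) (-1) 1 (F (-1)) (F 1) h11.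
- move=> x /andP[_ x1]; have a0 : 0 < 1 - x by lra.
  have d := is_derive_q a0.
  have d1 : is_derive x (1:R) (fun x : R => 1 - x) (-1).
    by apply: is_derive_eq; ring.
  have d2 := @is_derive1_comp R _ (fun x : R => 1 - x) x _ _ d d1.
  by apply: is_derive_eq; rewrite ?mulrN1; ring.
- move=> x /andP[_ x1]; apply: (@continuous_comp _ _ _ (fun x : R => 1 - x) q).
    by apply: cvgB; [exact: cvg_cst|exact: cvg_id].
  by apply: continuous_q; lra.
- by apply: cvg_at_right_filter; exact: cF.
- by apply: cvg_at_left_filter; exact: cF.
Qed.

(** From [1 + w <= (1 + sqrt w) ^+ 2] and [ln (1 + v) <= v]. *)
Let Phi_le (w : R) : 0 <= w -> Phi w <= 2 * (w * Num.sqrt w).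
Proof.
move=> w0; rewrite /Phi mulrCA ler_wpM2l//.
have s0 := sqrtr_ge0 w; have ss := sqr_sqrtr w0.
have p : 0 < 1 + Num.sqrt w by rewrite ltr_pwDl.
apply: (@le_trans _ _ (ln ((1 + Num.sqrt w) ^+ 2))).
  by rewrite ler_ln ?posrE ?exprn_gt0// ?ltr_pwDl//; nra.
rewrite lnXn// mulr_natl ler_wMn2r//.
by apply: le_ln1Dx; exact: (lt_le_trans (ltrN10 R)).
Qed.

(** [Phi wt] is at most twice [q (1 + x) * q (1 - x)]. One of these factors is at most one,
    according to the sign of [x], so the product is bounded by the sum, and each summand has one
    integrable singularity. *)
Lemma Zyg_wt : Zyg (@wt R).
Proof.
split; [exact: measurable_wt|exact: wt_supp|].
apply: (@L1r_le _ _ (fun x => 2 * (\1_`]-1, 1[%classic x * q (1 + x) +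
  \1_`]-1, 1[%classic x * q (1 - x)))).
- by have := @measurable_Phi_abs R 1 _ (@measurable_wt R); under eq_fun do rewrite mul1r.
- by apply: L1rZ; exact: L1rD.
move=> x; rewrite (ger0_norm (Phi_ge0 (normr_ge0 _))) (ger0_norm (wt_ge0 x)).
have [hx|hx] := boolP (-1 < x < 1); last first.
  by rewrite wt_supp// Phi0 mulr_ge0// addr_ge0// mulr_ge0 ?indic_ge0.
rewrite indicE mem_set ?mul1r//; apply: (le_trans (Phi_le (wt_ge0 x))).
rewrite ler_wpM2l//; case/andP: hx => x0 x1.
have a0 : 0 < 1 + x by lra.
have b0 : 0 < 1 - x by lra.
have -> : wt x * Num.sqrt (wt x) = q (1 + x) * q (1 - x).
  rewrite /wt /Sq (_ : 1 - x ^+ 2 = (1 + x) * (1 - x)); last by ring.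
  rewrite sqrtrM ?(ltW a0)// /q sqrtrV ?mulr_ge0 ?sqrtr_ge0//.
  by rewrite sqrtrM ?sqrtr_ge0// -!invfM mulrACA.
have qa := q_ge0 (1 + x); have qb := q_ge0 (1 - x).
have [h|h] := leP 0 x.
  have := @q_le1 (1 + x); rewrite lerDl => /(_ h) h1; nra.
have := @q_le1 (1 - x); rewrite lerDl oppr_ge0 => /(_ (ltW h)) h1; nra.
Qed.

End Zyg_wt.

(** * Complex-valued functions *)

Section complex_valued.
Context {R : realType}.
Notation mu := (@lebesgue_measure R).
Implicit Types (f g : lebesgueTypeR R -> R[i]) (F G : R -> R).

Lemma hypot_ge (a b : R) : `|a| <= Num.sqrt (a ^+ 2 + b ^+ 2).
Proof. by rewrite -sqrtr_sqr ler_wsqrtr// lerDl sqr_ge0. Qed.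

Lemma hypot_le (a b : R) : Num.sqrt (a ^+ 2 + b ^+ 2) <= `|a| + `|b|.
Proof.
rewrite -(@ger0_norm _ (`|a| + `|b|)) ?addr_ge0// -sqrtr_sqr ler_wsqrtr//.
rewrite -(real_normK (num_real a)) -(real_normK (num_real b)).
have := mulr_ge0 (normr_ge0 a) (normr_ge0 b); lra.
Qed.

Lemma measurable_hypot (d : measure_display) (T : measurableType d) (D : set T)
    (F G : T -> R) : measurable_fun D F -> measurable_fun D G ->
  measurable_fun D (fun x => Num.sqrt (F x ^+ 2 + G x ^+ 2)).
Proof.
move=> mF mG; apply: (measurableT_comp (continuous_measurable_fun (@sqrt_continuous R))).
by apply: measurable_funD; apply: (measurableT_comp (exprn_measurable 2)).
Qed.

(* The components of [f] coincide a.e. on (-1,1) with Borel functions vanishing outside. *)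
Definition borel_version f F1 F2 :=
  [/\ measurable_fun setT F1, measurable_fun setT F2, supp F1, supp F2 &
    {ae mu, forall x : R, -1 < x < 1 -> f x = F1 x +i* F2 x}].

Let mI : measurable (`]-1, 1[%classic : set (measurableTypeR R)).
Proof. exact: measurable_itv. Qed.

Let leb_mI : measurable (itvm11 R).
Proof. exact: leb_measurable. Qed.

Lemma borel_versionP f : cmeasurable_fun (itvm11 R) f <-> exists F1 F2, borel_version f F1 F2.
Proof.
split.
  move=> [m1 m2].
  have [F1 [mF1 s1 a1]] := leb_ae_borel mI m1.
  have [F2 [mF2 s2 a2]] := leb_ae_borel mI m2.
  exists F1, F2; split => //.
  - by move=> x hx; apply: s1 => /=; rewrite in_itv/=; exact/negP.
  - by move=> x hx; apply: s2 => /=; rewrite in_itv/=; exact/negP.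
  - move/ae_leb : a1 => a1; move/ae_leb : a2 => a2.
    apply: aeS (aeI a1 a2) => x [h1 h2] hx.
    have hx' : `]-1, 1[%classic x by rewrite /= in_itv.
    by move: (h1 hx') (h2 hx'); case: (f x) => a b /= -> ->.
move=> [F1 [F2 [m1 m2 _ _ a]]]; split.
- apply: (@leb_ae_measurable _ _ _ F1) => //.
    by apply: leb_measurable_fun => //; exact: measurable_funTS.
  apply/ae_leb; apply: aeS a => x h /=; rewrite in_itv/= => /h.
  by move=> ->.
- apply: (@leb_ae_measurable _ _ _ F2) => //.
    by apply: leb_measurable_fun => //; exact: measurable_funTS.
  apply/ae_leb; apply: aeS a => x h /=; rewrite in_itv/= => /h.
  by move=> ->.
Qed.

Section version.
Variables (f : lebesgueTypeR R -> R[i]) (F1 F2 : R -> R).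
Hypothesis v : borel_version f F1 F2.

Let N (x : R) : R := Num.sqrt (F1 x ^+ 2 + F2 x ^+ 2).

Let N0 x : 0 <= N x. Proof. exact: sqrtr_ge0. Qed.

Let mN : measurable_fun setT N.
Proof. by have [m1 m2 _ _ _] := v; exact: measurable_hypot. Qed.

Let sN : supp N.
Proof.
by have [_ _ s1 s2 _] := v => x hx; rewrite /N s1// s2// !expr0n/= addr0 sqrtr0.
Qed.

Let cmf : cmeasurable_fun (itvm11 R) f.
Proof. by apply/borel_versionP; exists F1, F2. Qed.

Let normcfE x : Normc.normc (f x) = Num.sqrt (complex.Re (f x) ^+ 2 + complex.Im (f x) ^+ 2).
Proof. by rewrite /Normc.normc; case: (f x). Qed.

Let mnf : measurable_fun (itvm11 R) (fun x => Normc.normc (f x)).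
Proof.
rewrite (_ : (fun x => _) = (fun x => Num.sqrt (complex.Re (f x) ^+ 2 + complex.Im (f x) ^+ 2))).
  by have [m1 m2] := cmf; exact: measurable_hypot.
by apply/funext => x; exact: normcfE.
Qed.

Let ae_normc : {ae leb, forall x, itvm11 R x -> Normc.normc (f x) = N x}.
Proof.
have [_ _ _ _ a] := v; apply/ae_leb; apply: aeS a => x h /=; rewrite in_itv/= => /h.
by move=> ->.
Qed.

Lemma borel_version_L1 : L1r F1 -> L1r F2 -> L1 f.
Proof.
move=> L1' L2'; split => //.
have mNl : measurable_fun (itvm11 R) N by apply: leb_measurable_fun => //; exact: measurable_funTS.
rewrite (@ae_eq_integral _ _ _ _ (itvm11 R) (fun x => (N x)%:E)) //; first last.
- by apply/ae_leb; move/ae_leb : ae_normc; apply: aeS => x h /h ->.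
- exact/measurable_EFinP.
- exact/measurable_EFinP.
rewrite integral_leb//; last by apply/measurable_EFinP; exact: measurable_funTS.
have LN : L1r N.
  apply: (@L1r_le _ _ (fun x => `|F1 x| + `|F2 x|)) => //.
    by apply: L1rD; exact: L1r_abs.
  by move=> x; rewrite ger0_norm// hypot_le.
apply: le_lt_trans ((@L1r_ge0P _ _ mN N0).1 LN).
apply: ge0_subset_integral => //; first exact: EFin_meas.
by move=> x _; rewrite lee_fin.
Qed.

Let decr_rearrE t : decr_rearr f t = rearr N t.
Proof.
suff E (l : R) : 0 <= l ->
    leb [set x | itvm11 R x /\ l < Normc.normc (f x)] = mu [set x | l < N x].
  by congr ereal_inf; apply/seteqP; split => _ [l [l0 h] <-]; exists l => //;
    split => //; rewrite ?E// -?E.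
move=> l0.
have mB : measurable ([set x | l < N x] : set (lebesgueTypeR R)).
  by apply: leb_measurable; exact: measurable_gt.
have mA : measurable [set x | itvm11 R x /\ l < Normc.normc (f x)].
  rewrite (_ : [set x | _] = itvm11 R `&` (fun x => Normc.normc (f x)) @^-1` `]l, +oo[%classic).
    exact: mnf.
  by apply/seteqP; split => x /= [hx h]; split => //; move: h; rewrite in_itv/= andbT.
have NI x : l < N x -> itvm11 R x.
  move=> h; rewrite /= in_itv/=; apply: contraPT h => /sN ->.
  by apply/negP; rewrite -leNgt.
rewrite -lebE; apply/eqP; rewrite eq_le; apply/andP; split; apply: leb_ae_le => //.
  by apply/ae_leb; move/ae_leb : ae_normc; apply: aeS => x h [hx]; rewrite h.
apply/ae_leb; move/ae_leb : ae_normc; apply: aeS => x h lN.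
by have hx := NI _ lN; split => //; rewrite h.
Qed.

(** The modulus lies between each [|F1|], [|F2|] and their sum, and [Phi] is increasing with
    [Phi (a + b) <= Phi (2 * a) + Phi (2 * b)]; [rearr_Phi] is applied to the modulus. *)
Lemma borel_version_LlogL : LlogL f <-> Zyg F1 /\ Zyg F2.
Proof.
have [m1 m2 s1 s2 _] := v.
have LE : LlogL f <-> L1r (fun x => Phi (N x)).
  rewrite -(rearr_Phi mN N0 sN).
  rewrite /LlogL/= /LlogL_norm.
  under eq_integral do rewrite decr_rearrE.
  rewrite integral_leb//; first by split=> [[]//|].
  by apply: measurable_rearr_ln.
rewrite LE; split=> [L|[[_ _ L1'] [_ _ L2']]].
  split; split => //.
    apply: L1r_le L _; first by have := @measurable_Phi_abs R 1 _ m1; under eq_fun do rewrite mul1r.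
    by move=> x; rewrite ger0_norm ?Phi_ge0// le_Phi// hypot_ge.
  apply: L1r_le L _; first by have := @measurable_Phi_abs R 1 _ m2; under eq_fun do rewrite mul1r.
  by move=> x; rewrite ger0_norm ?Phi_ge0// le_Phi// /N addrC hypot_ge.
have Z1 : Zyg (fun x => 2 * F1 x) by apply: Zyg_Z.
have Z2 : Zyg (fun x => 2 * F2 x) by apply: Zyg_Z.
have [_ _ P1] := Z1; have [_ _ P2] := Z2.
apply: (L1r_le _ (L1rD P1 P2)); first exact: (measurableT_comp (@measurable_Phi R)).
move=> x; rewrite ger0_norm ?Phi_ge0//.
apply: (le_trans (le_Phi (N0 x) (hypot_le _ _))).
by rewrite !normrM normr_nat; exact: PhiD.
Qed.

End version.
End complex_valued.

(** * The complex finite Hilbert transform in terms of real principal values *)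

Section finite_hilbert_transform.
Context {R : realType}.
Notation mu := (@lebesgue_measure R).
Implicit Types (f g : lebesgueTypeR R -> R[i]) (F G : R -> R).

Let L1r_kT F (t e : R) : L1r F -> 0 < e -> L1r (fun x => F x * kT e (x - t)).
Proof.
move=> LF e0; apply: L1rM_bounded LF _ (fun x => kT_le (x - t) e0).
exact: measurable_sh (measurable_kT e).
Qed.

Lemma conv_kTZ F (c t e : R) : L1r F -> 0 < e ->
  conv (kT e) (fun x => c * F x) t = c * conv (kT e) F t.
Proof.
move=> LF e0; rewrite /conv -IntZ; last exact: L1r_kT.
by apply: eq_Int => x; rewrite mulrA.
Qed.

Lemma complexD (a b c d : R) : (a +i* b) + (c +i* d) = (a + c) +i* (b + d).
Proof. by []. Qed.

Lemma complexZ (a b c : R) : a%:C * (b +i* c) = (a * b) +i* (a * c).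
Proof. by simpc. Qed.

Lemma Rintegral_version (D : set R) (u : lebesgueTypeR R -> R) (U : R -> R) :
  measurable (D : set (measurableTypeR R)) ->
  measurable_fun (setT : set R) U ->
  {ae mu, forall x, D x -> u x = U x} ->
  (\int[leb]_(x in D) u x)%R = \int[mu]_(x in D) U x.
Proof.
move=> mD mU /ae_leb uU; rewrite /Rintegral; congr fine.
have mDl : measurable (D : set (lebesgueTypeR R)) by exact: leb_measurable.
have mUl : measurable_fun (D : set (lebesgueTypeR R)) U.
  by apply: leb_measurable_fun => //; exact: measurable_funTS.
rewrite (@ae_eq_integral _ (lebesgueTypeR R) _ _ D (fun x => (U x)%:E)) //.
- by apply: integral_leb => //; apply/measurable_EFinP; exact: measurable_funTS.
- by apply/measurable_EFinP; exact: (leb_ae_measurable mDl mUl).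
- exact/measurable_EFinP.
- by apply/ae_leb; move/ae_leb : uU; apply: aeS => x h /h ->.
Qed.

Lemma truncated_hilbert_version f F1 F2 (t e : R) : borel_version f F1 F2 ->
  L1r F1 -> L1r F2 -> -1 < t < 1 -> 0 < e ->
  truncated_hilbert f t e = (pi^-1 * conv (kT e) F1 t) +i* (pi^-1 * conv (kT e) F2 t).
Proof.
move=> [m1 m2 s1 s2 a] L1' L2' /andP[t0 t1] e0.
have E (i : interval R) : (forall x : R, x \in i -> -1 < x < 1) ->
    Cintegral [set` i] (fun x : lebesgueTypeR R => f x / (x - t)%:C) =
    \int[mu]_(x in [set` i]) (F1 x / (x - t)) +i* \int[mu]_(x in [set` i]) (F2 x / (x - t)).
  move=> iI; rewrite /Cintegral; congr (_ +i* _).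
    apply: Rintegral_version; first exact: measurable_itv.
      by apply: measurable_funM => //; apply: measurable_funV; exact: measurable_funB.
    apply: aeS a => x h /= /iI /h ->.
    by rewrite -fmorphV /=; simpc.
  apply: Rintegral_version; first exact: measurable_itv.
    by apply: measurable_funM => //; apply: measurable_funV; exact: measurable_funB.
  apply: aeS a => x h /= /iI /h ->.
  by rewrite -fmorphV /=; simpc.
rewrite /truncated_hilbert !E; first last.
- by move=> x; rewrite in_itv/= => /andP[x0 x1]; rewrite x0/=; lra.
- by move=> x; rewrite in_itv/= => /andP[x0 x1]; rewrite x1 andbT; lra.
by rewrite complexD -!conv_kTE// complexZ.
Qed.

Lemma cvg_complex (u1 u2 : R -> R) (a b : R) :
  u1 e @[e --> 0^'+] --> a -> u2 e @[e --> 0^'+] --> b ->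
  ((u1 e +i* u2 e : (R[i] : numFieldType)) @[e --> 0^'+]) --> (a +i* b : (R[i] : numFieldType)).
Proof.
move=> c1 c2; apply/cvgrPdist_lt => eps; rewrite ltcE /= => /andP[/eqP i0 r0].
have e2 : 0 < complex.Re eps / 2 by rewrite divr_gt0.
near=> x.
have h1 : `|a - u1 x| < complex.Re eps / 2 by near: x; exact: cvgr_dist_lt.
have h2 : `|b - u2 x| < complex.Re eps / 2 by near: x; exact: cvgr_dist_lt.
rewrite normc_def ltcE /= i0 eqxx/=.
by apply: (le_lt_trans (hypot_le _ _)); move: h1 h2 => /=; lra.
Unshelve. all: end_near. Qed.

Lemma fht_version f F1 F2 (t a b : R) : borel_version f F1 F2 ->
  L1r F1 -> L1r F2 -> -1 < t < 1 ->
  conv (kT e) F1 t @[e --> 0^'+] --> a -> conv (kT e) F2 t @[e --> 0^'+] --> b ->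
  fht f t = (pi^-1 * a) +i* (pi^-1 * b).
Proof.
move=> v L1' L2' ht c1 c2; rewrite /fht.
apply: (@cvg_lim (R[i] : numFieldType)); first exact: norm_hausdorff.
have c : ((pi^-1 * conv (kT e) F1 t) +i* (pi^-1 * conv (kT e) F2 t) : (R[i] : numFieldType))
    @[e --> 0^'+] --> ((pi^-1 * a) +i* (pi^-1 * b) : (R[i] : numFieldType)).
  by apply: cvg_complex; apply: cvgM => //; exact: cvg_cst.
apply: cvg_trans c; apply: near_eq_cvg; near=> e.
have e0 : 0 < e by near: e; exact: nbhs_right_gt.
by rewrite (truncated_hilbert_version v L1' L2' ht e0).
Unshelve. all: by end_near. Qed.

End finite_hilbert_transform.

Theorem corollary4p11 (R : realType) :
  @fht_range_LlogL R =
  [set g | L1 g /\ LlogL (fht_hat g) /\ ae_eq_itvm11 (fht (fht_hat g)) g].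
Proof.
(* The inclusion from right to left is immediate: [fht_hat g] is a preimage of [g] in L log L. *)
apply/seteqP; split => g /=; last by move=> [_ [Lg ag]]; exists (fht_hat g).
move=> [f Lf /ae_leb fg].
have [F1 [F2 vf]] := (borel_versionP f).1 Lf.1.
have [Z1 Z2] := (borel_version_LlogL vf).1 Lf.
have L1' := Zyg_L1 Z1; have L2' := Zyg_L1 Z2.
have [G1 [mG1 sG1 LG1 c1]] := hilbert_inversion Z1.
have [G2 [mG2 sG2 LG2 c2]] := hilbert_inversion Z2.
have [m1 m2 s1 s2 af] := vf.
have pi0 : (pi : R) != 0 by rewrite gt_eqF// pi_gt0.
(* [G1] and [G2] are [pi] times the transforms of [F1] and [F2], hence the factor [pi^-1]. *)
have vg : borel_version g (fun x => pi^-1 * G1 x) (fun x => pi^-1 * G2 x).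
  split; [exact: measurable_funM|exact: measurable_funM|..].
  - by move=> x hx; rewrite sG1// mulr0.
  - by move=> x hx; rewrite sG2// mulr0.
  apply: aeS (aeI fg (aeI c1 c2)) => x [hfg [h1 h2]] hx.
  have [h11 _] := h1 hx; have [h21 _] := h2 hx.
  rewrite -hfg; last by rewrite /= in_itv.
  exact: (fht_version vf).
pose H1 x := Sq x * (pi^-1 * G1 x); pose H2 x := Sq x * (pi^-1 * G2 x).
have LSq (G : R -> R) : L1r G -> L1r (fun x => Sq x * G x).
  move=> LG; under eq_fun do rewrite mulrC.
  apply: (@L1rM_bounded _ _ _ 1) => //; first exact: measurable_Sq.
  by move=> x; rewrite (ger0_norm (Sq_ge0 x)) Sq_le1.
have vh : borel_version (fun t => (Num.sqrt (1 - t ^+ 2))%:C * g t) H1 H2.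
  have [n1 n2 t1 t2 a] := vg.
  split; [by apply: measurable_funM => //; exact: measurable_Sq|
          by apply: measurable_funM => //; exact: measurable_Sq|..].
  - by move=> x hx; rewrite /H1 t1// mulr0.
  - by move=> x hx; rewrite /H2 t2// mulr0.
  by apply: aeS a => x h /h ->; rewrite complexZ.
have vhat : borel_version (fht_hat g) (fun x => F1 x - pi^-1 * Int F1 * wt x)
                                      (fun x => F2 x - pi^-1 * Int F2 * wt x).
  split.
  - by apply: measurable_funB => //; apply: measurable_funM => //; exact: measurable_wt.
  - by apply: measurable_funB => //; apply: measurable_funM => //; exact: measurable_wt.
  - by move=> x hx; rewrite s1// wt_supp// mulr0 subr0.
  - by move=> x hx; rewrite s2// wt_supp// mulr0 subr0.
  apply: aeS (aeI c1 c2) => x [h1 h2] hx.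
  have [_ h12] := h1 hx; have [_ h22] := h2 hx.
  (* One component of the inversion formula, after division by [pi]: the division by [- Sq x] hidden
     in [fht_hat] then produces [F - pi^-1 * Int F * wt]. *)
  have cH (H G F : R -> R) : L1r G -> (forall x, H x = Sq x * (pi^-1 * G x)) ->
      conv (kT e) (fun x => Sq x * G x) x @[e --> 0^'+] --> pi * Int F - pi * Sq x * (pi * F x) ->
      conv (kT e) H x @[e --> 0^'+] --> Int F - pi * Sq x * F x.
    move=> LG HE cG.
    have z : pi^-1 * (pi * Int F - pi * Sq x * (pi * F x)) = Int F - pi * Sq x * F x.
      by apply: (mulfI pi0); rewrite mulVKf//; ring.
    rewrite -[X in _ --> X]z.
    have c : pi^-1 * conv (kT e) (fun x => Sq x * G x) x @[e --> 0^'+] -->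
        pi^-1 * (pi * Int F - pi * Sq x * (pi * F x)).
      by apply: cvgM => //; exact: cvg_cst.
    apply: cvg_trans c; apply: near_eq_cvg; near=> e.
    have e0 : 0 < e by near: e; exact: nbhs_right_gt.
    rewrite -(conv_kTZ _ _ (LSq _ LG) e0).
    by apply: eq_Int => y; rewrite HE; ring.
  rewrite /fht_hat (fht_version vh _ _ hx (cH _ _ F1 LG1 _ h12) (cH _ _ F2 LG2 _ h22))//; last 2 first.
  - by apply: LSq; exact: L1rZ.
  - by apply: LSq; exact: L1rZ.
  have S0 : Num.sqrt (1 - x ^+ 2) != 0 by rewrite gt_eqF// Sq_gt0.
  (* [pi] is generalised to an arbitrary nonzero number, so that [field] treats it as an atom. *)
  rewrite complexZ /wt /Sq; move: pi0; generalize (pi : R) => p p0.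
  by congr (_ +i* _); field; rewrite S0 p0.
have Zhat1 : Zyg (fun x => F1 x - pi^-1 * Int F1 * wt x).
  by apply: Zyg_B => //; apply: Zyg_Z; exact: Zyg_wt.
have Zhat2 : Zyg (fun x => F2 x - pi^-1 * Int F2 * wt x).
  by apply: Zyg_B => //; apply: Zyg_Z; exact: Zyg_wt.
split; first by apply: (borel_version_L1 vg); exact: L1rZ.
split; first by apply/(borel_version_LlogL vhat).
apply/ae_leb; have [_ _ _ _ ag] := vg.
apply: aeS (aeI ag (aeI c1 c2)) => t [agt [h1 h2]]; rewrite /= in_itv/= => ht.
have [h11 _] := h1 ht; have [h21 _] := h2 ht.
rewrite (agt ht).
(* The correction by a multiple of [wt] does not affect the transform, since the principal value of
   [wt] is zero. *)
have cw (F : R -> R) (l : R) : L1r F -> conv (kT e) F t @[e --> 0^'+] --> l ->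
    conv (kT e) (fun x => F x - pi^-1 * Int F * wt x) t @[e --> 0^'+] --> l.
  move=> LF cF.
  have z : l - pi^-1 * Int F * 0 = l by rewrite mulr0 subr0.
  rewrite -[X in _ --> X]z.
  have c : conv (kT e) F t - pi^-1 * Int F * conv (kT e) wt t @[e --> 0^'+] -->
      l - pi^-1 * Int F * 0.
    by apply: cvgB => //; apply: cvgM; [exact: cvg_cst|exact: conv_kT_wt_cvg].
  apply: cvg_trans c; apply: near_eq_cvg; near=> e.
  have Lw := (@wt_int R).1.
  have e0 : 0 < e by near: e; exact: nbhs_right_gt.
  rewrite (convB t (measurable_kT e) (fun u => kT_le u e0) LF (L1rZ _ Lw)).
  by rewrite conv_kTZ.
by apply: (fht_version vhat) => //; [exact: Zyg_L1|exact: Zyg_L1|exact: cw|exact: cw].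
Unshelve. all: end_near. Qed.
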